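(* Let $\alpha\in(0,1)$ and $p\in(1,+\infty)$. If $f\in W^{1,p}(\mathbb{R}^n)$, then $f\in S^{\alpha,p}(\mathbb{R}^n)$ with $$\|\nabla^\alpha_w f\|_{L^p(A;\,\mathbb{R}^n)}\le\frac{n\omega_n\mu_{n,\alpha}}{n+\alpha-1}\left(\frac{\|\nabla_w f\|_{L^p(\overline{A_r};\,\mathbb{R}^n)}}{1-\alpha}\,r^{1-\alpha}+\frac{n+2\alpha-1}{\alpha}\,\|f\|_{L^p(\mathbb{R}^n)}\,r^{-\alpha}\right)$$ for any $r>0$ and any open set $A\subset\mathbb{R}^n$, where $A_r:=\{x\in\mathbb{R}^n:\mathrm{dist}(x,A)<r\}$. In particular, $$\|\nabla^\alpha_w f\|_{L^p(\mathbb{R}^n;\,\mathbb{R}^n)}\le\frac{(n+2\alpha-1)^{1-\alpha}}{n+\alpha-1}\,\frac{n\omega_n\mu_{n,\alpha}}{\alpha(1-\alpha)}\,\|\nabla_w f\|^\alpha_{L^p(\mathbb{R}^n;\,\mathbb{R}^n)}\,\|f\|^{1-\alpha}_{L^p(\mathbb{R}^n)}.$$ In addition, if $p\in\big(1,\frac{n}{1-\alpha}\big)$ and $q=\frac{np}{n-(1-\alpha)p}$, then $$\nabla^\alpha_w f=I_{1-\alpha}\nabla_w f\quad\text{a.e. in }\mathbb{R}^n$$ and $\nabla^\alpha_w f\in L^q(\mathbb{R}^n;\mathbb{R}^n)$.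
   Context: Here $n\in\mathbb{N}$, $n\ge1$, $\omega_n$ is the volume of the unit ball of $\mathbb{R}^n$, and $\nabla_w f$ is the weak gradient. For $\alpha\in(0,1)$ let $\mu_{n,\alpha}:=2^\alpha\pi^{-n/2}\,\Gamma\big(\tfrac{n+\alpha+1}{2}\big)/\Gamma\big(\tfrac{1-\alpha}{2}\big)$, and for $\varphi\in C^\infty_c(\mathbb{R}^n;\mathbb{R}^n)$ let $$\mathrm{div}^\alpha\varphi(x):=\mu_{n,\alpha}\int_{\mathbb{R}^n}\frac{(y-x)\cdot(\varphi(y)-\varphi(x))}{|y-x|^{n+\alpha+1}}\,dy,\qquad x\in\mathbb{R}^n,$$ which belongs to $L^q(\mathbb{R}^n)$ for all $q\in[1,+\infty]$. For $f\in L^p(\mathbb{R}^n)$, the weak fractional $\alpha$-gradient $\nabla^\alpha_w f\in L^1_{\rm loc}(\mathbb{R}^n;\mathbb{R}^n)$ is the (unique, if it exists) function such that $\int f\,\mathrm{div}^\alpha\varphi\,dx=-\int\nabla^\alpha_w f\cdot\varphi\,dx$ for all $\varphi\in C^\infty_c(\mathbb{R}^n;\mathbb{R}^n)$, and $S^{\alpha,p}(\mathbb{R}^n):=\{f\in L^p(\mathbb{R}^n):\exists\,\nabla^\alpha_w f\in L^p(\mathbb{R}^n;\mathbb{R}^n)\}$. The Riesz potential of order $1-\alpha$ is $$I_{1-\alpha}u(x):=\frac{\mu_{n,\alpha}}{n+\alpha-1}\int_{\mathbb{R}^n}\frac{u(y)}{|x-y|^{n+\alpha-1}}\,dy,$$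 which for $p\in(1,\frac{n}{1-\alpha})$ is a continuous linear operator $L^p(\mathbb{R}^n;\mathbb{R}^n)\to L^q(\mathbb{R}^n;\mathbb{R}^n)$ with $\frac1q=\frac1p-\frac{1-\alpha}{n}$. *)

(* Defs.v *)
From HB Require Import structures.
From mathcomp Require Import all_boot all_order all_algebra.
From mathcomp Require Import all_classical all_reals all_analysis.

Set Implicit Arguments.
Unset Strict Implicit.
Unset Printing Implicit Defensive.
Import Order.TTheory GRing.Theory Num.Theory.
Import numFieldNormedType.Exports.
Local Open Scope classical_set_scope.
Local Open Scope ring_scope.

(* 'rV[R]_n carries its Borel sigma-algebra. *)
Definition borel_rV_display : measure_display.
Proof. exact: default_measure_display. Qed.

HB.instance Definition _ (R : realType) (n : nat) :=
  @isMeasurable.Build borel_rV_display 'rV[R]_n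
    <<s [set A : set 'rV[R]_n | open A] >>
    (@sigma_algebra0 _ _ _) (@sigma_algebraC _ _) (@sigma_algebra_bigcup _ _ _).

Section lebesgue_rV.
Context {R : realType}.

Definition consrV n (x : measurableTypeR R * 'rV[R]_n) : 'rV[R]_n.+1 :=
  \row_i oapp (x.2 ord0) x.1 (unlift ord0 i).

Definition unconsrV n (x : 'rV[R]_n.+1) : measurableTypeR R * 'rV[R]_n :=
  (x ord0 ord0, \row_j x ord0 (lift ord0 j)).

Lemma consrVK n : cancel (@consrV n) (@unconsrV n).
Proof.
move=> [a v]; congr pair; first by rewrite mxE unlift_none.
by apply/rowP => j; rewrite !mxE liftK.
Qed.

Lemma open_measurable_rV n (A : set 'rV[R]_n) : open A -> measurable A.
Proof. exact: sub_sigma_algebra. Qed.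

Lemma open_measurable_prod n (A : set (R * 'rV[R]_n)) :
  open A -> measurable (A : set (measurableTypeR R * 'rV[R]_n)).
Proof.
move=> oA.
pose c (i : rat * 'rV[rat]_n * nat) : R * 'rV[R]_n :=
  (ratr i.1.1, map_mx ratr i.1.2).
pose B i := ball (c i) (i.2.+1%:R^-1 : R).
pose F i := if `[< B i `<=` A >] then B i else set0.
suff -> : A = \bigcup_i F i.
  apply: countable_bigcupT_measurable; first exact: countableP.
  move=> i; rewrite /F; case: ifP => _; last exact: measurable0.
  have -> : B i = ball (c i).1 (i.2.+1%:R^-1 : R) `*`
                  ball (c i).2 (i.2.+1%:R^-1 : R) by [].
  apply: measurableX.
    by apply: measurable_realfun.open_measurable; apply: ball_open; rewrite invr_gt0.
  by apply: open_measurable_rV; apply: ball_open; rewrite invr_gt0.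
rewrite eqEsubset; split=> [x Ax|x [i _]]; last first.
  by rewrite /F; case: ifP => [/asboolP + Bx|//]; apply.
have /nbhs_ballP[e /= e0 eA] : nbhs x A by exact: open_nbhs_nbhs.
have [k] : exists k : nat, k.+1%:R^-1 < e / 2.
  have := near_infty_natSinv_lt (PosNum (divr_gt0 e0 (ltr0n R 2))).
  by case => k _ /(_ k (leqnn _)) /= ke; exists k.
set d := k.+1%:R^-1 => de.
have d0 : 0 < d by rewrite invr_gt0.
have ratP (a : R) : exists q : rat, `|ratr q - a| < d.
  have [|q] := @rat_in_itvoo R (a - d) (a + d); first by rewrite ltrD2l gtrN.
  by rewrite in_itv /= -ltr_distl => qd; exists q.
have [q qx] := ratP x.1.
have [v vx] := choice (fun j => ratP (x.2 ord0 j)).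
pose i := (q, \row_j v j, k).
have Bix : B i x.
  split; first by rewrite /ball /= /c /=.
  split=> [|a j]; first by rewrite invr_gt0.
  by rewrite ord1 /ball /= !mxE; exact: vx.
exists i => //; rewrite /F ifT//; apply/asboolP => y Biy; apply: eA.
have /ball_sym Bxi := Bix.
apply: le_ball (ball_triangle Bxi Biy).
by rewrite [leRHS](splitr e) lerD// ltW.
Qed.

Lemma measurable_consrV n : measurable_fun setT (@consrV n).
Proof.
apply: (measurability [set A : set 'rV[R]_n.+1 | open A]) => //.
move=> _ [A /= oA <-]; rewrite setTI; apply: open_measurable_prod.
apply: open_comp oA => x _; apply/cvg_ballP => e e0.
have /filterS := @nbhsx_ballx R _ x e e0; apply => y [xy1 [_ xy2]].
split=> // i j; rewrite /consrV !mxE.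
by case: unliftP => [k|] _ /=; [exact: xy2 | exact: xy1].
Qed.

Lemma measurable_coord n (i : 'I_n) :
  measurable_fun setT (fun x : 'rV[R]_n => x ord0 i : measurableTypeR R).
Proof.
apply: (measurability (@measurable_realfun.RGenOpens.G R)).
  exact: measurable_realfun.RGenOpens.measurableE.
move=> _ [_ [a [b ->]] <-]; rewrite setTI; apply: open_measurable_rV.
apply: open_comp; last exact: interval_open.
by move=> x _; exact: coord_continuous.
Qed.

Lemma measurable_unconsrV n : measurable_fun setT (@unconsrV n).
Proof.
apply: measurable_fun_pair; first exact: measurable_coord.
apply: (measurability [set A : set 'rV[R]_n | open A]) => //.
move=> _ [A /= oA <-]; rewrite setTI; apply: open_measurable_rV.
suff tailC : continuous (fun x : 'rV[R]_n.+1 => (\row_j x ord0 (lift ord0 j)) : 'rV[R]_n).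
  by apply: open_comp oA => x _; exact: tailC.
move=> x B /nbhs_ballP[e /= e0 eB]; apply/nbhs_ballP; exists e => //= y [_ xy].
by apply: eB; split=> // i j; rewrite !mxE ord1; exact: xy.
Qed.

Section lebesgue_cons.
Context n (m : {sigma_finite_measure set 'rV[R]_n -> \bar R}).

Definition lebesgue_cons : set 'rV[R]_n.+1 -> \bar R :=
  pushforward (lebesgue_measure \x m)%E (@consrV n).

HB.instance Definition _ := Measure.copy lebesgue_cons
  (measure_function_pushforward__canonical__measure_function_Measure
    [the measure _ _ of (lebesgue_measure \x m)%E] (@measurable_consrV n)).

Let sigma_finite_cons : sigma_finite setT lebesgue_cons.
Proof.
have /sigma_finiteP[F [TF ndF Foo]] := sigma_finiteT (@lebesgue_measure R).
have /sigma_finiteP[G [TG ndG Goo]] := sigma_finiteT m.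
exists (fun k => @unconsrV n @^-1` (F k `*` G k)).
  rewrite -preimage_bigcup; apply/esym; rewrite -subTset => x _ /=.
  have [k _ Fk] : (\bigcup_k F k) (unconsrV x).1 by rewrite -TF.
  have [l _ Gl] : (\bigcup_k G k) (unconsrV x).2 by rewrite -TG.
  exists (maxn k l) => //; split.
  - by move: (_.1) Fk; exact/subsetPset/ndF/leq_maxl.
  - by move: (_.2) Gl; exact/subsetPset/ndG/leq_maxr.
move=> k; have [mF Ffin] := Foo k; have [mG Gfin] := Goo k.
have mFG : measurable (F k `*` G k) by exact: measurableX.
split.
  by rewrite -[X in measurable X]setTI; exact: measurable_unconsrV.
rewrite /lebesgue_cons /pushforward -comp_preimage.
rewrite (_ : _ \o _ = id) ?preimage_id; last first.
  by apply/funext => x /=; rewrite consrVK.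
by rewrite product_measure1E// lte_mul_pinfty// ge0_fin_numE.
Qed.

HB.instance Definition _ :=
  Measure_isSigmaFinite.Build _ _ _ lebesgue_cons sigma_finite_cons.
End lebesgue_cons.

(* n-fold product of lebesgue_measure; the library has no n-dimensional one *)
Fixpoint lebesgue_rV n : {sigma_finite_measure set 'rV[R]_n -> \bar R} :=
  match n with
  | 0 => @dirac _ 'rV[R]_0 (const_mx 0) R
  | k.+1 => lebesgue_cons (lebesgue_rV k)
  end.

Lemma lebesgue_rV_box n (A : 'I_n -> set (measurableTypeR R)) :
  (forall i, measurable (A i)) ->
  lebesgue_rV n [set x | forall i, A i (x ord0 i)] =
  (\prod_i lebesgue_measure (A i))%E.
Proof.
elim: n A => [|n IH] A mA.
  by rewrite big_ord0 /= diracE mem_set// => -[].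
rewrite big_ord_recl -IH//= /lebesgue_cons /pushforward.
rewrite -product_measure1E//; last first.
  rewrite -[X in measurable X]setCK; apply: measurableC.
  rewrite (_ : ~` _ = \bigcup_i
      ~` ((fun x : 'rV[R]_n => x ord0 i) @^-1` A (lift ord0 i))); last first.
    apply/seteqP; split=> x /=; first by move/existsNP => [i ?]; exists i.
    by move=> [i _ /= Ai] h; exact/Ai/h.
  apply: countable_bigcupT_measurable => [|i]; first exact: countableP.
  by apply: measurableC; rewrite -[X in measurable X]setTI; exact: measurable_coord.
congr (_ _); apply/seteqP; split=> -[a v] /=.
  move=> h; split=> [|i]; first by have := h ord0; rewrite mxE unlift_none.
  by have := h (lift ord0 i); rewrite mxE liftK.
move=> [Aa Av] i; rewrite mxE; case: unliftP => [j|] -> //=.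
Qed.

End lebesgue_rV.

Section euclidean.
Context {R : realType} {n : nat}.
Implicit Types (x y : 'rV[R]_n) (A : set 'rV[R]_n).

Definition dotrV x y : R := \sum_i x ord0 i * y ord0 i.

(* The library norm on 'rV[R]_n is the sup norm (same topology). *)
Definition enorm x : R := Num.sqrt (dotrV x x).

(* +oo when A is empty *)
Definition edist_rV x A : \bar R := ereal_inf [set (enorm (x - a))%:E | a in A].

Definition enlarge A (r : R) : set 'rV[R]_n :=
  [set x | (edist_rV x A < r%:E)%E].

End euclidean.

Section constants.
Context {R : realType}.

Definition Gamma (s : R) : R :=
  \int[lebesgue_measure]_(t in `]0, +oo[) (t `^ (s - 1) * expR (- t)).

Definition mu_const (n : nat) (alpha : R) : R :=
  2 `^ alpha * pi `^ (- (n%:R / 2)) *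
  Gamma ((n%:R + alpha + 1) / 2) / Gamma ((1 - alpha) / 2).

Definition omega (n : nat) : R :=
  fine (lebesgue_rV n [set x : 'rV[R]_n | enorm x < 1]).

End constants.

Section test_fields.
Context {R : realType} {n : nat}.
Implicit Types phi : 'rV[R]_n -> 'rV[R]_n.

Definition iter_pderiv (s : seq 'I_n) phi : 'rV[R]_n -> 'rV[R]_n :=
  foldr (fun i g => 'D_(delta_mx ord0 i) g) phi s.

Definition smooth phi := forall s : seq 'I_n,
  continuous (iter_pderiv s phi) /\
  forall i x, derivable (iter_pderiv s phi) x (delta_mx ord0 i).

Definition test_field phi :=
  smooth phi /\ compact (closure [set x | phi x != 0]).

Definition divergence phi (x : 'rV[R]_n) : R :=
  \sum_i ('D_(delta_mx ord0 i) phi x) ord0 i.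

(* The integrand is 0 at y = x, since inverses of 0 are 0. *)
Definition fdivergence (alpha : R) phi (x : 'rV[R]_n) : R :=
  mu_const n alpha *
  \int[lebesgue_rV n]_y
    (dotrV (y - x) (phi y - phi x) / enorm (y - x) `^ (n%:R + alpha + 1)).

End test_fields.

Section function_spaces.
Context {R : realType} {n : nat}.
Implicit Types (f : 'rV[R]_n -> R) (g u : 'rV[R]_n -> 'rV[R]_n).

(* Elements of the Lebesgue spaces are Borel representatives. *)
Definition Lp (p : R) f := f \in Lfun (lebesgue_rV n) p%:E.

Definition Lp_field (p : R) g :=
  measurable_fun setT g /\ Lp p (enorm \o g).

Definition L1loc_field g :=
  measurable_fun setT g /\
  forall K : set 'rV[R]_n, compact K ->
    (lebesgue_rV n).-integrable K (EFin \o (enorm \o g)).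

Definition Lp_norm (A : set 'rV[R]_n) (p : R) f : \bar R :=
  ('N[lebesgue_rV n]_p%:E[EFin \o (f \_ A)])%E.

Definition Lp_norm_field (A : set 'rV[R]_n) (p : R) g : \bar R :=
  Lp_norm A p (enorm \o g).

(* g is minus the distributional adjoint of the divergence operator dv on f *)
Definition weak_adjoint (dv : ('rV[R]_n -> 'rV[R]_n) -> 'rV[R]_n -> R) f g :=
  L1loc_field g /\
  forall phi, test_field phi ->
    \int[lebesgue_rV n]_x (f x * dv phi x) =
    - \int[lebesgue_rV n]_x dotrV (g x) (phi x).

Definition is_weak_grad f g := weak_adjoint divergence f g.

Definition is_weak_fgrad (alpha : R) f g :=
  weak_adjoint (fdivergence alpha) f g.

Definition W1p (p : R) f :=
  Lp p f /\ exists g, is_weak_grad f g /\ Lp_field p g.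

Definition Sap (alpha p : R) f :=
  Lp p f /\ exists g, is_weak_fgrad alpha f g /\ Lp_field p g.

(* Riesz potential of order 1 - alpha, componentwise *)
Definition riesz (alpha : R) u (x : 'rV[R]_n) : 'rV[R]_n :=
  \row_i (mu_const n alpha / (n%:R + alpha - 1) *
    \int[lebesgue_rV n]_y
      (u y ord0 i / enorm (x - y) `^ (n%:R + alpha - 1))).

End function_spaces.

(* Main.v *)
(* Put a = n + alpha - 1, c = mu / a, kappa(h) = |h|^-a. For every r > 0 the
   weak fractional gradient of f is
     c (kappa1 * D f) - mu (K2 * f),
   where kappa1(h) = |h|^-a - r^-a for |h| < r and 0 elsewhere, and
   K2(h) = h |h|^(-a-2) for |h| >= r. Indeed, integrating by parts against the
   Lipschitz kernel max(|h|, s)^-a and letting s -> 0 gives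
     div^alpha phi (x) = c int kappa(h) div phi (x + h) dh,
   and the same integration by parts at s = r moves the derivative off the far
   part of kappa; there is no surface term because kappa1 vanishes on the
   sphere |h| = r. Since kappa1 is supported in the ball of radius r, with
   |kappa1|_1 <= n omega r^(1-alpha) / (1-alpha) and
   |K2|_1 <= n omega r^-alpha / alpha, Young's inequality gives the local
   estimate, and optimizing in r the interpolation inequality. For
   p < n / (1 - alpha), letting r -> oo identifies the gradient with the Riesz
   potential: the convolution kappa * |D f| is in L^q, hence finite almost
   everywhere, by the Hardy-Littlewood-Sobolev inequality. Weak gradients are
   unique because a function annihilated by all products of one-dimensional
   smooth bumps vanishes almost everywhere. *)

From HB Require Import structures.
Require Import Defs.
From mathcomp Require Import all_boot all_order all_algebra.
From mathcomp Require Import all_classical all_reals all_analysis.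
From mathcomp Require Import measurable_realfun ring lra.

Set Implicit Arguments.
Unset Strict Implicit.
Unset Printing Implicit Defensive.
Import Order.TTheory GRing.Theory Num.Theory.
Import numFieldNormedType.Exports.
Local Open Scope classical_set_scope.
Local Open Scope ring_scope.

(** The splitting at radius [r] answers a lack of integrability: the full kernel |h|^-a is not
    integrable at infinity, whereas [kappa1] and [K2] are both integrable, so that every exchange of
    integrals is absolute and all terms stay in L^p. Each [r] gives a version of the same weak
    gradient, and uniqueness turns an estimate of one version into an estimate of all. The cap at
    [s] makes the kernel bounded and globally Lipschitz: integration by parts then follows from
    translation invariance, applied to difference quotients, and dominated convergence, without a
    divergence theorem on balls. Spherical integrals are likewise avoided: the image of Lebesgue
    measure under x -> |x|^n is omega_n times Lebesgue measure on the half-line. As for the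
    constant, the argument itself yields n + alpha - 1 where n + 2 alpha - 1 is stated; the larger
    value enters only at the end, and it is the one for which the radius is optimized. *)

(** * Borel measurability of vector-valued maps *)

Section row_measurability.
Context {R : realType}.

(** By induction on the dimension, a row is rebuilt from its head and tail by the measurable map
    [consrV]; this avoids comparing the Borel sigma-algebra of rows with a product sigma-algebra. *)
Lemma measurable_fun_rV d (T : measurableType d) n (g : T -> 'rV[R]_n) :
  (forall i, measurable_fun setT (fun x => g x ord0 i : measurableTypeR R)) ->
  measurable_fun setT g.
Proof.
elim: n g => [|n IH] g mg.
  have -> : g = cst (0 : 'rV[R]_0).
    by apply/funext => x; apply/rowP => -[].
  exact: measurable_cst.
have -> : g = @consrV R n \o
    (fun x => (g x ord0 ord0 : measurableTypeR R,
               \row_j g x ord0 (lift ord0 j))).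
  apply/funext => x; apply/rowP => i; rewrite /= mxE /=.
  by case: unliftP => [j|] -> //=; rewrite mxE.
apply: measurableT_comp; first exact: measurable_consrV.
apply: measurable_fun_pair; first exact: mg.
apply: IH => i; under eq_fun do rewrite mxE.
exact: mg.
Qed.

Lemma measurable_fun_rVD d (T : measurableType d) n (f g : T -> 'rV[R]_n) :
  measurable_fun setT f -> measurable_fun setT g ->
  measurable_fun setT (fun x => f x + g x).
Proof.
move=> mf mg; apply: measurable_fun_rV => i; under eq_fun do rewrite mxE.
apply: measurable_funD.
- exact: measurableT_comp (measurable_coord i) mf.
- exact: measurableT_comp (measurable_coord i) mg.
Qed.

Lemma measurable_fun_rVZ d (T : measurableType d) n (k : R) (f : T -> 'rV[R]_n) :
  measurable_fun setT f -> measurable_fun setT (fun x => k *: f x).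
Proof.
move=> mf; apply: measurable_fun_rV => i; under eq_fun do rewrite mxE.
apply: measurable_funM => //.
exact: measurableT_comp (measurable_coord i) mf.
Qed.

Lemma measurable_fun_rVN d (T : measurableType d) n (f : T -> 'rV[R]_n) :
  measurable_fun setT f -> measurable_fun setT (fun x => - f x).
Proof.
by move=> mf; under eq_fun do rewrite -scaleN1r; exact: measurable_fun_rVZ.
Qed.

Lemma measurable_fun_rVB d (T : measurableType d) n (f g : T -> 'rV[R]_n) :
  measurable_fun setT f -> measurable_fun setT g ->
  measurable_fun setT (fun x => f x - g x).
Proof. by move=> mf mg; apply: measurable_fun_rVD => //; exact: measurable_fun_rVN. Qed.

Lemma measurable_dotrV d (T : measurableType d) n (f g : T -> 'rV[R]_n) :
  measurable_fun setT f -> measurable_fun setT g ->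
  measurable_fun setT (fun x => dotrV (f x) (g x)).
Proof.
move=> mf mg; rewrite /dotrV; apply: measurable_sum => i.
apply: measurable_funM.
- exact: measurableT_comp (measurable_coord i) mf.
- exact: measurableT_comp (measurable_coord i) mg.
Qed.

Lemma measurable_enorm n : measurable_fun setT (@enorm R n).
Proof.
apply: (@measurableT_comp _ _ _ _ _ _ (@Num.sqrt R)).
  by apply: continuous_measurable_fun; exact: sqrt_continuous.
exact: measurable_dotrV.
Qed.

Lemma continuous_measurable_rV n (f : 'rV[R]_n -> R) :
  continuous f -> measurable_fun setT f.
Proof.
move=> cf; apply: (measurability _ (measurable_realfun.RGenOpens.measurableE R)).
move=> _ [_ [a [b ->]] <-]; rewrite setTI; apply: open_measurable_rV.
by apply: open_comp; [move=> x _; exact: cf|exact: interval_open].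
Qed.

Lemma closed_measurable_rV n (A : set 'rV[R]_n) : closed A -> measurable A.
Proof.
by move=> cA; rewrite -(setCK A); apply: measurableC; apply: open_measurable_rV; exact: closed_openC.
Qed.

End row_measurability.

(** * The Euclidean inner product and norm *)

Section euclidean_norm.
Context {R : realType} {n : nat}.
Implicit Types x y : 'rV[R]_n.

Lemma dotrVxx_ge0 x : 0 <= dotrV x x.
Proof. by apply: sumr_ge0 => i _; rewrite -expr2 sqr_ge0. Qed.

Lemma enorm_ge0 x : 0 <= enorm x.
Proof. exact: sqrtr_ge0. Qed.

Lemma sqr_enorm x : enorm x ^+ 2 = dotrV x x.
Proof. by rewrite sqr_sqrtr// dotrVxx_ge0. Qed.

Lemma dotrVC x y : dotrV x y = dotrV y x.
Proof. by apply: eq_bigr => i _; rewrite mulrC. Qed.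

Lemma dotrVDl x y z : dotrV (x + y) z = dotrV x z + dotrV y z.
Proof. by rewrite -big_split/=; apply: eq_bigr => i _; rewrite mxE mulrDl. Qed.

Lemma dotrVDr x y z : dotrV z (x + y) = dotrV z x + dotrV z y.
Proof. by rewrite dotrVC dotrVDl !(dotrVC z). Qed.

Lemma dotrVZl k x y : dotrV (k *: x) y = k * dotrV x y.
Proof. by rewrite /dotrV mulr_sumr; apply: eq_bigr => i _; rewrite mxE mulrA. Qed.

Lemma dotrVZr k x y : dotrV x (k *: y) = k * dotrV x y.
Proof. by rewrite dotrVC dotrVZl dotrVC. Qed.

Lemma dotrVNl x y : dotrV (- x) y = - dotrV x y.
Proof. by rewrite -scaleN1r dotrVZl mulN1r. Qed.

Lemma dotrVNr x y : dotrV x (- y) = - dotrV x y.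
Proof. by rewrite dotrVC dotrVNl dotrVC. Qed.

Lemma enormZ k x : enorm (k *: x) = `|k| * enorm x.
Proof.
by rewrite /enorm dotrVZl dotrVZr mulrA -expr2 sqrtrM ?sqr_ge0// sqrtr_sqr.
Qed.

Lemma enormN x : enorm (- x) = enorm x.
Proof. by rewrite -scaleN1r enormZ normrN1 mul1r. Qed.

Lemma enorm0 : enorm (0 : 'rV[R]_n) = 0.
Proof. by rewrite -(scale0r (0 : 'rV[R]_n)) enormZ normr0 mul0r. Qed.

Lemma enorm_eq0 x : (enorm x == 0) = (x == 0).
Proof.
apply/idP/idP => [|/eqP ->]; last by rewrite enorm0.
rewrite -sqrf_eq0 sqr_enorm psumr_eq0 => [/allP h|i _]; last by rewrite -expr2 sqr_ge0.
apply/eqP/rowP => i; rewrite mxE; apply/eqP.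
by have := h i (mem_index_enum _); rewrite /= mulf_eq0 orbb.
Qed.

Lemma enorm_gt0 x : (0 < enorm x) = (x != 0).
Proof. by rewrite lt_def enorm_ge0 andbT enorm_eq0. Qed.

Lemma coord_le_enorm x i : `|x ord0 i| <= enorm x.
Proof.
rewrite -sqrtr_sqr ler_sqrt ?dotrVxx_ge0// /dotrV (bigD1 i)//= expr2 lerDl.
by apply: sumr_ge0 => j _; rewrite -expr2 sqr_ge0.
Qed.

Lemma normr_dotrV x y : `|dotrV x y| <= enorm x * enorm y.
Proof.
rewrite -ler_sqr ?nnegrE ?normr_ge0 ?mulr_ge0 ?enorm_ge0// exprMn !sqr_enorm.
rewrite real_normK ?num_real//; have [->|y0] := eqVneq y 0.
  have d0 z : dotrV z 0 = 0 :> R by apply: big1 => i _; rewrite mxE mulr0.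
  by rewrite !d0 expr0n mulr0.
have y2 : 0 < dotrV y y by rewrite -sqr_enorm exprn_gt0// enorm_gt0.
(* The squared norm of [(y.y) x - (x.y) y] expands to [C (A C - B^2)], and [C > 0] can be divided
   out. *)
have := dotrVxx_ge0 (dotrV y y *: x - dotrV x y *: y).
rewrite !dotrVDl !dotrVDr !dotrVNl !dotrVNr !dotrVZl !dotrVZr (dotrVC y x).
set A := dotrV x x; set B := dotrV x y; set C := dotrV y y in y2 *.
rewrite (_ : _ + _ = C * (A * C - B ^+ 2)); last by ring.
by rewrite pmulr_rge0// subr_ge0.
Qed.

Lemma ler_enormD x y : enorm (x + y) <= enorm x + enorm y.
Proof.
rewrite -ler_sqr ?nnegrE ?addr_ge0 ?enorm_ge0// sqrrD !sqr_enorm.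
rewrite dotrVDl !dotrVDr (dotrVC y x).
have := le_trans (ler_norm _) (normr_dotrV x y); set N := enorm x * _.
lra.
Qed.

Lemma ler_enormB x y : `|enorm x - enorm y| <= enorm (x - y).
Proof.
have H (a b : 'rV[R]_n) : enorm a <= enorm (a - b) + enorm b.
  by have := ler_enormD (a - b) b; rewrite subrK.
rewrite ler_norml; have := H x y; have := H y x.
rewrite -(enormN (y - x)) opprB; lra.
Qed.

Lemma enorm_delta i : enorm (delta_mx ord0 i : 'rV[R]_n) = 1.
Proof.
rewrite /enorm /dotrV (bigD1 i)//= mxE !eqxx mulr1 big1 ?addr0 ?sqrtr1// => j ji.
by rewrite mxE (negbTE ji) andbF mulr0.
Qed.

Lemma enorm_le_sum x : enorm x <= \sum_i `|x ord0 i|.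
Proof.
rewrite [in leLHS](row_sum_delta x).
elim/big_ind2 : _ => [|a b c d ab cd|i _]; first by rewrite enorm0.
  by rewrite (le_trans (ler_enormD _ _))// lerD.
by rewrite enormZ enorm_delta mulr1.
Qed.

End euclidean_norm.

(** * Lebesgue measure on row vectors *)

Section lebesgue_rV_transformations.
Context {R : realType}.
Local Open Scope ereal_scope.
Notation leb := (@lebesgue_measure R).

(** Tonelli for the recursive construction of [lebesgue_rV]; the changes of variables below induct
    on the dimension through it. *)
Lemma ge0_integral_consrV n (f : 'rV[R]_n.+1 -> \bar R) :
  measurable_fun setT f -> (forall x, 0 <= f x) ->
  \int[lebesgue_rV n.+1]_x f x =
  \int[leb]_a \int[lebesgue_rV n]_v f (consrV (a, v)).
Proof.
move=> mf f0.
rewrite (_ : \int[_]_x _ = \int[pushforward (leb \x lebesgue_rV n) (@consrV R n)]_x f x)//.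
rewrite ge0_integral_pushforward//; last exact: measurable_consrV.
rewrite preimage_setT fubini_tonelli1//; last by move=> x /=.
by apply: measurableT_comp => //; exact: measurable_consrV.
Qed.

Lemma measurable_fun_fubini_consrV n (f : 'rV[R]_n.+1 -> \bar R) :
  measurable_fun setT f -> (forall x, 0 <= f x) ->
  measurable_fun setT (fun a : measurableTypeR R => \int[lebesgue_rV n]_v f (consrV (a, v))).
Proof.
move=> mf f0.
apply: (@measurable_fun_fubini_tonelli_F _ _ _ _ _ (lebesgue_rV n) (f \o @consrV R n)); last by move=> x; exact: f0.
by apply: measurableT_comp => //; exact: measurable_consrV.
Qed.

(** The pushforward under the affine map, rescaled by [s], agrees with Lebesgue measure on half-open
    intervals, hence everywhere by uniqueness. *)
Lemma lebesgue_measure_affine (s v : R) (A : set R) : (0 < s)%R -> measurable A ->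
  leb ((fun x => s * x + v)%R @^-1` A) = s^-1%:E * leb A.
Proof.
move=> s0 mA; have s10 : (0 <= s)%R by exact: ltW.
have mf : measurable_fun setT ((fun x => s * x + v)%R : measurableTypeR R -> measurableTypeR R).
  by apply: measurable_funD => //; exact: measurable_funM.
pose m := [the measure _ _ of mscale (NngNum s10) (measure_function_pushforward__canonical__measure_function_Measure [the measure _ _ of leb] mf)].
suff /(_ A mA) -> : forall A, measurable A -> leb A = m A.
  by rewrite /m /= /mscale/= /pushforward muleA -EFinM mulVf ?gt_eqF// mul1e.
apply: lebesgue_measure_unique.
move=> _ [[a b] /= ab <-]; rewrite /m/= /mscale/= /pushforward.
have -> : (fun x => s * x + v)%R @^-1` `]a, b]%classic = `]((a - v) / s)%R, ((b - v) / s)%R]%classic.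
  apply/seteqP; split=> x /=; rewrite !in_itv/= ltr_pdivrMr// ler_pdivlMr// ltrBlDr lerBrDr mulrC//.
rewrite !lebesgue_measure_itv/= !lte_fin ltr_pM2r ?invr_gt0// ltrD2r; case: ifP => _; last by rewrite mule0.
by rewrite -!EFinD -EFinM; congr EFin; field; rewrite gt_eqF.
Qed.

Lemma ge0_integral_affine (s v : R) (f : R -> \bar R) : (0 < s)%R ->
  measurable_fun setT f -> (forall x, 0 <= f x) ->
  \int[leb]_x f (s * x + v)%R = s^-1%:E * \int[leb]_x f x.
Proof.
move=> s0 mf f0; have s10 : (0 <= s^-1)%R by rewrite invr_ge0 ltW.
have mg : measurable_fun setT ((fun x => s * x + v)%R : measurableTypeR R -> measurableTypeR R).
  by apply: measurable_funD => //; exact: measurable_funM.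
have := @ge0_integral_pushforward _ _ _ _ R _ mg leb setT f measurableT mf (fun x _ => f0 x).
rewrite preimage_setT /= => <-.
rewrite -(ge0_integral_mscale _ measurableT (NngNum s10))//.
apply: eq_measure_integral => A mA _.
exact: lebesgue_measure_affine.
Qed.

Lemma ge0_integral_opp1 (f : R -> \bar R) :
  measurable_fun setT f -> (forall x, 0 <= f x) ->
  \int[leb]_x f (- x)%R = \int[leb]_x f x.
Proof.
move=> mf f0.
have mg : measurable_fun setT ((fun x => - x)%R : measurableTypeR R -> measurableTypeR R).
  by exact: measurable_funN.
have := @ge0_integral_pushforward _ _ _ _ R _ mg leb setT f measurableT mf (fun x _ => f0 x).
rewrite preimage_setT /= => <-.
by apply: eq_measure_integral => A mA _; exact: lebesgue_measureN.
Qed.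

(** Each coordinate contributes one factor [s^-1]: the head variable by the one-dimensional formula,
    the tail by induction. *)
Lemma ge0_integral_rV_affine n (s : R) (v : 'rV[R]_n) (f : 'rV[R]_n -> \bar R) :
  (0 < s)%R -> measurable_fun setT f -> (forall x, 0 <= f x) ->
  \int[lebesgue_rV n]_x f (s *: x + v)%R =
  (s^-1 ^+ n)%:E * \int[lebesgue_rV n]_x f x.
Proof.
move=> s0; elim: n v f => [|n IH] v f mf f0.
  rewrite expr0 mul1e; apply: eq_integral => x _; congr f.
  by apply/rowP => -[].
have maff : measurable_fun setT (fun x : 'rV[R]_n.+1 => f (s *: x + v)%R).
  apply: measurableT_comp => //; apply: measurable_fun_rVD => //.
  exact: measurable_fun_rVZ.
rewrite !ge0_integral_consrV//.
pose w := (\row_j v ord0 (lift ord0 j))%R : 'rV[R]_n.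
have E a u : (s *: consrV (a, u) + v = consrV (s * a + v ord0 ord0, s *: u + w))%R.
  apply/rowP => i; rewrite !mxE/=.
  by case: unliftP => [j|] -> //=; rewrite !mxE.
under eq_integral do under eq_integral do rewrite E.
under eq_integral => a _.
  rewrite (IH w (fun u => f (consrV (s * a + v ord0 ord0, u)%R)))//; last first.
    apply: measurableT_comp => //.
    by apply: measurableT_comp; [exact: measurable_consrV|exact: pair1_measurable].
  over.
rewrite ge0_integralZl//; last 3 first.
- apply: (measurableT_comp (measurable_fun_fubini_consrV mf f0)) => //.
  by apply: measurable_funD => //; exact: measurable_funM.
- by move=> a _; exact: integral_ge0.
- by rewrite lee_fin exprn_ge0// invr_ge0 ltW.
rewrite (@ge0_integral_affine s (v ord0 ord0) (fun a => \int[lebesgue_rV n]_u f (consrV (a, u))))//.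
- by rewrite muleA -EFinM -exprSr.
- exact: measurable_fun_fubini_consrV.
- by move=> a; exact: integral_ge0.
Qed.

Lemma ge0_integral_rVN n (f : 'rV[R]_n -> \bar R) :
  measurable_fun setT f -> (forall x, 0 <= f x) ->
  \int[lebesgue_rV n]_x f (- x)%R = \int[lebesgue_rV n]_x f x.
Proof.
elim: n f => [|n IH] f mf f0.
  by apply: eq_integral => x _; congr f; apply/rowP => -[].
rewrite !ge0_integral_consrV//; last first.
  by apply: measurableT_comp => //; exact: measurable_fun_rVN.
have E a u : (- @consrV R n (a, u) = consrV (- a, - u))%R.
  apply/rowP => i; rewrite !mxE/=.
  by case: unliftP => [j _|_] //=; rewrite !mxE.
under eq_integral do under eq_integral do rewrite E.
under eq_integral => a _.
  rewrite (IH (fun u => f (consrV (- a, u)%R)))//; last first.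
    apply: measurableT_comp => //.
    by apply: measurableT_comp; [exact: measurable_consrV|exact: pair1_measurable].
  over.
rewrite (@ge0_integral_opp1 (fun a => \int[lebesgue_rV n]_u f (consrV (a, u))))//.
- exact: measurable_fun_fubini_consrV.
- by move=> a; exact: integral_ge0.
Qed.

(** Positive and negative parts are shifted separately, so that functions without an integral are
    covered as well. *)
Lemma integral_rV_shift n (v : 'rV[R]_n) (f : 'rV[R]_n -> \bar R) :
  measurable_fun setT f ->
  \int[lebesgue_rV n]_x f (x + v)%R = \int[lebesgue_rV n]_x f x.
Proof.
move=> mf; rewrite integralE [RHS]integralE.
have H g : measurable_fun setT g -> (forall x, 0 <= g x) ->
    \int[lebesgue_rV n]_x g (x + v)%R = \int[lebesgue_rV n]_x g x.
  move=> mg g0; have := @ge0_integral_rV_affine n 1%R v g ltr01 mg g0.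
  by rewrite invr1 expr1n mul1e => <-; apply: eq_integral => x _; rewrite scale1r.
congr (_ - _).
- by rewrite -(H _ (measurable_funepos mf) (funepos_ge0 f)); apply: eq_integral => x _; rewrite !funeposE.
- by rewrite -(H _ (measurable_funeneg mf) (funeneg_ge0 f)); apply: eq_integral => x _; rewrite !funenegE.
Qed.

Lemma integral_rV_reflect n (v : 'rV[R]_n) (f : 'rV[R]_n -> \bar R) :
  measurable_fun setT f ->
  \int[lebesgue_rV n]_x f (v - x)%R = \int[lebesgue_rV n]_x f x.
Proof.
move=> mf; rewrite -[RHS](integral_rV_shift v)//.
pose g (x : 'rV[R]_n) := f (x + v)%R.
have mg : measurable_fun setT g.
  by apply: measurableT_comp => //; exact: measurable_fun_rVD.
transitivity (\int[lebesgue_rV n]_x g (- x)%R).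
  by apply: eq_integral => x _; rewrite /g addrC.
rewrite integralE [RHS]integralE.
congr (_ - _).
- by rewrite -(ge0_integral_rVN (measurable_funepos mg) (funepos_ge0 g)); apply: eq_integral => x _; rewrite !funeposE.
- by rewrite -(ge0_integral_rVN (measurable_funeneg mg) (funeneg_ge0 g)); apply: eq_integral => x _; rewrite !funenegE.
Qed.

End lebesgue_rV_transformations.

(** * Integrals of powers on the half-line *)

Section power_integrals.
Context {R : realType}.
Local Open Scope ereal_scope.
Notation leb := (@lebesgue_measure R).

Lemma continuous_powR_gt0 (a x : R) : (0 < x)%R -> {for x, continuous (@powR R ^~ a)}.
Proof.
move=> x0; apply: differentiable_continuous; apply/derivable1_diffP.
by apply: derivable_powR; rewrite in_itv/= x0.
Qed.

Lemma measurable_powR_comp d (T : measurableType d) (f : T -> R) (a : R) :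
  measurable_fun setT f -> measurable_fun setT (fun x => f x `^ a)%R.
Proof. exact: (@measurableT_comp _ _ _ _ _ _ (@powR R ^~ a)). Qed.

Lemma powR_cvg_pinfty (s : R) : (0 < s)%R -> (x `^ (- s))%R @[x --> +oo%R] --> (0 : R)%R.
Proof.
move=> s0; apply/cvgrPdist_le => e e0; near=> x.
have x0 : (0 < x)%R by near: x; exact: nbhs_pinfty_gt.
rewrite sub0r normrN ger0_norm ?powR_ge0//.
have xe : (e `^ (- s^-1) <= x)%R by near: x; exact: nbhs_pinfty_ge.
rewrite powRN -(invrK e) lef_pV2 ?posrE ?invr_gt0 ?powR_gt0//.
have := ge0_ler_powR (ltW s0) (powR_ge0 _ _) (ltW x0) xe.
by rewrite -powRrM mulNr mulVf ?gt_eqF// powR_inv1// ltW.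
Unshelve. all: by end_near. Qed.

Lemma integral_powR_pinfty (s T : R) : (0 < s)%R -> (0 < T)%R ->
  \int[leb]_(t in `[T, +oo[) (t `^ (- s - 1))%:E = (T `^ (- s) / s)%:E.
Proof.
move=> s0 T0; pose F (t : R) := (- (s^-1 * t `^ (- s)))%R.
have dF (x : R) : (0 < x)%R -> derivable (fun t : R => t `^ (- s))%R x 1.
  by move=> x0; apply: derivable_powR; rewrite in_itv/= x0.
have dFF x : (0 < x)%R -> derivable F x 1.
  by move=> x0; apply: derivableN; apply: derivableM => //; exact: dF.
rewrite (@ge0_continuous_FTC2y _ _ F T 0%R).
- by rewrite -EFinB sub0r opprK mulrC.
- by move=> x _; exact: powR_ge0.
- apply: continuous_in_subspaceT => x /=; rewrite inE/= in_itv/= andbT => Tx.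
  by apply: continuous_powR_gt0; rewrite (lt_le_trans T0).
- rewrite -[0%R]oppr0; apply: cvgN; rewrite -(mulr0 s^-1%R).
  by apply: cvgM; [exact: cvg_cst|exact: powR_cvg_pinfty].
- by move=> x Tx; apply: dFF; rewrite (lt_trans T0).
- apply: cvg_at_right_filter; apply: differentiable_continuous.
  by apply/derivable1_diffP; exact: dFF.
- move=> x; rewrite in_itv/= andbT => Tx; have x0 := lt_trans T0 Tx.
  rewrite derive1E deriveN; last by apply: derivableM => //; exact: dF.
  rewrite deriveM//; last exact: dF.
  rewrite derive_cst scaler0 addr0 -derive1E powR_derive1 ?in_itv/= ?x0//.
  by rewrite /GRing.scale/=; field; rewrite gt_eqF.
Qed.

(** The integrand may blow up at [0], so the interval is exhausted by [[T / (k + 2), T]] and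
    monotone convergence is combined with the fundamental theorem of calculus on each piece. The
    shift by [2] keeps every left endpoint strictly below [T]. *)
Lemma integral_powR_0 (s T : R) : (0 < s)%R -> (0 < T)%R ->
  \int[leb]_(t in `]0%R, T]) (t `^ (s - 1))%:E = (T `^ s / s)%:E.
Proof.
move=> s0 T0; pose F (t : R) := (s^-1 * t `^ s)%R.
have dF (x : R) : (0 < x)%R -> derivable (fun t : R => t `^ s)%R x 1.
  by move=> x0; apply: derivable_powR; rewrite in_itv/= x0.
have dFF x : (0 < x)%R -> derivable F x 1.
  by move=> x0; apply: derivableM => //; exact: dF.
have cF x : (0 < x)%R -> {for x, continuous F}.
  by move=> x0; apply: differentiable_continuous; apply/derivable1_diffP; exact: dFF.
pose e (k : nat) : R := (T * k.+2%:R^-1)%R.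
have e0 k : (0 < e k)%R by rewrite mulr_gt0// invr_gt0.
have eT k : (e k < T)%R by rewrite gtr_pMr// invf_lt1// ltr1n.
have ->  : `]0%R, T]%classic = \bigcup_k `[e k, T]%classic.
  apply/seteqP; split => [x|x [k _]] /=; rewrite !in_itv/=; last first.
    by move=> /andP[ex ->]; rewrite andbT (lt_le_trans (e0 k)).
  move=> /andP[x0 xT]; have xT0 : (0 < x / T)%R by rewrite divr_gt0.
  have [k _ /(_ k (leqnn _)) /= kx] := near_infty_natSinv_lt (PosNum xT0).
  exists k => //=; rewrite in_itv/= xT andbT /e.
  rewrite -ler_pdivlMl// mulrC (le_trans _ (ltW kx))// lef_pV2 ?posrE// ler_nat//.
have FTC k : \int[leb]_(t in `[e k, T]) (t `^ (s - 1))%:E = (F T - F (e k))%:E.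
  rewrite (@continuous_FTC2 _ _ F)//.
  - apply: continuous_in_subspaceT => x /=; rewrite inE/= in_itv/= => /andP[ex _].
    by apply: continuous_powR_gt0; rewrite (lt_le_trans (e0 k)).
  - split.
    + by move=> x; rewrite in_itv/= => /andP[ex _]; apply: dFF; exact: lt_trans ex.
    + by apply: cvg_at_right_filter; exact: cF.
    + by apply: cvg_at_left_filter; exact: cF.
  - move=> x; rewrite in_itv/= => /andP[ex _]; have x0 := lt_trans (e0 k) ex.
    rewrite derive1E deriveM//; last exact: dF.
    rewrite derive_cst scaler0 addr0 -derive1E powR_derive1 ?in_itv/= ?x0//.
    by rewrite /GRing.scale/=; field; rewrite gt_eqF.
have h1 : \int[leb]_(t in `[e k, T]) (t `^ (s - 1))%:E @[k --> \oo] -->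
    \int[leb]_(t in \bigcup_k `[e k, T]%classic) (t `^ (s - 1))%:E.
  apply: ge0_nondecreasing_set_cvg_integral => //.
  - move=> k l kl; apply/subsetPset => x /=; rewrite !in_itv/= => /andP[ex ->].
    rewrite andbT (le_trans _ ex)// ler_pM2l// lef_pV2 ?posrE// ler_nat//.
  - move=> k; apply: measurable_funTS; apply/measurable_EFinP.
    exact: measurable_powR_comp.
  - by move=> k x _; rewrite lee_fin powR_ge0.
suff h2 : \int[leb]_(t in `[e k, T]) (t `^ (s - 1))%:E @[k --> \oo] --> (T `^ s / s)%:E.
  by rewrite -(cvg_lim _ h1)// -(cvg_lim _ h2).
rewrite (eq_cvg _ _ FTC); apply: cvg_EFin; first by near=> k.
rewrite /= (_ : (T `^ s / s = F T - s^-1 * 0)%R); last by rewrite /F; ring.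
apply: cvgB; first exact: cvg_cst.
apply: cvgM; first exact: cvg_cst.
have e_cvg : e k @[k --> \oo] --> (0 : R)%R.
  rewrite -(mulr0 T); apply: cvgM; first exact: cvg_cst.
  by have := @cvg_harmonic R; rewrite -(cvg_shiftS (@harmonic R)).
have : e k @[k --> \oo] --> (0 : R)^'+.
  move=> P /= /e_cvg; rewrite !near_simpl => h.
  by move: h; apply: filterS => k; apply; exact: e0.
move=> h; exact: (cvg_comp _ _ h (powR_cvg0 s0)).
Unshelve. all: by end_near. Qed.

End power_integrals.

(** * Radial functions and integrals of powers of the norm *)

Section radial_integrals.
Context {R : realType}.
Local Open Scope ereal_scope.
Notation leb := (@lebesgue_measure R).

Lemma measurable_eball n (r : R) : measurable [set x : 'rV[R]_n | (enorm x < r)%R].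
Proof.
rewrite -[X in measurable X]setTI (_ : [set x | _] = @enorm R n @^-1` `]-oo, r[%classic).
  by apply: measurable_enorm => //; exact: measurable_itv.
by apply/seteqP; split=> x /=; rewrite in_itv.
Qed.

Lemma measurable_rV_box n (A : 'I_n -> set (measurableTypeR R)) :
  (forall i, measurable (A i)) ->
  measurable [set x : 'rV[R]_n | forall i, A i (x ord0 i)].
Proof.
move=> mA.
rewrite (_ : [set x | _] = \bigcap_(i in setT) [set x : 'rV[R]_n | A i (x ord0 i)]).
  apply: fin_bigcap_measurable => // i _.
  by rewrite -[X in measurable X]setTI; exact: measurable_coord.
by apply/seteqP; split=> x /= h i; [move=> _; exact: h|exact: h].
Qed.

Lemma lebesgue_rV_bounded_box n (c : R) :
  lebesgue_rV n [set x : 'rV[R]_n | forall i, (`|x ord0 i| <= c)%R] < +oo.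
Proof.
pose A (i : 'I_n) : set R := `[(- c)%R, c]%classic.
rewrite (_ : [set x | _] = [set x : 'rV[R]_n | forall i, A i (x ord0 i)]); last first.
  by apply/seteqP; split=> x /= h i; have := h i; rewrite /A/= in_itv/= ler_norml.
rewrite lebesgue_rV_box => [|i]; last exact: measurable_itv.
suff : 0 <= \prod_i leb (A i) < +oo by case/andP.
apply: (big_ind (fun x => 0 <= x < +oo)) => [|x y /andP[x0 xoo] /andP[y0 yoo]|i _].
- by rewrite lee01 ltry.
- by rewrite mule_ge0//= lte_mul_pinfty// ge0_fin_numE.
- by rewrite measure_ge0 /A lebesgue_measure_itv/=; case: ifP => _; rewrite -?EFinB ltry.
Qed.

Lemma lebesgue_rV_unit_eball n :
  lebesgue_rV n [set x : 'rV[R]_n | (enorm x < 1)%R] = (omega n)%:E.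
Proof.
rewrite /omega fineK// ge0_fin_numE//.
apply: le_lt_trans (lebesgue_rV_bounded_box n 1).
apply: le_measure; rewrite ?inE.
- exact: measurable_eball.
- apply: (@measurable_rV_box _ (fun=> [set a | (`|a| <= 1)%R])) => i.
  rewrite (_ : [set a | _] = `[(-1)%R, 1%R]%classic); first exact: measurable_itv.
  by apply/seteqP; split=> x /=; rewrite in_itv/= ler_norml.
- move=> x /= x1 i; apply: ltW.
  exact: le_lt_trans (coord_le_enorm x i) x1.
Qed.

Lemma omega_ge0 n : (0 <= omega n :> R)%R.
Proof. by rewrite fine_ge0. Qed.

Lemma lebesgue_rV_eball n (r : R) : (0 < r)%R ->
  lebesgue_rV n [set x : 'rV[R]_n | (enorm x < r)%R] = (r ^+ n * omega n)%:E.
Proof.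
move=> r0; have mB s := @measurable_eball n s.
have indicE s : lebesgue_rV n [set x : 'rV[R]_n | (enorm x < s)%R] =
    \int[lebesgue_rV n]_x (\1_[set x : 'rV[R]_n | (enorm x < s)%R] x)%:E.
  by rewrite integral_indic// setIT.
rewrite EFinM -lebesgue_rV_unit_eball !indicE.
have := @ge0_integral_rV_affine R n r^-1 0 (fun x => (\1_[set x : 'rV[R]_n | (enorm x < 1)%R] x)%:E).
rewrite invrK invr_gt0 => <- //; last by apply/measurable_EFinP; exact: measurable_indic.
apply: eq_integral => x _; rewrite /indic; congr (nat_of_bool _)%:R%:E.
apply/idP/idP; rewrite !inE/= addr0 enormZ ger0_norm ?invr_ge0 ?(ltW r0)// ltr_pdivrMl// mulr1//.
Qed.

(** The set where [|x|^n < t] is a ball of volume [t * omega n], so x -> |x|^n carries Lebesgue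
    measure to [omega n] times Lebesgue measure on the half-line. This replaces polar
    coordinates. *)
Lemma ge0_integral_radial n (F : R -> \bar R) : (0 < n)%N ->
  measurable_fun setT F -> (forall t, 0 <= F t) ->
  \int[lebesgue_rV n]_x F (enorm x ^+ n)%R =
  (omega n)%:E * \int[leb]_(t in `[0%R, +oo[) F t.
Proof.
move=> n0 mF F0; pose D : set (measurableTypeR R) := `[0%R, +oo[%classic.
have mD : measurable D by exact: measurable_itv.
pose phi (x : 'rV[R]_n) : measurableTypeR R := (enorm x ^+ n)%R.
have mphi : measurable_fun setT phi by apply: measurable_funX; exact: measurable_enorm.
pose m1 : {measure set (measurableTypeR R) -> \bar R} :=
  measure_function_pushforward__canonical__measure_function_Measure (lebesgue_rV n) mphi.
pose m2 : {measure set (measurableTypeR R) -> \bar R} :=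
  mscale (NngNum (omega_ge0 n)) (mrestr leb mD).
pose g (k : nat) : set R := `]-oo, k%:R%R[%classic.
have m1E (t : R) : m1 `]-oo, t[%classic = (Num.max t 0 * omega n)%:E.
  rewrite /m1/= /pushforward.
  have [t0|t0] := leP t 0%R.
    rewrite mul0r (_ : _ @^-1` _ = set0) ?measure0//.
    apply/seteqP; split => // x /=; rewrite in_itv/= => /(lt_le_trans)/(_ t0).
    by rewrite ltNge exprn_ge0// enorm_ge0.
  have E : ((t `^ n%:R^-1) ^+ n = t)%R.
    by rewrite -powR_mulrn ?powR_ge0// -powRrM mulVf ?pnatr_eq0 ?gt_eqF// powRr1// ltW.
  rewrite -{2}E -lebesgue_rV_eball ?powR_gt0//; congr (lebesgue_rV n _).
  have H x : (phi x < t)%R = (enorm x < t `^ n%:R^-1)%R.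
    by rewrite -[in LHS]E ltr_pXn2r ?nnegrE ?enorm_ge0 ?powR_ge0.
  by apply/seteqP; split => x /=; rewrite in_itv/= H.
have m2E (t : R) : m2 `]-oo, t[%classic = (Num.max t 0 * omega n)%:E.
  rewrite /m2/= /mscale/= /mrestr/= mulrC EFinM; congr (_ * _).
  rewrite (_ : _ `&` _ = `[0%R, t[%classic); last first.
    by rewrite setIC; apply/seteqP; split => x /=; rewrite /D/= !in_itv/= ?andbT => /andP.
  rewrite lebesgue_measure_itv/= lte_fin; have [t0|t0] := ltP 0%R t.
    by rewrite -EFinB subr0.
  by [].
(* The rays []-oo, t[] are stable under intersection, generate the Borel sets and exhaust the line
   with finite mass. *)
have m12 A : measurable A -> m1 A = m2 A.
  move=> mA; apply: (@measure_unique _ R (measurableTypeR R) (@measurable_realfun.RGenInftyO.G R) g) => //.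
  - exact: measurable_realfun.RGenInftyO.measurableE.
  - move=> _ _ [x ->] [y ->]; exists (Num.min x y).
    by apply/seteqP; split => z /=; rewrite !in_itv/= lt_min; [case=> -> ->|case/andP].
  - by move=> k; exists k%:R%R.
  - apply/seteqP; split => // x _; exists (Num.truncn `|x|).+1 => //=.
    by rewrite /g/= in_itv/= (le_lt_trans (ler_norm x))// truncnS_gt.
  - by move=> _ [x ->]; rewrite m1E m2E.
  - by move=> k; rewrite m1E ltry.
have -> : \int[lebesgue_rV n]_x F (enorm x ^+ n)%R = \int[m1]_t F t.
  by rewrite /m1/= (ge0_integral_pushforward mphi)//.
rewrite (@eq_measure_integral _ _ _ setT m2)//; last by move=> A mA _; exact: m12.
rewrite /m2 ge0_integral_mscale//; congr (_ * _).
rewrite (@ge0_negligible_integral _ _ _ _ setT (~` D))//.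
- rewrite setTD setCK; apply: eq_measure_integral => A mA AD /=.
  by rewrite /mrestr setIidl.
- exact: measurableC.
- by rewrite /= /mrestr setICl measure0.
Qed.

Lemma powRXn_div n (x c : R) : (0 < n)%N -> (0 <= x)%R ->
  ((x ^+ n) `^ (c / n%:R) = x `^ c)%R.
Proof.
move=> n0 x0; rewrite -powR_mulrn// -powRrM mulrC divfK//.
by rewrite pnatr_eq0 gt_eqF.
Qed.

Lemma measurable_setC_eball n (r : R) : measurable [set x : 'rV[R]_n | (r <= enorm x)%R].
Proof.
have -> : [set x : 'rV[R]_n | (r <= enorm x)%R] = ~` [set x : 'rV[R]_n | (enorm x < r)%R].
  by apply/seteqP; split=> x /=; rewrite leNgt => /negP.
by apply: measurableC; exact: measurable_eball.
Qed.

(** In the variable t = |x|^n the power |x|^(b - n) becomes t^(b/n - 1), integrable at [0] because b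
    > 0. An inequality suffices, so the sphere |x| = r may be included on the right. *)
Lemma integral_eball_powR n (b r : R) : (0 < b)%R -> (b < n%:R)%R -> (0 < r)%R ->
  \int[lebesgue_rV n]_(x in [set x | (enorm x < r)%R]) ((enorm x `^ (n%:R - b))^-1)%:E
  <= (n%:R * omega n * (r `^ b / b))%:E.
Proof.
move=> b0 bn r0.
have nR0 : (0 < n%:R :> R)%R by exact: lt_trans bn.
have n0 : (0 < n)%N by rewrite -(ltr_nat R).
have rn0 : (0 < r ^+ n)%R by rewrite exprn_gt0.
pose F (t : R) := (t `^ (b / n%:R - 1) * (\1_`]0%R, (r ^+ n)%R] t))%:E.
have mF : measurable_fun setT F.
  apply/measurable_EFinP; apply: measurable_funM; first exact: measurable_powR_comp.
  by apply: measurable_indic; exact: measurable_itv.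
have F0 t : 0 <= F t by rewrite lee_fin mulr_ge0 ?powR_ge0.
rewrite integral_mkcond.
apply: (@le_trans _ _ (\int[lebesgue_rV n]_x F (enorm x ^+ n)%R)).
  apply: ge0_le_integral => //.
  - by move=> x _; rewrite patchE; case: ifP => // _; rewrite lee_fin invr_ge0 powR_ge0.
  - apply/(measurable_restrictT _ _).1; first exact: measurable_eball.
    apply: measurable_funTS; apply/measurable_EFinP.
    under eq_fun do rewrite -powRN.
    by apply: measurable_powR_comp; exact: measurable_enorm.
  - by apply: measurableT_comp => //; apply: measurable_funX; exact: measurable_enorm.
  - move=> x _; rewrite patchE; case: ifPn => // /[!inE]/= xr.
    (* At the origin the power is [0] since its exponent is nonzero, and so is its inverse. *)
    have [->|x0] := eqVneq x 0%R.
      by rewrite enorm0 powR0 ?invr0// subr_eq0 gt_eqF.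
    have xn0 : (0 < enorm x ^+ n)%R by rewrite exprn_gt0// enorm_gt0.
    rewrite lee_fin indicE mem_set/= ?in_itv/= ?xn0 ?lerXn2r ?nnegrE ?enorm_ge0 ?(ltW xr) ?(ltW r0)// mulr1.
    rewrite (_ : b / n%:R - 1 = (b - n%:R) / n%:R)%R; last by field; rewrite gt_eqF.
    by rewrite powRXn_div ?enorm_ge0// -powRN opprB.
rewrite ge0_integral_radial//.
have -> : \int[leb]_(t in `[0%R, +oo[) F t = \int[leb]_(t in `]0%R, (r ^+ n)%R]) (t `^ (b / n%:R - 1))%:E.
  rewrite integral_mkcond [RHS]integral_mkcond; apply: eq_integral => t _.
  rewrite !patchE /F indicE.
  have [tin|tin] := boolP (t \in `]0%R, (r ^+ n)%R]%classic); last by rewrite mulr0 if_same.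
  rewrite ifT ?mulr1//; move: tin; rewrite !inE/= !in_itv/= andbT.
  by case/andP => /ltW.
rewrite integral_powR_0 ?divr_gt0// -EFinM lee_fin le_eqVlt; apply/orP; left; apply/eqP.
rewrite powRXn_div ?(ltW r0)//; field.
by rewrite !gt_eqF.
Qed.

Lemma integral_setC_eball_powR n (b r : R) : (0 < n)%N -> (0 < b)%R -> (0 < r)%R ->
  \int[lebesgue_rV n]_(x in [set x | (r <= enorm x)%R]) ((enorm x `^ (n%:R + b))^-1)%:E
  <= (n%:R * omega n * (r `^ (- b) / b))%:E.
Proof.
move=> n0 b0 r0.
have nR0 : (0 < n%:R :> R)%R by rewrite ltr0n.
have rn0 : (0 < r ^+ n)%R by rewrite exprn_gt0.
pose F (t : R) := (t `^ (- (b / n%:R) - 1) * (\1_`[(r ^+ n)%R, +oo[ t))%:E.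
have mF : measurable_fun setT F.
  apply/measurable_EFinP; apply: measurable_funM; first exact: measurable_powR_comp.
  by apply: measurable_indic; exact: measurable_itv.
have F0 t : 0 <= F t by rewrite lee_fin mulr_ge0 ?powR_ge0.
rewrite integral_mkcond.
apply: (@le_trans _ _ (\int[lebesgue_rV n]_x F (enorm x ^+ n)%R)).
  apply: ge0_le_integral => //.
  - by move=> x _; rewrite patchE; case: ifP => // _; rewrite lee_fin invr_ge0 powR_ge0.
  - apply/(measurable_restrictT _ _).1; first exact: measurable_setC_eball.
    apply: measurable_funTS; apply/measurable_EFinP.
    under eq_fun do rewrite -powRN.
    by apply: measurable_powR_comp; exact: measurable_enorm.
  - by apply: measurableT_comp => //; apply: measurable_funX; exact: measurable_enorm.
  - move=> x _; rewrite patchE; case: ifPn => // /[!inE]/= xr.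
    have x0 : x != 0%R by rewrite -enorm_gt0 (lt_le_trans r0).
    have -> : F (enorm x ^+ n)%R = ((enorm x ^+ n) `^ (- (b / n%:R) - 1))%:E.
      by rewrite /F indicE mem_set ?mulr1//= in_itv/= andbT lerXn2r ?nnegrE ?enorm_ge0 ?(ltW r0).
    rewrite lee_fin.
    rewrite (_ : - (b / n%:R) - 1 = (- b - n%:R) / n%:R)%R; last by field; rewrite gt_eqF.
    by rewrite powRXn_div ?enorm_ge0// -powRN opprD addrC.
rewrite ge0_integral_radial//.
have -> : \int[leb]_(t in `[0%R, +oo[) F t = \int[leb]_(t in `[(r ^+ n)%R, +oo[) (t `^ (- (b / n%:R) - 1))%:E.
  rewrite integral_mkcond [RHS]integral_mkcond; apply: eq_integral => t _.
  rewrite !patchE /F indicE.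
  have [tin|tin] := boolP (t \in `[(r ^+ n)%R, +oo[%classic); last by rewrite mulr0 if_same.
  rewrite ifT ?mulr1//; move: tin; rewrite !inE/= !in_itv/= !andbT.
  by move=> h; rewrite (le_trans (ltW rn0) h).
rewrite integral_powR_pinfty ?divr_gt0// -EFinM lee_fin le_eqVlt; apply/orP; left; apply/eqP.
rewrite -mulNr powRXn_div ?(ltW r0)//; field.
by rewrite !gt_eqF.
Qed.

End radial_integrals.

(** * Real-valued integrals and norms of Lebesgue spaces *)

Section Rintegral_complements.
Local Open Scope ereal_scope.

(** The real inner integrals agree with the extended ones where the slice is integrable, that is
    almost everywhere; hence the comparison almost everywhere on both sides of the extended
    theorem. *)
Lemma Rintegral_Fubini d1 d2 (T1 : measurableType d1) (T2 : measurableType d2)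
    (R : realType) (m1 : {sigma_finite_measure set T1 -> \bar R})
    (m2 : {sigma_finite_measure set T2 -> \bar R}) (F : T1 * T2 -> R) :
  measurable_fun setT F -> \int[m1]_x \int[m2]_y `|F (x, y)|%:E < +oo ->
  (\int[m1]_x \int[m2]_y F (x, y) = \int[m2]_y \int[m1]_x F (x, y))%R.
Proof.
move=> mF Foo.
have mEF : measurable_fun setT (EFin \o F) by exact/measurable_EFinP.
have iF : (m1 \x m2).-integrable setT (EFin \o F) by apply/integrable12ltyP.
have := Fubini iF; rewrite /Rintegral /= => E.
transitivity (fine (\int[m1]_x \int[m2]_y (F (x, y))%:E)).
  congr fine; apply: ae_eq_integral => //.
  - apply/measurable_EFinP; apply: measurableT_comp => //.
    exact: measurable_fubini_F iF.
  - exact: measurable_fubini_F iF.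
  - have := ae_integrable1 iF; apply: filterS => x ix _ /=.
    by rewrite fineK//; exact: integrable_fin_num.
rewrite E; congr fine; apply: ae_eq_integral => //.
- exact: measurable_fubini_G iF.
- apply/measurable_EFinP; apply: measurableT_comp => //.
  exact: measurable_fubini_G iF.
- have := ae_integrable2 iF; apply: filterS => x ix _ /=.
  by rewrite fineK//; exact: integrable_fin_num.
Qed.

(** An infinite extended integral is sent to [0] by [fine], which keeps the bound valid without
    integrability. *)
Lemma le_abs_Rintegral d (T : measurableType d) (R : realType)
    (m : {measure set T -> \bar R}) (f : T -> R) :
  measurable_fun setT f ->
  (`| \int[m]_x f x |%R)%:E <= \int[m]_x `|f x|%:E.
Proof.
move=> mf; have := le_abse_integral m measurableT (proj2 (measurable_EFinP _ _) mf).
rewrite /Rintegral; case: (\int[m]_x _) => //= _; rewrite normr0; exact: integral_ge0.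
Qed.

Lemma ae_eq_Rintegral d (T : measurableType d) (R : realType)
    (m : {measure set T -> \bar R}) (f g : T -> R) :
  measurable_fun setT f -> measurable_fun setT g -> {ae m, forall x, f x = g x} ->
  (\int[m]_x f x = \int[m]_x g x)%R.
Proof.
move=> mf mg fg; congr fine; apply: ae_eq_integral => //; try exact/measurable_EFinP.
by apply: filterS fg => x /= -> _.
Qed.

Lemma integrable_EFinP d (T : measurableType d) (R : realType)
    (m : {measure set T -> \bar R}) (f : T -> R) :
  m.-integrable setT (EFin \o f) <->
  measurable_fun setT f /\ \int[m]_x `|f x|%:E < +oo.
Proof.
split=> [/integrableP[mf foo]|[mf foo]]; first by split => //; exact/measurable_EFinP.
by apply/integrableP; split => //; exact/measurable_EFinP.
Qed.

End Rintegral_complements.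

Section Lp_complements.
Context {R : realType}.
Local Open Scope ereal_scope.

Lemma LpP n (p : R) (f : 'rV[R]_n -> R) : (0 < p)%R ->
  Lp p f <-> measurable_fun setT f /\ \int[lebesgue_rV n]_x (`|f x| `^ p)%:E < +oo.
Proof.
move=> p0; rewrite /Lp; split.
  rewrite inE => /andP[/[!inE] mf]; rewrite /finite_norm unlock /Lnorm => h; split => //.
  by apply: lty_poweRy h; rewrite invr_eq0 gt_eqF.
move=> [mf h]; rewrite inE; apply/andP; split; rewrite inE//=.
rewrite /finite_norm unlock /Lnorm; exact: poweR_lty.
Qed.

Lemma Lp_normE n (p : R) (A : set 'rV[R]_n) (f : 'rV[R]_n -> R) : (0 < p)%R ->
  Lp_norm A p f = (\int[lebesgue_rV n]_(x in A) (`|f x| `^ p)%:E) `^ p^-1.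
Proof.
move=> p0; rewrite /Lp_norm unlock /Lnorm; congr (_ `^ _).
rewrite [RHS]integral_mkcond; apply: eq_integral => x _; rewrite patchE /=.
by rewrite patchE; case: ifP => //= _; rewrite normr0 powR0 ?gt_eqF.
Qed.

End Lp_complements.

Lemma ge0_le_poweR {R : realType} (r : R) (x y : \bar R) :
  0 <= r -> (0 <= x)%E -> (x <= y)%E -> (x `^ r <= y `^ r)%E.
Proof.
move=> r0 x0 xy; apply: gt0_ler_poweR => //; rewrite in_itv/= leey andbT//.
exact: le_trans xy.
Qed.

(** * Convolution in Lebesgue spaces *)

Section convolution.
Context {R : realType} {n : nat}.
Local Open Scope ereal_scope.
Notation rV := ('rV[R]_n).
Notation lam := (@lebesgue_rV R n).
Implicit Types k u v w : rV -> R.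

Definition conv k u (x : rV) : R := (\int[lam]_h (k h * u (x - h)))%R.

(** Extended-valued companion of [conv] for nonnegative data: it may be infinite, so finiteness is
    something to be proved and not a side condition. *)
Definition econv k w (x : rV) : \bar R := \int[lam]_h (k h * w (x - h))%:E.

Lemma measurable_conv_integrand k u : measurable_fun setT k -> measurable_fun setT u ->
  measurable_fun setT (fun z : rV * rV => k z.2 * u (z.1 - z.2))%R.
Proof.
move=> mk mu; apply: measurable_funM.
  by apply: measurableT_comp => //; exact: measurable_snd.
apply: measurableT_comp => //; apply: measurable_fun_rVB.
  exact: measurable_fst.
exact: measurable_snd.
Qed.

Lemma measurable_conv_slice k u x : measurable_fun setT k -> measurable_fun setT u ->
  measurable_fun setT (fun h : rV => k h * u (x - h))%R.
Proof.
move=> mk mu; apply: measurable_funM => //.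
by apply: measurableT_comp => //; exact: measurable_fun_rVB.
Qed.

Lemma measurable_econv k w : measurable_fun setT k -> measurable_fun setT w ->
  (forall x, 0 <= k x)%R -> (forall x, 0 <= w x)%R -> measurable_fun setT (econv k w).
Proof.
move=> mk mw k0 w0.
pose F (z : rV * rV) := (k z.2 * w (z.1 - z.2))%:E.
apply: (@measurable_fun_fubini_tonelli_F _ _ _ _ _ lam F).
- by apply/measurable_EFinP; exact: measurable_conv_integrand.
- by move=> z; rewrite lee_fin mulr_ge0.
Qed.

(** Tonelli applies to the positive and the negative part of the integrand separately, so no
    integrability of the slices is involved. *)
Lemma measurable_conv k u : measurable_fun setT k -> measurable_fun setT u ->
  measurable_fun setT (conv k u).
Proof.
move=> mk mu; apply: measurableT_comp; first exact: fine_measurable.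
pose F (z : rV * rV) := (k z.2 * u (z.1 - z.2))%:E.
have mF : measurable_fun setT F.
  by apply/measurable_EFinP; exact: measurable_conv_integrand.
rewrite (_ : (fun x => _) = (fun x => \int[lam]_h F^\+ (x, h) - \int[lam]_h F^\- (x, h))).
  apply: emeasurable_funB.
  - apply: (@measurable_fun_fubini_tonelli_F _ _ _ _ _ lam F^\+).
      exact: measurable_funepos.
    by move=> z; exact: funepos_ge0.
  - apply: (@measurable_fun_fubini_tonelli_F _ _ _ _ _ lam F^\-).
      exact: measurable_funeneg.
    by move=> z; exact: funeneg_ge0.
apply/funext => x; rewrite integralE; congr (_ - _); apply: eq_integral => h _.
  by rewrite !funeposE.
by rewrite !funenegE.
Qed.

Lemma econv_ge0 k w x : (forall x, 0 <= k x)%R -> (forall x, 0 <= w x)%R ->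
  0 <= econv k w x.
Proof. by move=> k0 w0; apply: integral_ge0 => h _; rewrite lee_fin mulr_ge0. Qed.

Lemma le_abs_conv k u x : measurable_fun setT k -> measurable_fun setT u ->
  (`|conv k u x|%R)%:E <= econv (fun h => `|k h|)%R (fun h => `|u h|)%R x.
Proof.
move=> mk mu; apply: le_trans (le_abs_Rintegral _ _) _.
  exact: measurable_conv_slice.
by rewrite le_eqVlt; apply/orP; left; apply/eqP; apply: eq_integral => h _ /=; rewrite normrM.
Qed.

Lemma integral_econv k w : measurable_fun setT k -> measurable_fun setT w ->
  (forall x, 0 <= k x)%R -> (forall x, 0 <= w x)%R ->
  \int[lam]_x econv k w x = (\int[lam]_h (k h)%:E) * \int[lam]_x (w x)%:E.
Proof.
move=> mk mw k0 w0; pose F (z : rV * rV) := (k z.2 * w (z.1 - z.2))%:E.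
have mF : measurable_fun setT F.
  by apply/measurable_EFinP; exact: measurable_conv_integrand.
have F0 z : 0 <= F z by rewrite lee_fin mulr_ge0.
rewrite (fubini_tonelli F)//.
rewrite -[RHS]ge0_integralZr//; first last.
- by apply: integral_ge0 => x _; rewrite lee_fin.
- by move=> x _; rewrite lee_fin.
- exact/measurable_EFinP.
apply: eq_integral => h _; rewrite /F/=.
under eq_integral do rewrite EFinM.
rewrite ge0_integralZl_EFin//; last 2 first.
- by move=> x _; rewrite lee_fin.
- apply/measurable_EFinP; apply: measurableT_comp => //.
  exact: measurable_fun_rVB.
congr (_ * _); rewrite (@integral_rV_shift R n (- h)%R (fun x => (w x)%:E))//.
exact/measurable_EFinP.
Qed.

(** Hölder with [k = k^(1/p) k^(1/q)] gives the pointwise bound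
    [(k conv w)^p <= K^(p-1) (k conv w^p)]; integrating it costs one more factor [K]. *)
Lemma young k w (p K : R) : (1 < p)%R -> (0 <= K)%R ->
  measurable_fun setT k -> measurable_fun setT w ->
  (forall x, 0 <= k x)%R -> (forall x, 0 <= w x)%R ->
  \int[lam]_h (k h)%:E <= K%:E ->
  \int[lam]_x (econv k w x `^ p) <= (K `^ p)%:E * \int[lam]_x (w x `^ p)%:E.
Proof.
move=> p1 K0 mk mw k0 w0 kK.
have p0 : (0 < p)%R by rewrite (lt_trans _ p1).
pose q : R := (p / (p - 1))%R.
have q0 : (0 < q)%R by rewrite divr_gt0// subr_gt0.
have pq : (p^-1 + q^-1 = 1)%R by rewrite /q; field; rewrite gt_eqF ?gt_eqF ?subr_gt0.
have mkp (c : R) : measurable_fun setT (fun h => k h `^ c)%R by exact: measurable_powR_comp.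
have mwp : measurable_fun setT (fun h => w h `^ p)%R by exact: measurable_powR_comp.
have kE h : (k h `^ p^-1 * k h `^ q^-1 = k h)%R.
  have [->|kh] := eqVneq (k h) 0%R; first by rewrite powR0 ?mul0r// invr_eq0 gt_eqF.
  by rewrite -powRD ?kh ?implybT// pq powRr1.
have pointwise x : econv k w x `^ p <= (K `^ (p - 1))%:E * econv k (fun y => w y `^ p)%R x.
  have mwx : measurable_fun setT (fun h : rV => w (x - h)%R).
    by apply: measurableT_comp => //; exact: measurable_fun_rVB.
  have := @hoelder _ _ _ lam (fun h => k h `^ p^-1 * w (x - h))%R (fun h => k h `^ q^-1)%R p q.
  move=> /(_ _ _ p0 q0 pq); rewrite Lnorm1.
  have -> : \int[lam]_h `|(EFin \o ((fun h => k h `^ p^-1 * w (x - h)) \* (fun h => k h `^ q^-1))%R) h| = econv k w x.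
    apply: eq_integral => h _ /=; rewrite -mulrAC kE ger0_norm// mulr_ge0//.
  have -> : 'N[lam]_p%:E[EFin \o (fun h => k h `^ p^-1 * w (x - h))%R] =
      econv k (fun y => w y `^ p)%R x `^ p^-1.
    rewrite unlock /Lnorm; congr (_ `^ _); apply: eq_integral => h _ /=.
    rewrite ger0_norm ?mulr_ge0 ?powR_ge0// powRM ?powR_ge0// -powRrM mulVf ?gt_eqF// powRr1//.
  have -> : 'N[lam]_q%:E[EFin \o (fun h => k h `^ q^-1)%R] = (\int[lam]_h (k h)%:E) `^ q^-1.
    rewrite unlock /Lnorm; congr (_ `^ _); apply: eq_integral => h _ /=.
    rewrite ger0_norm ?powR_ge0// -powRrM mulVf ?gt_eqF// powRr1//.
  move=> /(_ _ _) h.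
  have {}h : econv k w x <= econv k (fun y => w y `^ p)%R x `^ p^-1 * (K `^ q^-1)%:E.
    apply: le_trans (h _ _) _; first by apply: measurable_funM.
      exact: mkp.
    apply: lee_wpmul2l; first exact: poweR_ge0.
    rewrite -poweR_EFin; apply: ge0_le_poweR => //; first by rewrite invr_ge0 ltW.
    by apply: integral_ge0 => y _; rewrite lee_fin.
  apply: le_trans (ge0_le_poweR (ltW p0) (econv_ge0 x k0 w0) h) _.
  rewrite poweRM ?poweR_ge0 ?lee_fin ?powR_ge0// -poweRrM mulVf ?gt_eqF// poweRe1; last first.
    by apply: econv_ge0 => // y; exact: powR_ge0.
  rewrite muleC poweR_EFin -powRrM (_ : q^-1 * p = p - 1)%R// /q; field.
  by rewrite !gt_eqF ?subr_gt0.
apply: (@le_trans _ _ (\int[lam]_x ((K `^ (p - 1))%:E * econv k (fun y => w y `^ p)%R x))).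
  apply: ge0_le_integral => //.
  - by move=> x _; exact: poweR_ge0.
  - apply: (@measurableT_comp _ _ _ _ _ _ (fun z => poweR z p)); first exact: measurable_poweR.
    exact: measurable_econv.
  - apply: measurable_funeM; apply: measurable_econv => // x; exact: powR_ge0.
rewrite ge0_integralZl//; last 3 first.
- by apply: measurable_econv => // x; exact: powR_ge0.
- by move=> x _; apply: econv_ge0 => // y; exact: powR_ge0.
- by rewrite lee_fin powR_ge0.
rewrite integral_econv//; last by move=> x; exact: powR_ge0.
rewrite muleA; apply: lee_wpmul2r.
  by apply: integral_ge0 => x _; rewrite lee_fin powR_ge0.
have -> : (K `^ p)%R = (K `^ (p - 1) * K)%R by rewrite mulrC mulr_powRB1.
by rewrite EFinM; apply: lee_wpmul2l; rewrite ?lee_fin ?powR_ge0.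
Qed.

End convolution.

(** * Linearity of real integrals, Hölder's inequality, norms of vector integrals *)

Section Rintegral_linearity.
Context d (T : measurableType d) (R : realType) (m : {measure set T -> \bar R}).
Implicit Types f g : T -> R.

(* The value of a Bochner-type integral of a non-integrable function is 0, so
   that scalars can be pulled out without checking integrability. *)
Lemma Rintegral_nonintegrable f : measurable_fun setT f ->
  ~ m.-integrable setT (EFin \o f) -> \int[m]_x f x = 0.
Proof.
move=> mf nif; have mE : measurable_fun setT (EFin \o f) by exact/measurable_EFinP.
have H := abse_integralP m measurableT mE.
rewrite /Rintegral; case E : (integral _ _ _) => [r| |] //=.
exfalso; apply: nif; apply/integrableP; split => //.
by apply/H; rewrite /= in E *; rewrite E ltry.
Qed.

Lemma RintegralZl_measurable c f : measurable_fun setT f ->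
  \int[m]_x (c * f x) = c * \int[m]_x f x.
Proof.
move=> mf; have [->|c0] := eqVneq c 0.
  by rewrite mul0r /Rintegral (eq_integral (cst 0%E)) ?integral0// => x _; rewrite mul0r.
have [ifi|nif] := pselect (m.-integrable setT (EFin \o f)).
  by rewrite RintegralZl.
rewrite (Rintegral_nonintegrable mf)// mulr0 Rintegral_nonintegrable//.
  exact: measurable_funM.
move=> icf; apply: nif; have := integrableZl measurableT c^-1 icf.
apply: eq_integrable => // x _ /=.
by rewrite -EFinM mulKf.
Qed.

Lemma RintegralZr_measurable c f : measurable_fun setT f ->
  \int[m]_x (f x * c) = (\int[m]_x f x) * c.
Proof.
move=> mf; rewrite mulrC -RintegralZl_measurable//.
by apply: eq_Rintegral => x _; rewrite mulrC.
Qed.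

Lemma RintegralN_measurable f : measurable_fun setT f ->
  \int[m]_x (- f x) = - \int[m]_x f x.
Proof.
move=> mf; rewrite -mulN1r -RintegralZl_measurable//.
by apply: eq_Rintegral => x _; rewrite mulN1r.
Qed.

Lemma Rintegral_sum (I : Type) (s : seq I) (f : I -> T -> R) :
  (forall i, m.-integrable setT (EFin \o f i)) ->
  \int[m]_x (\sum_(i <- s) f i x) = \sum_(i <- s) \int[m]_x f i x.
Proof.
move=> fi; elim: s => [|i s IH].
  rewrite big_nil /Rintegral (eq_integral (cst 0%E)) ?integral0// => x _.
  by rewrite big_nil.
rewrite big_cons -IH -RintegralD//.
  by apply: eq_Rintegral => x _; rewrite big_cons.
have := @integrable_sum _ _ _ m setT measurableT I s xpredT (fun i => EFin \o f i) (fun i _ => fi i).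
by apply: eq_integrable => // x _ /=; rewrite sumEFin.
Qed.

Lemma integrable_sum_EFin (I : Type) (s : seq I) (f : I -> T -> R) :
  (forall i, m.-integrable setT (EFin \o f i)) ->
  m.-integrable setT (EFin \o (fun x => \sum_(i <- s) f i x)).
Proof.
move=> fi; have := @integrable_sum _ _ _ m setT measurableT I s xpredT (fun i => EFin \o f i) (fun i _ => fi i).
by apply: eq_integrable => // x _ /=; rewrite sumEFin.
Qed.

Lemma holder_ge0 f g (p q : R) : measurable_fun setT f -> measurable_fun setT g ->
  0 < p -> 0 < q -> p^-1 + q^-1 = 1 ->
  (\int[m]_x (`|f x * g x|)%:E <= (\int[m]_x (`|f x| `^ p)%:E) `^ p^-1 *
    (\int[m]_x (`|g x| `^ q)%:E) `^ q^-1)%E.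
Proof.
move=> mf mg p0 q0 pq.
have := @hoelder _ _ _ m f g p q mf mg p0 q0 pq.
by rewrite Lnorm1 unlock.
Qed.

End Rintegral_linearity.

Section vector_integral.
Context d (T : measurableType d) (R : realType) (m : {measure set T -> \bar R}).

(* |int V|^2 = int V . (int V) <= |int V| int |V| *)
Lemma enorm_Rintegral n (V : T -> 'rV[R]_n) : measurable_fun setT V ->
  ((enorm (\row_i \int[m]_x V x ord0 i))%:E <= \int[m]_x (enorm (V x))%:E)%E.
Proof.
move=> mV; set z := (\row__ _).
have mVi i : measurable_fun setT (fun x => V x ord0 i).
  exact: measurableT_comp (measurable_coord i) mV.
have mN : measurable_fun setT (fun x => enorm (V x)).
  exact: measurableT_comp (@measurable_enorm R n) mV.
have N0 : (0 <= \int[m]_x (enorm (V x))%:E)%E.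
  by apply: integral_ge0 => x _; rewrite lee_fin enorm_ge0.
have [z0|z0] := eqVneq z 0; first by rewrite z0 enorm0.
have [Noo|] := ltP (\int[m]_x (enorm (V x))%:E)%E +oo%E; last first.
  by move=> /(le_trans _); apply; rewrite leey.
have iV i : m.-integrable setT (EFin \o (fun x => V x ord0 i)).
  apply/integrable_EFinP; split => //; apply: le_lt_trans Noo.
  apply: ge0_le_integral => //.
  - by apply/measurable_EFinP; apply: measurableT_comp.
  - exact/measurable_EFinP.
  - by move=> x _; rewrite lee_fin coord_le_enorm.
have iN : m.-integrable setT (EFin \o (fun x => enorm (V x))).
  apply/integrable_EFinP; split => //; rewrite (eq_integral (fun x => (enorm (V x))%:E))// => x _.
  by rewrite ger0_norm ?enorm_ge0.
have zz : dotrV z z = \int[m]_x dotrV z (V x).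
  rewrite /dotrV Rintegral_sum => [|i].
    by apply: eq_bigr => i _; rewrite RintegralZl_measurable// mxE.
  apply: eq_integrable (integrableZl measurableT (z ord0 i) (iV i)) => //.
have iz : m.-integrable setT (EFin \o (fun x => dotrV z (V x))).
  apply: integrable_sum_EFin => i.
  exact: eq_integrable (integrableZl measurableT (z ord0 i) (iV i)).
have : dotrV z z <= \int[m]_x (enorm z * enorm (V x)).
  rewrite zz; apply: le_Rintegral => //.
    exact: eq_integrable (integrableZl measurableT (enorm z) iN).
  by move=> x _; apply: le_trans (ler_norm _) (normr_dotrV _ _).
rewrite RintegralZl_measurable// -sqr_enorm expr2 ler_pM2l ?enorm_gt0// => zN.
rewrite -(@fineK _ (\int[m]_x (enorm (V x))%:E)%E) ?ge0_fin_numE// lee_fin.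
Qed.

End vector_integral.

(** * Fubini and duality for convolutions *)

Section convolution_adjoint.
Context {R : realType} {n : nat}.
Notation rV := ('rV[R]_n).
Notation lam := (@lebesgue_rV R n).
Implicit Types k u v w : rV -> R.

Lemma Rintegral_rV_shift (v : rV) (f : rV -> R) : measurable_fun setT f ->
  \int[lam]_x f (x + v) = \int[lam]_x f x.
Proof.
move=> mf; congr fine; apply: (@integral_rV_shift R n v (EFin \o f)).
exact/measurable_EFinP.
Qed.

Lemma Rintegral_rV_reflect (v : rV) (f : rV -> R) : measurable_fun setT f ->
  \int[lam]_x f (v - x) = \int[lam]_x f x.
Proof.
move=> mf; congr fine; apply: (@integral_rV_reflect R n v (EFin \o f)).
exact/measurable_EFinP.
Qed.

Variables (p q : R) (k u v : rV -> R).
Hypotheses (p0 : 0 < p) (q0 : 0 < q) (pq : p^-1 + q^-1 = 1).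
Hypotheses (ik : lam.-integrable setT (EFin \o k)) (Lu : Lp p u) (Lv : Lp q v).

Let mk : measurable_fun setT k. Proof. by have /integrable_EFinP[] := ik. Qed.
Let mu : measurable_fun setT u. Proof. by have /(LpP _ p0)[] := Lu. Qed.
Let mv : measurable_fun setT v. Proof. by have /(LpP _ q0)[] := Lv. Qed.

Let C : \bar R := ((\int[lam]_x (`|u x| `^ p)%:E) `^ p^-1 *
    (\int[lam]_x (`|v x| `^ q)%:E) `^ q^-1)%E.

Let Coo : (C < +oo)%E.
Proof.
have [_ uoo] := (LpP _ p0).1 Lu; have [_ voo] := (LpP _ q0).1 Lv.
by rewrite /C lte_mul_pinfty ?poweR_ge0// ?poweR_lty// ge0_fin_numE ?poweR_ge0// poweR_lty.
Qed.

Let mvs h : measurable_fun setT (fun x : rV => v (x + h)).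
Proof. by apply: measurableT_comp => //; exact: measurable_fun_rVD. Qed.

Let mus h : measurable_fun setT (fun x : rV => u (x - h)).
Proof. by apply: measurableT_comp => //; exact: measurable_fun_rVB. Qed.

(** The bound does not depend on [h], because the norm of [v] is translation invariant; integrated
    against [|k|] it gives the absolute integrability behind both exchanges below. *)
Let pair_bound h : (\int[lam]_x `|u x * v (x + h)|%:E <= C)%E.
Proof.
apply: le_trans (holder_ge0 lam mu (mvs h) p0 q0 pq) _.
rewrite (@integral_rV_shift R n h (fun x => (`|v x| `^ q)%:E))//.
by apply/measurable_EFinP; apply: measurable_powR_comp; exact: measurableT_comp.
Qed.

Let F (z : rV * rV) := u z.1 * (k z.2 * v (z.1 + z.2)).

Let mF : measurable_fun setT F.
Proof.
apply: measurable_funM; first by apply: measurableT_comp => //; exact: measurable_fst.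
apply: measurable_funM; first by apply: measurableT_comp => //; exact: measurable_snd.
apply: measurableT_comp => //; apply: measurable_fun_rVD.
  exact: measurable_fst.
exact: measurable_snd.
Qed.

Let Foo : (\int[lam]_h \int[lam]_x `|F (x, h)|%:E < +oo)%E.
Proof.
have [_ koo] := (integrable_EFinP _ _).1 ik.
apply: (@le_lt_trans _ _ (\int[lam]_h (`|k h|%:E * C))%E).
  apply: ge0_le_integral => //.
  - by move=> h _; apply: integral_ge0 => x _; rewrite lee_fin.
  - apply: (@measurable_fun_fubini_tonelli_G _ _ _ _ _ lam (fun z => `|F z|%:E)) => //.
      by apply/measurable_EFinP; exact: measurableT_comp.
  - apply: emeasurable_funM => //; apply/measurable_EFinP; exact: measurableT_comp.
  - move=> h _; under eq_integral do rewrite /F/= mulrCA normrM EFinM.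
    rewrite ge0_integralZl_EFin//.
    + by apply: lee_wpmul2l; rewrite ?lee_fin.
    + apply/measurable_EFinP; apply: measurableT_comp => //.
      exact: measurable_funM.
have C0 : (0 <= C)%E by rewrite mule_ge0 ?poweR_ge0.
rewrite ge0_integralZr//.
- by rewrite lte_mul_pinfty// ?integral_ge0// ge0_fin_numE// integral_ge0.
- by apply/measurable_EFinP; exact: measurableT_comp.
Qed.

Lemma conv_Fubini :
  \int[lam]_x (u x * \int[lam]_h (k h * v (x + h))) =
  \int[lam]_h (k h * \int[lam]_x (u x * v (x + h))).
Proof.
transitivity (\int[lam]_x \int[lam]_h F (x, h)).
  apply: eq_Rintegral => x _; rewrite -RintegralZl_measurable//.
  apply: measurable_funM => //; apply: measurableT_comp => //; exact: measurable_fun_rVD.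
rewrite Rintegral_Fubini//.
  apply: eq_Rintegral => h _; rewrite -RintegralZl_measurable//.
    by apply: eq_Rintegral => x _; rewrite /F mulrCA.
  exact: measurable_funM.
rewrite (fubini_tonelli (fun z => `|F z|%:E))//.
by apply/measurable_EFinP; exact: measurableT_comp.
Qed.

(** The substitution [y = x + h] in the inner integral moves the shift from [v] to [u]; Fubini then
    exposes the convolution. *)
Lemma conv_adjoint :
  \int[lam]_h (k h * \int[lam]_x (u x * v (x + h))) =
  \int[lam]_y (conv k u y * v y).
Proof.
pose G (z : rV * rV) := k z.1 * u (z.2 - z.1) * v z.2.
have mG : measurable_fun setT G.
  apply: measurable_funM; last by apply: measurableT_comp => //; exact: measurable_snd.
  apply: measurable_funM; first by apply: measurableT_comp => //; exact: measurable_fst.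
  apply: measurableT_comp => //; apply: measurable_fun_rVB.
    exact: measurable_snd.
  exact: measurable_fst.
have mGh h : measurable_fun setT (fun y => G (h, y)).
  exact: measurable_funM (measurable_funM (measurable_cst (k h)) (mus h)) mv.
transitivity (\int[lam]_h \int[lam]_y G (h, y)).
  apply: eq_Rintegral => h _; rewrite -RintegralZl_measurable//; last exact: measurable_funM.
  rewrite -(@Rintegral_rV_shift h (fun y => G (h, y)))//.
  by apply: eq_Rintegral => x _; rewrite /G/= addrK mulrA.
rewrite Rintegral_Fubini//.
  by apply: eq_Rintegral => y _; rewrite -RintegralZr_measurable//; exact: measurable_conv_slice.
apply: le_lt_trans Foo.
rewrite le_eqVlt; apply/orP; left; apply/eqP; apply: eq_integral => h _.
rewrite -(@integral_rV_shift R n h (fun y => `|G (h, y)|%:E)).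
  by apply: eq_integral => x _; rewrite /G/F/= addrK mulrA (mulrC (u x)).
by apply/measurable_EFinP; apply: measurableT_comp.
Qed.

End convolution_adjoint.

(** * The Hardy-Littlewood-Sobolev inequality *)

Section layer_cake.
Context d (T : measurableType d) {R : realType} (m : {sigma_finite_measure set T -> \bar R}).
Local Open Scope ereal_scope.
Notation leb := (@lebesgue_measure R).

Lemma measurable_hypograph (W : T -> \bar R) : measurable_fun setT W ->
  measurable [set z : T * measurableTypeR R | (0 < z.2)%R /\ z.2%:E < W z.1].
Proof.
move=> mW.
rewrite (_ : [set z | _] =
  (setT `*` `]0%R, +oo[%classic) `&` [set z : T * measurableTypeR R | z.2%:E < W z.1]); last first.
  apply/seteqP; split=> -[x t] /=; rewrite in_itv/= andbT; first by move=> [].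
  by move=> [[]].
apply: measurableI; first exact: measurableX.
have m1 : measurable_fun setT (fun z : T * measurableTypeR R => z.2%:E).
  by apply/measurable_EFinP; exact: measurable_snd.
have m2 : measurable_fun setT (fun z : T * measurableTypeR R => W z.1).
  by apply: measurableT_comp => //; exact: measurable_fst.
by rewrite -[X in measurable X]setTI; exact: measurable_lte.
Qed.

Lemma measurable_distribution (W : T -> \bar R) : measurable_fun setT W ->
  measurable_fun setT (fun t : measurableTypeR R => m [set x | t%:E < W x]).
Proof.
move=> mW; pose E := [set z : T * measurableTypeR R | z.2%:E < W z.1].
have mE : measurable E.
  have m1 : measurable_fun setT (fun z : T * measurableTypeR R => z.2%:E).
    by apply/measurable_EFinP; exact: measurable_snd.
  have m2 : measurable_fun setT (fun z : T * measurableTypeR R => W z.1).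
    by apply: measurableT_comp => //; exact: measurable_fst.
  by rewrite -[X in measurable X]setTI; exact: measurable_lte.
rewrite (_ : (fun t => _) = m \o ysection E); first exact: measurable_fun_ysection.
apply/funext => t; congr (m _); apply/seteqP; split=> x; rewrite /ysection/=; by rewrite inE.
Qed.

(* W^q = \int_0^W q t^(q-1) dt, integrated in x by Tonelli *)
Lemma layer_cake (W : T -> \bar R) (q : R) : (0 < q)%R ->
  measurable_fun setT W -> (forall x, 0 <= W x) ->
  \int[m]_x (W x `^ q) <=
  \int[leb]_(t in `]0%R, +oo[) ((q * t `^ (q - 1))%:E * m [set x | t%:E < W x]).
Proof.
move=> q0 mW W0.
pose E := [set z : T * measurableTypeR R | (0 < z.2)%R /\ z.2%:E < W z.1].
have mE : measurable E by exact: measurable_hypograph.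
pose F (z : T * measurableTypeR R) := (q * z.2 `^ (q - 1) * \1_E z)%:E.
have F0 z : 0 <= F z by rewrite lee_fin !mulr_ge0 ?powR_ge0 ?(ltW q0).
have mpow : measurable_fun setT (fun t : measurableTypeR R => q * t `^ (q - 1))%R.
  by apply: measurable_funM => //; exact: measurable_powR_comp.
have mF : measurable_fun setT F.
  apply/measurable_EFinP; apply: measurable_funM; last exact: measurable_indic.
  by apply: (measurableT_comp mpow); exact: measurable_snd.
have cake (M : R) : (0 < M)%R ->
    \int[leb]_(t in `]0%R, M]) (q * t `^ (q - 1))%:E = (M `^ q)%:E.
  move=> M0; under eq_integral do rewrite EFinM.
  rewrite ge0_integralZl_EFin//.
  - rewrite integral_powR_0// -EFinM; congr EFin; field; by rewrite gt_eqF.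
  - by move=> t _; rewrite lee_fin powR_ge0.
  - by apply: measurable_funTS; apply/measurable_EFinP; exact: measurable_powR_comp.
  - exact: ltW.
have slice x : W x `^ q <= \int[leb]_t F (x, t).
  (* Only finite heights [M] below [W x] are compared; the case [W x = +oo] follows by letting [M]
     grow. *)
  have lower (M : R) : (0 < M)%R -> M%:E <= W x -> (M `^ q)%:E <= \int[leb]_t F (x, t).
    (* The right endpoint is dropped because the hypograph is strict: for [M = W x] it does not
       contain the height [M]. *)
    move=> M0 MW; rewrite -cake// -integral_itv_bndo_bndc; last first.
      by apply: measurable_funTS; apply/measurable_EFinP.
    rewrite integral_mkcond; apply: ge0_le_integral => //.
    - move=> t _; rewrite patchE; case: ifP => // _.
      by rewrite lee_fin mulr_ge0 ?powR_ge0 ?(ltW q0).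
    - apply/(measurable_restrictT _ _).1; first exact: measurable_itv.
      by apply: measurable_funTS; apply/measurable_EFinP.
    - by apply: measurableT_comp => //; exact: pair1_measurable.
    - move=> t _; rewrite patchE; case: ifPn => // /[!inE]/=; rewrite in_itv/= => /andP[t0 tM].
      rewrite /F/= indicE mem_set ?mulr1//; split => //=.
      by apply: lt_le_trans MW; rewrite lte_fin.
  have FI0 : 0 <= \int[leb]_t F (x, t) by exact: integral_ge0.
  have := W0 x; case Wx : (W x) => [r| |//] => r0.
  - have [->|rn0] := eqVneq r 0%R; first by rewrite poweR_EFin powR0 ?gt_eqF.
    by rewrite poweR_EFin lower ?Wx// lt_neqAle eq_sym rn0.
  - rewrite poweRyr ?gt_eqF// leye_eq; apply/eqP.
    apply: (@eq_infty _ _) => M; have [M0|M0] := leP M 0%R.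
      by apply: le_trans FI0; rewrite lee_fin.
    have := lower (M `^ q^-1)%R; rewrite powR_gt0// Wx leey => /(_ isT isT).
    by rewrite -powRrM mulVf ?gt_eqF// powRr1// ltW.
apply: (@le_trans _ _ (\int[m]_x \int[leb]_t F (x, t))).
  apply: ge0_le_integral => //.
  - by move=> x _; exact: poweR_ge0.
  - exact: (measurableT_comp (measurable_poweR _)).
  - exact: measurable_fun_fubini_tonelli_F.
rewrite (fubini_tonelli F)//.
rewrite [leRHS]integral_mkcond le_eqVlt; apply/orP; left; apply/eqP.
apply: eq_integral => t _; rewrite patchE; case: ifPn => [/[!inE]/=|tn].
  rewrite in_itv/= andbT => t0.
  under eq_integral do rewrite /F/= EFinM.
  rewrite ge0_integralZl_EFin//.
  - have mWt : measurable [set x | t%:E < W x].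
      by rewrite -[X in measurable X]setTI; exact: emeasurable_fun_o_infty.
    have <- : \int[m]_x (\1_[set x | (t%:E < W x)%E] x)%:E = m [set x | t%:E < W x].
      by rewrite integral_indic ?setIT.
    congr (_ * _).
    apply: eq_integral => x _; congr EFin; rewrite !indicE; congr (nat_of_bool _)%:R.
    by apply/idP/idP; rewrite !inE/=; [case|].
  - apply/measurable_EFinP.
    have mI : measurable_fun setT (\1_E : T * measurableTypeR R -> R).
      exact: measurable_indic.
    by apply: measurableT_comp; [exact: mI|exact: pair2_measurable].
  - by rewrite mulr_ge0 ?powR_ge0 ?(ltW q0).
apply: integral0_eq => x _; rewrite /F/= indicE memNset ?mulr0// => -[/= t0 _].
by move: tn; rewrite notin_setE/= in_itv/= t0.
Qed.

End layer_cake.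

Lemma measurable_ltr_natr d (T : measurableType d) (R : realType) (f g : T -> R) :
  measurable_fun setT f -> measurable_fun setT g ->
  measurable_fun setT (fun x => (f x < g x)%R%:R : R).
Proof.
move=> mf mg; have mfg := measurable_fun_ltr mf mg.
rewrite (_ : (fun x => _) = \1_((fun x => (f x < g x)%R) @^-1` [set true])).
  by apply: measurable_indic; rewrite -[X in measurable X]setTI; exact: mfg.
apply/funext => x; rewrite indicE; congr (nat_of_bool _)%:R.
by apply/idP/idP; rewrite inE.
Qed.

(** * The kernel |h|^-a inside and outside a ball *)

Section riesz_kernel.
Context {R : realType} {n : nat}.
Local Open Scope ereal_scope.
Notation rV := ('rV[R]_n).
Notation lam := (@lebesgue_rV R n).

(** At the origin the value is [0] for [a != 0], not infinity. In positive dimension the origin is a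
    null set, but pointwise inequalities have to treat it separately. *)
Definition kpow (a : R) (h : rV) : R := ((enorm h `^ a)^-1)%R.

Definition near_ball (r : R) (h : rV) : R := \1_[set x : rV | (enorm x < r)%R] h.

Definition off_ball (r : R) (h : rV) : R := \1_[set x : rV | (r <= enorm x)%R] h.

Lemma kpow_ge0 a h : (0 <= kpow a h)%R.
Proof. by rewrite invr_ge0 powR_ge0. Qed.

Lemma measurable_kpow a : measurable_fun setT (kpow a).
Proof.
rewrite /kpow; under eq_fun do rewrite -powRN.
by apply: measurable_powR_comp; exact: measurable_enorm.
Qed.

Lemma measurable_near_ball r : measurable_fun setT (near_ball r).
Proof. by apply: measurable_indic; exact: measurable_eball. Qed.

Lemma measurable_off_ball r : measurable_fun setT (off_ball r).
Proof. by apply: measurable_indic; exact: measurable_setC_eball. Qed.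

Lemma near_ballE r h : near_ball r h = (enorm h < r)%R%:R.
Proof. by rewrite /near_ball indicE; congr (nat_of_bool _)%:R; apply/idP/idP; rewrite inE. Qed.

Lemma off_ballE r h : off_ball r h = (r <= enorm h)%R%:R.
Proof. by rewrite /off_ball indicE; congr (nat_of_bool _)%:R; apply/idP/idP; rewrite inE. Qed.

Lemma integral_kpow_near (b r : R) : (0 < b)%R -> (b < n%:R)%R -> (0 < r)%R ->
  \int[lam]_h (kpow (n%:R - b) h * near_ball r h)%:E
  <= (n%:R * omega n * (r `^ b / b))%:E.
Proof.
move=> b0 bn r0; apply: le_trans (integral_eball_powR b0 bn r0).
rewrite [leRHS]integral_mkcond le_eqVlt; apply/orP; left; apply/eqP.
apply: eq_integral => h _; rewrite patchE near_ballE; case: ifPn => [/[!inE]/= ->|].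
  by rewrite mulr1.
by rewrite notin_setE/= => /negP/negbTE ->; rewrite mulr0.
Qed.

Lemma integral_kpow_off (b r : R) : (0 < n)%N -> (0 < b)%R -> (0 < r)%R ->
  \int[lam]_h (kpow (n%:R + b) h * off_ball r h)%:E
  <= (n%:R * omega n * (r `^ (- b) / b))%:E.
Proof.
move=> n0 b0 r0; apply: le_trans (integral_setC_eball_powR n0 b0 r0).
rewrite [leRHS]integral_mkcond le_eqVlt; apply/orP; left; apply/eqP.
apply: eq_integral => h _; rewrite patchE off_ballE; case: ifPn => [/[!inE]/= ->|].
  by rewrite mulr1.
by rewrite notin_setE/= => /negP/negbTE ->; rewrite mulr0.
Qed.

End riesz_kernel.

Section hardy_littlewood_sobolev.
Context {R : realType} {n : nat}.
Local Open Scope ereal_scope.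
Notation rV := ('rV[R]_n).
Notation lam := (@lebesgue_rV R n).
Notation leb := (@lebesgue_measure R).
Variables (b p : R) (w : rV -> R).
Hypotheses (b0 : (0 < b)%R) (p1 : (1 < p)%R) (bp : (b * p < n%:R)%R).
Hypotheses (mw : measurable_fun setT w) (w0 : forall x, (0 <= w x)%R).
Hypothesis woo : \int[lam]_x (w x `^ p)%:E < +oo.
Local Notation q := (n%:R * p / (n%:R - b * p))%R.
Local Notation e := (n%:R / p - b)%R.
Local Notation kap := (@kpow R n (n%:R - b)).

Let p0 : (0 < p)%R. Proof. exact: lt_trans p1. Qed.
Let nR0 : (0 < n%:R :> R)%R. Proof. by rewrite (lt_trans _ bp)// mulr_gt0. Qed.
Let n0 : (0 < n)%N. Proof. by rewrite -(ltr_nat R). Qed.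
Let bn : (b < n%:R)%R.
Proof. by apply: lt_trans bp; rewrite ltr_pMr. Qed.
Let nbp : (0 < n%:R - b * p)%R. Proof. by rewrite subr_gt0. Qed.
Let q0 : (0 < q)%R. Proof. by rewrite divr_gt0// mulr_gt0. Qed.
Let e0 : (0 < e)%R. Proof. by rewrite subr_gt0 ltr_pdivlMr. Qed.

(** Hölder's inequality: the conjugate power of the kernel is |h|^-(n + c) with [c = (n/p - b) p'],
    and [b p < n] makes [c] positive, so it is integrable off the ball. *)
Lemma hls_far : exists2 C : R, (0 < C)%R & forall (r : R) x, (0 < r)%R ->
  econv (fun h => kap h * off_ball r h)%R w x <= (C * r `^ (- e))%:E.
Proof.
pose p' : R := (p / (p - 1))%R.
have pm1 : (0 < p - 1)%R by rewrite subr_gt0.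
have p'0 : (0 < p')%R by rewrite divr_gt0.
have pp' : (p'^-1 + p^-1 = 1)%R by rewrite /p'; field; rewrite !gt_eqF.
pose c : R := (e * p')%R.
have c0 : (0 < c)%R by rewrite mulr_gt0.
have cE : (((n%:R - b) * p') = n%:R + c)%R by rewrite /c /p'; field; rewrite !gt_eqF.
have N0 : 0 <= \int[lam]_x (w x `^ p)%:E.
  by apply: integral_ge0 => x _; rewrite lee_fin powR_ge0.
pose N := fine (\int[lam]_x (w x `^ p)%:E).
have NE : \int[lam]_x (w x `^ p)%:E = N%:E by rewrite fineK// ge0_fin_numE.
have NR0 : (0 <= N)%R by rewrite fine_ge0.
pose C := ((n%:R * omega n / c) `^ p'^-1 * N `^ p^-1)%R.
(* Adding [1] makes the constant positive even when [w] vanishes almost everywhere. *)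
exists (C + 1)%R; first by rewrite ltr_pwDr// mulr_ge0 ?powR_ge0.
move=> r x r0.
have mk : measurable_fun setT (fun h => kap h * off_ball r h)%R.
  by apply: measurable_funM; [exact: measurable_kpow|exact: measurable_off_ball].
have mwx : measurable_fun setT (fun h : rV => w (x - h)%R).
  by apply: measurableT_comp => //; exact: measurable_fun_rVB.
have k0 h : (0 <= kap h * off_ball r h)%R.
  by rewrite mulr_ge0 ?kpow_ge0// off_ballE.
have := holder_ge0 lam mk mwx p'0 p0 pp'.
rewrite (_ : \int[lam]_h `|_ * w _|%:E = econv (fun h => kap h * off_ball r h)%R w x); last first.
  by apply: eq_integral => h _; rewrite ger0_norm// mulr_ge0.
move=> /le_trans; apply.
rewrite (_ : \int[lam]_h (`|w _| `^ p)%:E = N%:E); last first.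
  rewrite -NE -[RHS](@integral_rV_reflect R n x); last first.
    by apply/measurable_EFinP; exact: measurable_powR_comp.
  by apply: eq_integral => h _; rewrite ger0_norm.
rewrite poweR_EFin.
apply: (@le_trans _ _ ((n%:R * omega n * (r `^ (- c) / c))%:E `^ p'^-1 * (N `^ p^-1)%:E)).
  apply: lee_wpmul2r; first by rewrite lee_fin powR_ge0.
  apply: ge0_le_poweR; first by rewrite invr_ge0 ltW.
    by apply: integral_ge0 => h _; rewrite lee_fin powR_ge0.
  apply: le_trans (integral_kpow_off n0 c0 r0).
  rewrite le_eqVlt; apply/orP; left; apply/eqP.
  apply: eq_integral => h _; congr EFin.
  rewrite ger0_norm// powRM ?kpow_ge0 ?off_ballE//.
  case: (r <= enorm h)%R; last by rewrite powR0 ?gt_eqF// !mulr0.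
  by rewrite powR1 !mulr1 /kpow -!powRN -powRrM -cE mulNr.
rewrite poweR_EFin -EFinM lee_fin.
have -> : (n%:R * omega n * (r `^ (- c) / c) = (n%:R * omega n / c) * r `^ (- c))%R by ring.
rewrite powRM ?powR_ge0//; last by rewrite !mulr_ge0 ?omega_ge0// invr_ge0 ltW.
rewrite -powRrM (_ : - c * p'^-1 = - e)%R; last by rewrite /c mulNr mulfK// gt_eqF.
rewrite mulrAC -/C ler_wpM2r ?powR_ge0// lerDl//.
Qed.

(** At level [t] the kernel is cut at a radius [r] and [w] at a height [a = D t^(q/p)]. The far
    part, and the near part of the low values, are each at most [t/3]; where the total exceeds [t],
    the near part of the high values is at least [t/3], and Chebyshev's inequality bounds that
    set. *)
Lemma hls_levels : exists2 D : R, (0 < D)%R & forall t : R, (0 < t)%R ->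
  lam [set x | t%:E < econv kap w x] <=
  (D * t `^ (q / p))^-1%:E *
    \int[lam]_y (w y * ((D * t `^ (q / p) < w y)%R)%:R)%:E.
Proof.
have [C C0 far] := hls_far.
pose C1 : R := (n%:R * omega n / b + 1)%R.
have C10 : (0 < C1)%R by rewrite ltr_pwDr// !mulr_ge0 ?omega_ge0// invr_ge0 ltW.
have near r : (0 < r)%R -> \int[lam]_h (kap h * near_ball r h)%:E <= (C1 * r `^ b)%:E.
  move=> r0; apply: le_trans (integral_kpow_near b0 bn r0) _.
  rewrite lee_fin mulrA mulrAC ler_wpM2r ?powR_ge0// lerDl//.
(* The radius below solves [C r^-e = t/3]. Since [q/p - b/e = 1], this [D] then gives
   [a C1 r^b = t/3] at every level [t]. *)
pose D := (3 * C1 * (3 * C) `^ (b / e))^-1%R.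
have D0 : (0 < D)%R by rewrite invr_gt0 !mulr_gt0 ?powR_gt0// mulr_gt0.
exists D => // t t0.
set a := (D * t `^ (q / p))%R.
have a0 : (0 < a)%R by rewrite mulr_gt0// powR_gt0.
pose l := (t / 3)%R; have l0 : (0 < l)%R by rewrite divr_gt0.
pose r := ((3 * C / t) `^ e^-1)%R.
have tC0 : (0 < 3 * C / t)%R by rewrite divr_gt0// mulr_gt0.
have r0 : (0 < r)%R by rewrite powR_gt0.
have far_l : (C * r `^ (- e) = l)%R.
  rewrite /r -powRrM mulrN mulVf ?gt_eqF// powR_inv1 ?(ltW tC0)// /l; field.
  by rewrite !gt_eqF.
have near_l : (a * (C1 * r `^ b) = l)%R.
  rewrite /a /r -powRrM (mulrC _ b) powRM ?invr_ge0 ?(ltW t0)//; last by rewrite mulr_ge0// ltW.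
  have -> : (t^-1 `^ (b / e) = t `^ (- (b / e)))%R.
    by rewrite -powR_inv1 ?(ltW t0)// -powRrM mulN1r.
  have tt : (t `^ (q / p) * t `^ (- (b / e)) = t)%R.
    rewrite -powRD; last by apply/implyP => _; rewrite gt_eqF.
    rewrite (_ : q / p + - (b / e) = 1)%R ?powRr1 ?(ltW t0)//.
    have e0' : (n%:R - b * p != 0)%R by rewrite gt_eqF.
    have p00 : (p != 0)%R by rewrite gt_eqF.
    have -> : e = ((n%:R - b * p) / p)%R by field.
    by field; rewrite p00 e0'.
  set X := (_ `^ (b / e))%R in D D0 a a0 tt *.
  have X0 : (0 < X)%R by rewrite powR_gt0// mulr_gt0.
  transitivity (D * C1 * X * (t `^ (q / p) * t `^ (- (b / e))))%R; first by ring.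
  rewrite tt /D /l; field.
  by rewrite !gt_eqF.
pose wlo y := (w y * (w y <= a)%R%:R)%R.
pose whi y := (w y * (a < w y)%R%:R)%R.
have mlt : measurable_fun setT (fun y => ((a < w y)%R%:R : R)).
  by apply: measurable_ltr_natr.
have mle : measurable_fun setT (fun y => ((w y <= a)%R%:R : R)).
  rewrite (_ : (fun y => _) = (fun y => 1 - (a < w y)%R%:R)%R); first exact: measurable_funB.
  by apply/funext => y; rewrite leNgt; case: (a < w y)%R; rewrite ?subr0 ?subrr.
have mlo : measurable_fun setT wlo by exact: measurable_funM.
have mhi : measurable_fun setT whi by exact: measurable_funM.
have lo0 y : (0 <= wlo y)%R by rewrite mulr_ge0.
have hi0 y : (0 <= whi y)%R by rewrite mulr_ge0.
pose kn h := (kap h * near_ball r h)%R.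
pose kf h := (kap h * off_ball r h)%R.
have mkn : measurable_fun setT kn.
  by apply: measurable_funM; [exact: measurable_kpow|exact: measurable_near_ball].
have mkf : measurable_fun setT kf.
  by apply: measurable_funM; [exact: measurable_kpow|exact: measurable_off_ball].
have kn0 h : (0 <= kn h)%R by rewrite mulr_ge0 ?kpow_ge0// near_ballE.
have kf0 h : (0 <= kf h)%R by rewrite mulr_ge0 ?kpow_ge0// off_ballE.
have slice (k v : rV -> R) (x : rV) : measurable_fun setT k -> measurable_fun setT v ->
    measurable_fun setT (fun h : rV => (k h * v (x - h))%:E).
  by move=> mk mv; apply/measurable_EFinP; exact: measurable_conv_slice.
have split3 x : econv kap w x = econv kf w x + econv kn wlo x + econv kn whi x.
  rewrite /econv -ge0_integralD//; try by [exact: slice|move=> h _; rewrite lee_fin mulr_ge0].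
  rewrite -ge0_integralD//; try by [exact: slice|move=> h _; rewrite lee_fin mulr_ge0].
  - apply: eq_integral => h _; rewrite -!EFinD; congr EFin.
    rewrite /kf /kn /wlo /whi near_ballE off_ballE.
    rewrite (leNgt r) (leNgt _ a).
    by case: (enorm h < r)%R; case: (a < _)%R => /=; ring.
  - by move=> h _; rewrite -EFinD lee_fin addr_ge0// mulr_ge0.
  - by apply: emeasurable_funD; exact: slice.
have bfar x : econv kf w x <= l%:E by rewrite -far_l; exact: far.
have blo x : econv kn wlo x <= l%:E.
  apply: (@le_trans _ _ (\int[lam]_h (a%:E * (kn h)%:E))).
    apply: ge0_le_integral => //.
    - by move=> h _; rewrite lee_fin mulr_ge0.
    - exact: slice.
    - by apply: measurable_funeM; apply/measurable_EFinP.
    - move=> h _; rewrite -EFinM lee_fin mulrC ler_wpM2r// /wlo.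
      by have [wa|wa] := leP (w (x - h)%R) a; rewrite ?mulr1 ?mulr0//; exact: ltW.
  rewrite ge0_integralZl_EFin// ?(ltW a0)//; last 2 first.
  - by move=> h _; rewrite lee_fin.
  - exact/measurable_EFinP.
  by rewrite -near_l [leRHS]EFinM; apply: lee_wpmul2l; [rewrite lee_fin ltW|exact: near].
have mS : measurable_fun setT (econv kn whi) by exact: measurable_econv.
have S0 x : 0 <= econv kn whi x by exact: econv_ge0.
have sub : [set x | t%:E < econv kap w x] `<=` setT `&` [set x | `|econv kn whi x| >= l%:E].
  move=> x /= tT; split => //; rewrite gee0_abs//; apply: ltW; rewrite ltNge; apply/negP => Sl.
  move: tT; rewrite ltNge => /negP; apply.
  rewrite split3 (_ : t = l + l + l)%R; last by rewrite /l; field.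
  by rewrite !EFinD; apply: leeD => //; exact: leeD.
have mkap : measurable_fun setT kap by exact: measurable_kpow.
apply: (@le_trans _ _ (lam (setT `&` [set x | `|econv kn whi x| >= l%:E]))).
  apply: le_measure; rewrite ?inE//.
  - rewrite -[X in measurable X]setTI; apply: emeasurable_fun_o_infty => //.
    by apply: measurable_econv => // h; exact: kpow_ge0.
  - apply: emeasurable_fun_c_infty => //; exact: measurableT_comp.
have ch := le_integral_abse lam measurableT mS l0.
have SE : \int[lam]_x `|econv kn whi x| <= (C1 * r `^ b)%:E * \int[lam]_y (whi y)%:E.
  under eq_integral do rewrite gee0_abs//.
  rewrite integral_econv//; apply: lee_wpmul2r; last exact: near.
  by apply: integral_ge0 => y _; rewrite lee_fin.
have {}ch := le_trans ch SE.
(* The mass of the near kernel divided by the Chebyshev level is exactly the inverse height, by the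
   choice of [D]. *)
have -> : (a^-1 = l^-1 * (C1 * r `^ b))%R.
  have Y0 : (0 < C1 * r `^ b)%R by rewrite mulr_gt0// powR_gt0.
  by rewrite -near_l; move: (C1 * r `^ b)%R Y0 => Y Y0; field; rewrite !gt_eqF.
by rewrite [(l^-1 * _)%:E]EFinM -muleA lee_pdivlMl.
Qed.

(** This is Marcinkiewicz interpolation done by hand: the level bounds, whose truncation height
    varies with [t], are inserted in the layer cake formula, and Tonelli puts the integral in [t]
    inside. *)
Lemma hardy_littlewood_sobolev : \int[lam]_x (econv kap w x `^ q) < +oo.
Proof.
have [D D0 levels] := hls_levels.
have mkap : measurable_fun setT kap by exact: measurable_kpow.
have kap0 h : (0 <= kap h)%R by exact: kpow_ge0.
pose A (t : R) := (D * t `^ (q / p))%R.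
have mA : measurable_fun setT A.
  by apply: measurable_funM => //; exact: measurable_powR_comp.
(* The weight t^(q-1) of the layer cake divided by the height t^(q/p) is t^(s-1), and [s > 0]
   because [p > 1]. *)
pose s : R := (q - q / p)%R.
have s0 : (0 < s)%R.
  by rewrite subr_gt0 gtr_pMr// invf_lt1.
pose F (z : rV * measurableTypeR R) :=
  (q / D * z.2 `^ (s - 1) * (0 < z.2)%R%:R * (w z.1 * (A z.2 < w z.1)%R%:R))%:E.
have F0 z : 0 <= F z.
  by rewrite lee_fin !mulr_ge0 ?powR_ge0 ?(ltW q0)// ?invr_ge0 ltW.
have mF : measurable_fun setT F.
  apply/measurable_EFinP; apply: measurable_funM.
    apply: (@measurableT_comp _ _ _ _ _ _ (fun t : measurableTypeR R => q / D * t `^ (s - 1) * (0 < t)%R%:R)%R).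
      apply: measurable_funM; first by apply: measurable_funM => //; exact: measurable_powR_comp.
      exact: measurable_ltr_natr.
    exact: measurable_snd.
  have mw1 : measurable_fun setT (fun z : rV * measurableTypeR R => w z.1).
    by apply: measurableT_comp => //; exact: measurable_fst.
  apply: measurable_funM => //; apply: measurable_ltr_natr => //.
  by apply: measurableT_comp => //; exact: measurable_snd.
have qD0 : (0 <= q / D)%R by exact: divr_ge0 (ltW q0) (ltW D0).
have K0 : (0 <= q / D / s * D `^ (- (p - 1)))%R.
  by rewrite mulr_ge0 ?powR_ge0// divr_ge0// ltW.
have inner x : \int[leb]_t F (x, t) <= (q / D / s * D `^ (- (p - 1)))%:E * (w x `^ p)%:E.
  have pn0 : (p != 0)%R by rewrite gt_eqF.
  have [wx0|wx0] := eqVneq (w x) 0%R.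
    rewrite integral0_eq; last by move=> t _; rewrite /F/= wx0 mul0r mulr0.
    by rewrite wx0 powR0// mule0.
  have wx : (0 < w x)%R by rewrite lt_neqAle eq_sym wx0 w0.
  (* For fixed [x] the truncation indicator vanishes beyond the level [M], where the height [A M]
     equals [w x]. The factor [M^s] contributes (w x)^(p-1), which completes the remaining [w x] to
     its p-th power. *)
  pose M := ((w x / D) `^ (p / q))%R.
  have M0 : (0 < M)%R by rewrite powR_gt0// divr_gt0.
  have ME : (M `^ s = (w x) `^ (p - 1) * D `^ (- (p - 1)))%R.
    rewrite /M -powRrM (_ : p / q * s = p - 1)%R; last first.
      by rewrite /s; field; rewrite pn0 !gt_eqF.
    rewrite powRM ?invr_ge0 ?(ltW D0)// ; congr (_ * _)%R.
    by rewrite -powR_inv1 ?(ltW D0)// -powRrM mulN1r.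
  apply: (@le_trans _ _ (\int[leb]_(t in `]0%R, M]) ((q / D * w x)%:E * (t `^ (s - 1))%:E))).
    rewrite [leRHS]integral_mkcond; apply: ge0_le_integral => //.
    - by apply: measurableT_comp => //; exact: pair1_measurable.
    - apply/(measurable_restrictT _ _).1; first exact: measurable_itv.
      apply: measurable_funTS; apply: measurable_funeM; apply/measurable_EFinP.
      exact: measurable_powR_comp.
    - move=> t _; rewrite patchE; case: ifPn => [_|].
        rewrite -EFinM lee_fin /=.
        have : (0 <= q / D * w x * t `^ (s - 1))%R.
          by rewrite mulr_ge0 ?powR_ge0// mulr_ge0.
        by case: (_ < _)%R; case: (_ < _)%R; rewrite ?mulr1 ?mulr0 ?mul0r// mulrAC.
      rewrite notin_setE/= in_itv/= => /negP; rewrite negb_and -leNgt -ltNge => /orP[t0|Mt].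
        by rewrite /F/= ltNge t0/= mulr0 mul0r.
      suff wA : (w x <= A t)%R by rewrite /F/= (ltNge (A t)) wA/= !mulr0.
      have := gt0_ltr_powR (_ : 0 < q / p)%R _ _ Mt.
      rewrite divr_gt0// !nnegrE (ltW M0) (ltW (lt_trans M0 Mt)) => /(_ isT isT isT).
      rewrite /M -powRrM (_ : p / q * (q / p) = 1)%R; last first.
        by field; rewrite pn0 !gt_eqF.
      rewrite powRr1; last by rewrite divr_ge0// ltW.
      by rewrite ltr_pdivrMr// mulrC => /ltW.
  rewrite ge0_integralZl_EFin//; last 3 first.
  - by move=> t _; rewrite lee_fin powR_ge0.
  - by apply: measurable_funTS; apply/measurable_EFinP; exact: measurable_powR_comp.
  - by rewrite mulr_ge0.
  rewrite integral_powR_0// -!EFinM lee_fin ME.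
  rewrite -(mulr_powRB1 (w0 x) p0) le_eqVlt; apply/orP; left; apply/eqP.
  by field; rewrite !gt_eqF.
apply: le_lt_trans (layer_cake lam q0 _ _) _.
- exact: measurable_econv.
- by move=> x; exact: econv_ge0.
apply: (@le_lt_trans _ _ (\int[leb]_t \int[lam]_x F (x, t))).
  rewrite integral_mkcond; apply: ge0_le_integral => //.
  - move=> t _; rewrite patchE; case: ifP => // _.
    by rewrite mule_ge0// lee_fin mulr_ge0 ?powR_ge0 ?(ltW q0).
  - apply/(measurable_restrictT _ _).1; first exact: measurable_itv.
    apply: measurable_funTS; apply: emeasurable_funM.
      by apply/measurable_EFinP; apply: measurable_funM => //; exact: measurable_powR_comp.
    by apply: measurable_distribution; exact: measurable_econv.
  - exact: measurable_fun_fubini_tonelli_G.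
  - move=> t _; rewrite patchE; case: ifPn => [/[!inE]/=|_]; last exact: integral_ge0.
    rewrite in_itv/= andbT => t0.
    apply: (@le_trans _ _ ((q * t `^ (q - 1))%:E * ((A t)^-1%:E *
      \int[lam]_y (w y * ((A t < w y)%R)%:R)%:E))).
      by apply: lee_wpmul2l; [rewrite lee_fin mulr_ge0 ?powR_ge0 ?(ltW q0)|exact: levels].
    rewrite muleA -EFinM -ge0_integralZl_EFin//; last 3 first.
    + by move=> y _; rewrite lee_fin mulr_ge0.
    + apply/measurable_EFinP; apply: measurable_funM => //.
      exact: measurable_ltr_natr.
    + apply: divr_ge0; apply: mulr_ge0; rewrite ?powR_ge0//; exact: ltW.
    rewrite le_eqVlt; apply/orP; left; apply/eqP; apply: eq_integral => y _.
    rewrite /F/= t0 mulr1 -EFinM; congr EFin; congr (_ * _)%R.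
    have -> : (t `^ (s - 1) = t `^ (q - 1) * t `^ (- (q / p)))%R.
      rewrite -powRD; last by apply/implyP => _; rewrite gt_eqF.
      by congr (_ `^ _)%R; rewrite /s; ring.
    rewrite /A invfM -powRN; set X := (t `^ (q - 1))%R; set Y := (t `^ _)%R.
    exact: mulrACA.
rewrite -(fubini_tonelli F)//.
apply: (@le_lt_trans _ _ (\int[lam]_x ((q / D / s * D `^ (- (p - 1)))%:E * (w x `^ p)%:E))).
  apply: ge0_le_integral => //.
  - by move=> x _; exact: integral_ge0.
  - exact: measurable_fun_fubini_tonelli_F.
  - by apply: measurable_funeM; apply/measurable_EFinP; exact: measurable_powR_comp.
rewrite ge0_integralZl_EFin//; last 2 first.
- by move=> x _; rewrite lee_fin powR_ge0.
- by apply/measurable_EFinP; exact: measurable_powR_comp.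
by rewrite lte_mul_pinfty// lee_fin.
Qed.

End hardy_littlewood_sobolev.

(** * Smooth bumps and the fundamental lemma *)

Section smooth_functions.
Context {R : realType}.
Implicit Types f g : R -> R.

(** C^k regularity with the derivative carried as a witness, so that stability under products and
    compositions is a direct induction. *)
Fixpoint Cdiff (k : nat) g : Prop :=
  if k is l.+1 then exists2 g', (forall x, is_derive x (1 : R) g (g' x)) & Cdiff l g'
  else continuous g.

Definition smooth1 g := forall k, Cdiff k g.

Lemma Cdiff_continuous k g : Cdiff k g -> continuous g.
Proof.
case: k => [//|k] [g' dg _] x; apply: differentiable_continuous.
by apply/derivable1_diffP; case: (dg x).
Qed.

Lemma CdiffW k g : Cdiff k.+1 g -> Cdiff k g.
Proof.
elim: k g => [|k IH] g; first exact: Cdiff_continuous.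
by move=> [g' dg Cg]; exists g' => //; exact: IH.
Qed.

Lemma Cdiff_cst k (c : R) : Cdiff k (fun=> c).
Proof.
elim: k c => [|k IH] c; first by move=> x; exact: cvg_cst.
by exists (fun=> 0) => [x|]; [exact: is_derive_cst|exact: IH].
Qed.

Lemma Cdiff_id k : Cdiff k (fun x : R => x).
Proof.
case: k => [|k]; first by move=> x; exact: cvg_id.
by exists (fun=> 1) => [x|]; [exact: is_derive_id|exact: Cdiff_cst].
Qed.

Lemma CdiffD k f g : Cdiff k f -> Cdiff k g -> Cdiff k (fun x => f x + g x).
Proof.
elim: k f g => [|k IH] f g /=.
  by move=> cf cg x; apply: cvgD; [exact: cf|exact: cg].
move=> [f' df Cf] [g' dg Cg]; exists (fun x => f' x + g' x); last exact: IH.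
by move=> x; exact: is_deriveD.
Qed.

Lemma CdiffM k f g : Cdiff k f -> Cdiff k g -> Cdiff k (fun x => f x * g x).
Proof.
elim: k f g => [|k IH] f g.
  by move=> cf cg x; apply: cvgM; [exact: cf|exact: cg].
move=> Cf Cg; have [f' df Cf'] := Cf; have [g' dg Cg'] := Cg.
exists (fun x => f x * g' x + g x * f' x); first by move=> x; exact: is_deriveM.
by apply: CdiffD; apply: IH => //; exact: CdiffW.
Qed.

Lemma Cdiff_comp k f g : Cdiff k f -> Cdiff k g -> Cdiff k (fun x => f (g x)).
Proof.
elim: k f g => [|k IH] f g.
  by move=> cf cg x; apply: continuous_comp; [exact: cg|exact: cf].
move=> [f' df Cf'] Cg; have [g' dg Cg'] := Cg.
exists (fun x => f' (g x) * g' x); first by move=> x; exact: is_derive1_comp.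
by apply: CdiffM => //; apply: IH => //; exact: CdiffW.
Qed.

Lemma Cdiff_expR k : Cdiff k (@expR R).
Proof.
elim: k => [|k IH]; first exact: continuous_expR.
by exists expR => // x; exact: is_derive_expR.
Qed.

(** The factors t^-m make the family generated by exp(-1/t) stable under differentiation, whence
    smoothness by induction on the order for all [m] at once. *)
Definition flat (m : nat) (t : R) : R :=
  if 0 < t then t^-1 ^+ m * expR (- t^-1) else 0.

Lemma flat_ge0 m t : 0 <= flat m t.
Proof. by rewrite /flat; case: ifP => // t0; rewrite mulr_ge0 ?expR_ge0// exprn_ge0// invr_ge0 ltW. Qed.

(** With u = 1/t and N = m + 2, the inequality exp u >= (u/N)^N absorbs t^-m and leaves t^2. A
    quadratic bound is what the derivative at [0] calls for. *)
Lemma flat_bound m : exists2 C : R, 0 <= C & forall t, `|flat m t| <= C * `|t| ^+ 2.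
Proof.
pose N := m.+2; exists (N%:R ^+ N); first by rewrite exprn_ge0.
move=> t; rewrite ger0_norm ?flat_ge0// /flat; case: ifPn => t0; last first.
  by rewrite mulr_ge0 ?exprn_ge0.
rewrite (ger0_norm (ltW t0)).
have u0 : 0 < t^-1 by rewrite invr_gt0.
have h : (t^-1 / N%:R) ^+ N <= expR (t^-1).
  have -> : expR t^-1 = expR (t^-1 / N%:R) ^+ N.
    by rewrite -expRM_natl mulrC divfK// pnatr_eq0.
  rewrite lerXn2r ?nnegrE ?expR_ge0 ?divr_ge0 ?(ltW u0)//.
  by apply: le_trans (expR_ge1Dx _); rewrite lerDr.
rewrite expRN ler_pdivrMr ?expR_gt0//.
apply: le_trans (_ : N%:R ^+ N * t ^+ 2 * (t^-1 / N%:R) ^+ N <= _); last first.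
  by rewrite ler_wpM2l// mulr_ge0 ?exprn_ge0// ltW.
rewrite exprMn [t^-1 ^+ N * _]mulrC mulrACA -exprMn mulfV ?pnatr_eq0// expr1n mul1r.
have -> : N = (m + 2)%N by rewrite addn2.
by rewrite (exprD _ m 2) mulrCA -exprMn mulfV ?gt_eqF// expr1n mulr1.
Qed.

Lemma is_derive_flat m x :
  is_derive x (1 : R) (flat m) (- m%:R * flat m.+1 x + flat m.+2 x).
Proof.
have [x0|x0|->] := ltgtP x 0.
- have -> : - m%:R * flat m.+1 x + flat m.+2 x = 0.
    by rewrite /flat ltNge (ltW x0)/= mulr0 addr0.
  have near0 : \near x, cst 0 x = flat m x.
    near=> y; rewrite /flat ifN// -leNgt ltW//; near: y; exact: lt_nbhsl.
  by apply: near_eq_is_derive near0 _; exact: is_derive_cst.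
- have dV : is_derive x (1 : R) (fun y : R => y^-1) (- x ^- 2 *: 1).
    by apply: is_deriveV; rewrite ?gt_eqF//; exact: is_derive_id.
  have dE : is_derive x (1 : R) (fun y : R => expR (- y^-1)) (expR (- x^-1) * (x ^- 2)).
    apply: (@is_derive1_comp _ expR (fun y : R => - y^-1)).
    by apply: (is_derive_eq (is_deriveN dV)); rewrite scaleNr opprK [LHS]mulr1.
  have nearE : \near x, x^-1 ^+ m * expR (- x^-1) = flat m x.
    near=> y; rewrite /flat ifT//; near: y; exact: lt_nbhsr.
  apply: near_eq_is_derive nearE _.
  have dX := is_deriveX m dV; rewrite exprfctE in dX.
  apply: (is_derive_eq (is_deriveM dX dE)).
  rewrite /flat x0 /GRing.scale/= -exprVn; set E := expR _; set Y := x^-1.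
  case: m {dX} => [|m] /=; first by rewrite !mul0r !expr0; ring.
  by rewrite !exprS; ring.
- have -> : - m%:R * flat m.+1 0 + flat m.+2 0 = 0.
    by rewrite /flat ltxx/= mulr0 addr0.
  (* The difference quotient at [0] is at most [C |h|], so the derivative there is [0]. *)
  have [C C0 hC] := flat_bound m.
  have f0 : flat m 0 = 0 by rewrite /flat ltxx.
  have H : h^-1 *: ((flat m \o shift 0) (h *: 1) - flat m 0) @[h --> 0^'] --> (0 : R).
    apply/cvgrPdist_le => e e0; near=> h.
    rewrite sub0r normrN f0 subr0 /= addr0 [h *: 1]mulr1 normrZ.
    have h0 : h != 0 by near: h; exact: nbhs_dnbhs_neq.
    rewrite normfV ler_pdivrMl ?normr_gt0//.
    apply: le_trans (hC h) _; rewrite expr2 mulrA mulrC; apply: ler_wpM2l => //.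
    have hs : `|h| <= e / (C + 1).
      by near: h; apply: dnbhs0_le; rewrite divr_gt0// ltr_pwDr.
    apply: (@le_trans _ _ ((C + 1) * (e / (C + 1)))).
      by apply: ler_pM => //; rewrite lerDl.
    by rewrite mulrC divfK// gt_eqF// ltr_pwDr.
  by split; [apply/cvg_ex; exists 0|apply: cvg_lim].
Unshelve. all: by end_near. Qed.

Lemma Cdiff_flat k m : Cdiff k (flat m).
Proof.
elim: k m => [|k IH] m.
  move=> x; apply: differentiable_continuous; apply/derivable1_diffP.
  by case: (is_derive_flat m x).
exists (fun x => - m%:R * flat m.+1 x + flat m.+2 x); first exact: is_derive_flat.
by apply: CdiffD => //; apply: CdiffM => //; exact: Cdiff_cst.
Qed.

(** As [k] grows, these functions tend to the indicator of []a, b[] while staying between [0] and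
    [1]; smooth approximants of intervals are thus explicit, without mollification. *)
Definition bump (a b : R) (k : nat) (t : R) : R :=
  1 - expR (- (k%:R * (flat 0 (t - a) * flat 0 (b - t)))).

Lemma smooth1_bump a b k : smooth1 (bump a b k).
Proof.
move=> l; rewrite /bump.
have Cc := @Cdiff_cst l; have Ci := @Cdiff_id l.
have CN f : Cdiff l f -> Cdiff l (fun x => - f x).
  move=> Cf; under eq_fun do rewrite -mulN1r; exact: CdiffM.
apply: CdiffD => //; apply/CN; apply: (Cdiff_comp (Cdiff_expR l)).
apply/CN; apply: CdiffM => //; apply: CdiffM.
- by apply: (Cdiff_comp (Cdiff_flat l 0)); apply: CdiffD.
- by apply: (Cdiff_comp (Cdiff_flat l 0)); apply: CdiffD => //; exact: CN.
Qed.

Lemma bump_ge0_le1 a b k t : 0 <= bump a b k t <= 1.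
Proof.
rewrite /bump subr_ge0 -expR0 ler_expR oppr_le0 expR0 gerBl expR_ge0 andbT.
by rewrite !mulr_ge0 ?flat_ge0.
Qed.

Lemma bump_eq0 a b k t : ~~ (a < t < b) -> bump a b k t = 0.
Proof.
rewrite negb_and -!leNgt => h; rewrite /bump (_ : _ * _ = 0) ?oppr0 ?expR0 ?subrr//.
rewrite /flat !subr_gt0; case/orP: h; rewrite leNgt => /negbTE ->; rewrite ?mul0r ?mulr0//.
Qed.

Lemma bump_cvg a b t : a < t < b -> bump a b k t @[k --> \oo] --> (1 : R).
Proof.
move=> /andP[at_ tb]; pose c := flat 0 (t - a) * flat 0 (b - t).
have c0 : 0 < c by rewrite mulr_gt0// /flat subr_gt0 ?at_ ?tb expr0 mul1r expR_gt0.
apply/cvgrPdist_lt => e e0.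
near=> k; rewrite /bump opprB addrC subrK ger0_norm ?expR_ge0// -/c.
rewrite expRN -(invrK e) ltf_pV2 ?posrE ?expR_gt0 ?invr_gt0//.
apply: lt_le_trans (expR_ge1Dx _); apply: (@lt_le_trans _ _ (k%:R * c)); last by rewrite lerDr.
rewrite -ltr_pdivrMr//; near: k; exact: nbhs_infty_gtr.
Unshelve. all: by end_near. Qed.

End smooth_functions.

(** * Partial derivatives of products of one-variable functions *)

Section directional_derivatives.
Context {R : realType} (V W : normedModType R).

Lemma is_derive_cvg (f : V -> W) (a v : V) (df : W) :
  h^-1 *: ((f \o shift a) (h *: v) - f a) @[h --> 0^'] --> df -> is_derive a v f df.
Proof. by move=> h; split; [apply/cvg_ex; exists df|apply: cvg_lim]. Qed.

Lemma cvg_is_derive (f : V -> W) (a v : V) (df : W) : is_derive a v f df ->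
  h^-1 *: ((f \o shift a) (h *: v) - f a) @[h --> 0^'] --> df.
Proof. by move=> [d <-]; exact: d. Qed.

Lemma derive_shift (f : V -> W) (b v x : V) :
  'D_v (fun y => f (y + b)) x = 'D_v f (x + b).
Proof.
rewrite /derive (_ : (fun h => _) =
  (fun h : R => h^-1 *: ((f \o shift (x + b)) (h *: v) - f (x + b))))//.
by apply/funext => h /=; rewrite addrA.
Qed.

Lemma derivable_shift (f : V -> W) (b v x : V) :
  derivable f (x + b) v -> derivable (fun y => f (y + b)) x v.
Proof.
rewrite /derivable (_ : (fun h => _) =
  (fun h : R => h^-1 *: (((fun y => f (y + b)) \o shift x) (h *: v) - f (x + b))))//.
by apply/funext => h /=; rewrite addrA.
Qed.

End directional_derivatives.

Section smooth_iterates.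
Context {R : realType}.

Lemma smooth1_derive1 (g : R -> R) : smooth1 g ->
  smooth1 (derive1 g) /\ forall x, is_derive x (1 : R) g ((derive1 g) x).
Proof.
move=> sg; split=> [k|x]; last first.
  have [g' dg _] := sg 1%N; rewrite derive1E; apply: derivableP.
  by case: (dg x).
have [g' dg Cg'] := sg k.+1; suff -> : (derive1 g) = g' by [].
by apply/funext => x; rewrite derive1E; case: (dg x).
Qed.

Lemma smooth1_derive1n (g : R -> R) k : smooth1 g ->
  smooth1 (derive1n k g) /\ forall x, is_derive x (1 : R) (derive1n k g) (derive1n k.+1 g x).
Proof.
move=> sg; have sk : smooth1 (derive1n k g).
  by elim: k => [|k IH]; [rewrite derive1n0|rewrite derive1nS; exact: (smooth1_derive1 IH).1].
by split => // x; rewrite derive1nS; exact: (smooth1_derive1 sk).2.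
Qed.

End smooth_iterates.

Section tensor_fields.
Context {R : realType} {n : nat}.
Notation rV := ('rV[R]_n).

Definition tensor (G : 'I_n -> R -> R) (x : rV) : R := \prod_j G j (x ord0 j).

Lemma continuous_tensor (G : 'I_n -> R -> R) :
  (forall j, continuous (G j)) -> continuous (tensor G).
Proof.
move=> cG; rewrite /tensor; elim: (index_enum _) => [|j s IH].
  by under eq_fun do rewrite big_nil; exact: cst_continuous.
under eq_fun do rewrite big_cons.
move=> x; apply: (@continuousM R rV); last exact: IH.
apply: (@continuous_comp rV R R (fun y => y ord0 j) (G j)); last exact: cG.
exact: coord_continuous.
Qed.

(** Along a coordinate direction a single factor moves; the product [C] of the others is constant
    and leaves the difference quotient. *)
Lemma is_derive_tensor (G : 'I_n -> R -> R) (dG : 'I_n -> R -> R) (e : rV) (i : 'I_n) (x : rV) :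
  is_derive (x ord0 i) (1 : R) (G i) (dG i (x ord0 i)) ->
  is_derive x (delta_mx ord0 i) (fun y => tensor G y *: e)
    (tensor (fun j => if j == i then dG j else G j) x *: e).
Proof.
move=> /cvg_is_derive dGi; apply: is_derive_cvg.
pose C := \prod_(j | j != i) G j (x ord0 j).
have -> : tensor (fun j => if j == i then dG j else G j) x = dG i (x ord0 i) * C.
  rewrite /tensor (bigD1 i)//= eqxx; congr (_ * _).
  by apply: eq_bigr => j /negbTE ->.
have tE (t : R) : tensor G (t *: delta_mx ord0 i + x) = G i (t + x ord0 i) * C.
  rewrite /tensor (bigD1 i)//= !mxE !eqxx mulr1; congr (_ * _).
  by apply: eq_bigr => j ji; rewrite !mxE (negbTE ji) andbF mulr0 add0r.
have t0 : tensor G x = G i (x ord0 i) * C.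
  by have := tE 0; rewrite scale0r !add0r.
have -> : (fun h : R => h^-1 *: (((fun y => tensor G y *: e) \o shift x) (h *: delta_mx ord0 i) -
      tensor G x *: e)) =
    (fun h : R => ((h^-1 *: ((G i \o shift (x ord0 i)) (h *: 1) - G i (x ord0 i))) * C) *: e).
  apply/funext => h /=; rewrite tE t0 -scalerBl scalerA -mulrBl mulrA; congr (_ *: _).
  by rewrite [h *: 1]mulr1.
apply: cvgZr_tmp.
by apply: cvgM => //; exact: cvg_cst.
Qed.

(** Each partial derivative acts on one factor only, so the iterate depends on [s] only through the
    number of occurrences of each coordinate. *)
Lemma iter_pderiv_tensor (g : 'I_n -> R -> R) (e : rV) (s : seq 'I_n) :
  (forall j, smooth1 (g j)) ->
  iter_pderiv s (fun y => tensor g y *: e) =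
  (fun y => tensor (fun j => derive1n (count_mem j s) (g j)) y *: e).
Proof.
move=> sg; elim: s => [|i s IH].
  apply/funext => y /=; congr (tensor _ _ *: _).
rewrite [LHS]/= -/(iter_pderiv s _) IH; apply/funext => x.
have := @is_derive_tensor (fun j => derive1n (count_mem j s) (g j)) (fun j => derive1n (count_mem j s).+1 (g j)) e i x.
move=> /(_ ((smooth1_derive1n _ (sg i)).2 _)) [_ ->].
congr (tensor _ _ *: _); apply/funext => j /=; rewrite eq_sym.
by case: (i == j).
Qed.

Lemma smooth_tensor (g : 'I_n -> R -> R) (e : rV) :
  (forall j, smooth1 (g j)) -> smooth (fun y => tensor g y *: e).
Proof.
move=> sg s; rewrite iter_pderiv_tensor//; split.
  have ct : continuous (tensor (fun j => derive1n (count_mem j s) (g j))).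
    by apply: continuous_tensor => j; exact: ((smooth1_derive1n _ (sg j)).1 0%N).
  by move=> x; apply: (@continuousZ R rV rV _ (fun=> e) x (ct x)); exact: cst_continuous.
move=> i x.
have := @is_derive_tensor (fun j => derive1n (count_mem j s) (g j)) (fun j => derive1n (count_mem j s).+1 (g j)) e i x.
by move=> /(_ ((smooth1_derive1n _ (sg i)).2 _)) [].
Qed.

Lemma test_field_tensor_bump (a b : 'I_n -> R) (e : rV) k :
  test_field (fun y => tensor (fun j => bump (a j) (b j) k) y *: e).
Proof.
split; first by apply: smooth_tensor => j; exact: smooth1_bump.
have cb : compact [set y : rV | forall j, `[a j, b j]%classic (y ord0 j)].
  by apply: (@rV_compact R n (fun j => `[a j, b j]%classic)) => j; exact: segment_compact.
apply: (subclosed_compact (@closed_closure _ _) cb).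
rewrite [X in _ `<=` X](closure_id _).1; last first.
  by apply: compact_closed => //; exact: norm_hausdorff.
apply: closure_subset => y /= ty j; rewrite in_itv/=.
apply/negPn/negP => yj; move/negP: ty; apply; apply/eqP.
rewrite /tensor (bigD1 j)//= bump_eq0 ?mul0r ?scale0r//.
by apply: contra yj => /andP[/ltW -> /ltW ->].
Qed.

End tensor_fields.

(** * Measures with a density and the sigma-algebra of open boxes *)

Section density.
Context d (T : measurableType d) (R : realType) (mu : {measure set T -> \bar R}).
Variables (f : T -> \bar R) (mf : measurable_fun setT f) (f0 : forall x, (0 <= f x)%E).

(** The proofs of measurability and positivity are arguments, so that the measure structure can be
    inferred from the term. *)
Definition density of measurable_fun setT f & (forall x, (0 <= f x)%E) :=
  fun A : set T => (\int[mu]_(x in A) f x)%E.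

Let density0 : density mf f0 set0 = 0%E.
Proof. exact: integral_set0. Qed.

Let density_ge0 A : (0 <= density mf f0 A)%E.
Proof. exact: integral_ge0. Qed.

Let density_sigma_additive : semi_sigma_additive (density mf f0).
Proof. exact: semi_sigma_additive_nng_induced. Qed.

HB.instance Definition _ := isMeasure.Build _ _ _ (density mf f0)
  density0 density_ge0 density_sigma_additive.

End density.

Lemma compact_measurable_rV (R : realType) n (K : set 'rV[R]_n) : compact K -> measurable K.
Proof.
move=> cK; apply: closed_measurable_rV.
by apply: compact_closed => //; exact: norm_hausdorff.
Qed.

Section open_boxes.
Context {R : realType} {n : nat}.
Notation rV := ('rV[R]_n).

Definition obox (a b : 'I_n -> R) : set rV := [set x | forall i, a i < x ord0 i < b i].

Definition oboxes : set (set rV) := [set A | exists a b, A = obox a b].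

Lemma measurable_obox a b : measurable (obox a b).
Proof.
apply: (@measurable_rV_box _ _ (fun i => [set t | a i < t < b i])) => i.
rewrite (_ : [set t | _] = `]a i, b i[%classic); first exact: measurable_itv.
by apply/seteqP; split=> t /=; rewrite in_itv.
Qed.

Lemma obox_setI a b c d : obox a b `&` obox c d =
  obox (fun i => Num.max (a i) (c i)) (fun i => Num.min (b i) (d i)).
Proof.
apply/seteqP; split=> [x [h1 h2] i|x h].
  by rewrite gt_max lt_min; have /andP[-> ->] := h1 i; have /andP[-> ->] := h2 i.
by split=> i; have := h i; rewrite gt_max lt_min => /andP[/andP[h1 h2] /andP[h3 h4]]; apply/andP.
Qed.

(** Balls of the sup norm are open boxes, and an open set is the union of the countably many balls
    of rational centre and radius [1 / (k + 1)] that it contains. *)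
Lemma measurable_oboxes : (@measurable _ rV) = <<s oboxes >>.
Proof.
rewrite eqEsubset; split; last first.
  apply: smallest_sub; first exact: sigma_algebra_measurable.
  by move=> _ [a [b ->]]; exact: measurable_obox.
apply: smallest_sub; first exact: smallest_sigma_algebra.
move=> A oA.
pose c (i : 'rV[rat]_n * nat) : rV := map_mx ratr i.1.
pose B i := ball (c i) (i.2.+1%:R^-1 : R).
pose F i := if `[< B i `<=` A >] then B i else set0.
have -> : A = \bigcup_i F i.
  rewrite eqEsubset; split=> [x Ax|x [i _]]; last first.
    by rewrite /F; case: ifP => [/asboolP + Bx|//]; apply.
  have /nbhs_ballP[e /= e0 eA] : nbhs x A by exact: open_nbhs_nbhs.
  have [k] : exists k : nat, k.+1%:R^-1 < e / 2.
    have := near_infty_natSinv_lt (PosNum (divr_gt0 e0 (ltr0n R 2))).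
    by case => k _ /(_ k (leqnn _)) /= ke; exists k.
  set d := k.+1%:R^-1 => de.
  have d0 : 0 < d by rewrite invr_gt0.
  have ratP (a : R) : exists q : rat, `|ratr q - a| < d.
    have [|q] := @rat_in_itvoo R (a - d) (a + d); first by rewrite ltrD2l gtrN.
    by rewrite in_itv /= -ltr_distl => qd; exists q.
  have [v vx] := choice (fun j => ratP (x ord0 j)).
  pose i := (\row_j v j, k).
  have Bix : B i x.
    split=> [|a j]; first by rewrite invr_gt0.
    by rewrite ord1 /ball /= !mxE; exact: vx.
  exists i => //; rewrite /F ifT//; apply/asboolP => y Biy; apply: eA.
  have /ball_sym Bxi := Bix.
  apply: le_ball (ball_triangle Bxi Biy).
  by rewrite [leRHS](splitr e) lerD// ltW.
apply: (@countable_bigcupT_measurable _ (g_sigma_algebraType oboxes) _ F).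
  exact: countableP.
move=> i; rewrite /F; case: ifP => _; last exact: measurable0.
apply: sub_sigma_algebra.
pose e : R := i.2.+1%:R^-1.
exists (fun j => c i ord0 j - e), (fun j => c i ord0 j + e).
apply/seteqP; split=> [x [_ Bx] j|x Bx]; rewrite /=.
  by have := Bx ord0 j; rewrite /ball/= distrC ltr_distl.
split=> [|a j]; first by rewrite invr_gt0.
by rewrite ord1 /ball/= distrC ltr_distl; exact: Bx.
Qed.

Lemma compact_cbox (a b : 'I_n -> R) : compact [set y : rV | forall j, a j <= y ord0 j <= b j].
Proof.
rewrite (_ : [set y | _] = [set y : rV | forall j, `[a j, b j]%classic (y ord0 j)]).
  by apply: (@rV_compact R n (fun j => `[a j, b j]%classic)) => j; exact: segment_compact.
by apply/seteqP; split=> y /= h j; have := h j; rewrite in_itv.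
Qed.

End open_boxes.

(** * The fundamental lemma of the calculus of variations *)

Section fundamental_lemma.
Context {R : realType} {n : nat}.
Notation rV := ('rV[R]_n).
Notation lam := (@lebesgue_rV R n).
Variable u : rV -> R.
Hypothesis mu : measurable_fun setT u.
Hypothesis u_loc : forall K, compact K -> lam.-integrable K (EFin \o u).
Hypothesis u_test : forall a b k, \int[lam]_x (u x * tensor (fun j => bump (a j) (b j) k) x) = 0.

Let bumpt a b k : rV -> R := tensor (fun j => bump (a j) (b j) k).

Let bumpt_ge0_le1 a b k x : 0 <= bumpt a b k x <= 1.
Proof.
rewrite /bumpt /tensor; apply: (big_ind (fun t : R => 0 <= t <= 1)) => [|s t /andP[s0 s1] /andP[t0 t1]|j _].
- by rewrite ler01 lexx.
- by rewrite mulr_ge0// mulr_ile1.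
- exact: bump_ge0_le1.
Qed.

Let bumpt_eq0 a b k x : ~ obox a b x -> bumpt a b k x = 0.
Proof.
move=> /existsNP[i /negP xi]; rewrite /bumpt /tensor (bigD1 i)//=.
by rewrite bump_eq0 ?mul0r.
Qed.

Let bumpt_cvg a b x : bumpt a b k x @[k --> \oo] --> (\1_(obox a b) x : R).
Proof.
have [xab|xab] := pselect (obox a b x); last first.
  rewrite indicE memNset//; under eq_fun do rewrite bumpt_eq0//; exact: cvg_cst.
rewrite indicE mem_set//=.
rewrite /bumpt /tensor (_ : 1%:R = \prod_(j < n) (1 : R)); last by rewrite big1.
elim: (index_enum _) => [|j s IH].
  by under eq_fun do rewrite big_nil; rewrite big_nil; exact: cvg_cst.
under eq_fun do rewrite big_cons.
by rewrite big_cons; apply: cvgM => //; exact: bump_cvg.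
Qed.

Let measurable_bumpt a b k : measurable_fun setT (bumpt a b k).
Proof.
apply: continuous_measurable_rV; apply: continuous_tensor => j.
exact: (smooth1_bump (a j) (b j) k 0%N).
Qed.

(** Dominated convergence as the bumps approach the indicator of the box; [|u|] on the closed box is
    an integrable majorant. *)
Let integral_obox a b : (\int[lam]_x (u x * \1_(obox a b) x)%:E)%E = 0%E.
Proof.
pose K := [set y : rV | forall j, a j <= y ord0 j <= b j].
have KoK x : obox a b x -> K x by move=> h j; have /andP[/ltW -> /ltW ->] := h j.
have mK : measurable K.
  by apply: compact_measurable_rV; exact: compact_cbox.
have iK : lam.-integrable setT ((abse \o (EFin \o u)) \_ K).
  apply: (integrable_mkcond _ mK).1; apply: integrable_abse => //.
  by apply: u_loc; exact: compact_cbox.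
have mI : measurable_fun setT (\1_(obox a b) : rV -> R).
  by apply: measurable_indic; exact: measurable_obox.
have bound k x : (`|(u x * bumpt a b k x)%:E| <= ((abse \o (EFin \o u)) \_ K) x)%E.
  rewrite patchE; case: ifPn => [_|/negP xK].
    rewrite /= lee_fin normrM ler_piMr// ger0_norm; by case/andP: (bumpt_ge0_le1 a b k x).
  rewrite bumpt_eq0 ?mulr0 ?abse0// => xab; apply: xK; rewrite inE; exact: KoK.
have cv x : (u x * bumpt a b k x)%:E @[k --> \oo] --> (u x * \1_(obox a b) x)%:E.
  apply: cvg_EFin; first exact: nearW.
  by apply: cvgM; [exact: cvg_cst|exact: bumpt_cvg].
have [_ _] := @dominated_convergence _ _ _ lam setT measurableT
  (fun k x => (u x * bumpt a b k x)%:E) (fun x => (u x * \1_(obox a b) x)%:E)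
  ((abse \o (EFin \o u)) \_ K)
  (fun k => proj2 (measurable_EFinP _ _) (measurable_funM mu (measurable_bumpt a b k)))
  (proj2 (measurable_EFinP _ _) (measurable_funM mu mI))
  (aeW _ (fun x _ => cv x)) iK
  (aeW _ (fun x k _ => bound k x)).
rewrite (_ : [sequence _]_k = cst 0%E).
  by move=> /cvg_lim <- //; rewrite lim_cst.
apply/funext => k /=; have ik : lam.-integrable setT (fun x => (u x * bumpt a b k x)%:E).
  apply: le_integrable iK => //; first exact/measurable_EFinP/measurable_funM.
  by move=> x _; apply: le_trans (bound k x) _; exact: lee_abs.
by rewrite -(fineK (integrable_fin_num measurableT ik)); congr EFin; exact: u_test.
Qed.

(** On a cube, the measures with densities the positive and the negative part of [u] coincide on
    open boxes, a generating pi-system, hence on all Borel sets. So [u] has integral zero over every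
    Borel subset of the cube and vanishes there almost everywhere. *)
Lemma fundamental_lemma : {ae lam, forall x, u x = 0}.
Proof.
suff : forall N : nat, {ae lam, forall x, obox (fun=> - N%:R) (fun=> N%:R) x -> u x = 0}.
  move=> /ae_foralln; apply: filterS => x /= h.
  pose N := (Num.truncn (enorm x)).+1; apply: (h N) => i.
  rewrite -ltr_norml; apply: le_lt_trans (coord_le_enorm x i) _.
  exact: truncnS_gt.
(* The restriction to a bounded cube makes both measures finite, so that their values can be
   subtracted and uniqueness applies. *)
move=> N; pose Q := obox (fun=> - N%:R) (fun=> N%:R) : set rV.
pose v x := u x * \1_Q x.
have mQ : measurable Q by exact: measurable_obox.
have mv : measurable_fun setT v by apply: measurable_funM => //; exact: measurable_indic.
have mEv : measurable_fun setT (EFin \o v) by exact/measurable_EFinP.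
pose K := [set y : rV | forall j, - N%:R <= y ord0 j <= N%:R].
have QK : Q `<=` K by move=> x h j; have /andP[/ltW -> /ltW ->] := h j.
have mK : measurable K.
  by apply: compact_measurable_rV; exact: compact_cbox.
have iv : lam.-integrable setT (EFin \o v).
  have iQ : lam.-integrable setT ((EFin \o u) \_ Q).
    apply: (integrable_mkcond _ mQ).1; apply: (integrableS mK) => //.
    by apply: u_loc; exact: compact_cbox.
  apply: eq_integrable iQ => // x _; rewrite patchE /v/= indicE.
  by case: ifP => _; rewrite ?mulr1 ?mulr0.
pose m1 : {measure set rV -> \bar R} :=
  density lam (measurable_funepos mEv) (funepos_ge0 (EFin \o v)).
pose m2 : {measure set rV -> \bar R} :=
  density lam (measurable_funeneg mEv) (funeneg_ge0 (EFin \o v)).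
have fin1 A : measurable A -> m1 A \is a fin_num.
  move=> mA; apply: integrable_fin_num => //.
  by apply: (integrableS measurableT) => //; exact: integrable_funepos.
have fin2 A : measurable A -> m2 A \is a fin_num.
  move=> mA; apply: integrable_fin_num => //.
  by apply: (integrableS measurableT) => //; exact: integrable_funeneg.
have EA A : measurable A -> (\int[lam]_(x in A) (EFin \o v) x = m1 A - m2 A)%E.
  by move=> mA; rewrite integralE.
have m12 A : measurable A -> m1 A = m2 A.
  move=> mA.
  apply: (@measure_unique _ R rV oboxes (fun k => obox (fun=> - k%:R) (fun=> k%:R))) => //.
  - exact: measurable_oboxes.
  - move=> _ _ [a [b ->]] [c [d ->]]; rewrite obox_setI.
    by eexists; eexists; reflexivity.
  - by move=> k; eexists; eexists; reflexivity.
  - apply/seteqP; split => // x _; exists (Num.truncn (enorm x)).+1 => // i.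
    rewrite -ltr_norml; apply: le_lt_trans (coord_le_enorm x i) _; exact: truncnS_gt.
  - move=> _ [a [b ->]]; have mab := @measurable_obox R n a b.
    suff : (m1 (obox a b) - m2 (obox a b) = 0)%E.
      rewrite -(fineK (fin1 _ mab)) -(fineK (fin2 _ mab)) -EFinB => -[] /eqP.
      by rewrite subr_eq0 => /eqP ->.
    rewrite -EA// integral_mkcond.
    (* The intersection of the box with the cube is again an open box. *)
    rewrite -(integral_obox (fun i => Num.max (a i) (- N%:R)) (fun i => Num.min (b i) N%:R)).
    apply: eq_integral => x _; rewrite patchE /= /v -obox_setI indicI /Q.
    by rewrite /= [(\1_(obox a b) : _ -> R) x]indicE; case: ifP => _; rewrite ?mul1r ?mul0r ?mulr0.
  - by move=> k; rewrite -ge0_fin_numE ?fin1//; exact: measurable_obox.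
have := @integral_ae_eq _ _ _ lam setT measurableT (cst 0%E) (EFin \o v) iv (measurable_cst _).
move=> /(_ _)/wrap[].
  by move=> E _ mE; rewrite integral0 EA// m12// subee// fin2.
apply: filterS => x /= + Qx; move=> /(_ I) [].
by rewrite /v indicE mem_set// mulr1.
Qed.

End fundamental_lemma.

(** * Test fields and integration by parts *)

Section test_field_theory.
Context {R : realType} {n : nat}.
Notation rV := ('rV[R]_n).
Notation lam := (@lebesgue_rV R n).
Implicit Types phi : rV -> rV.

(** A bound on the coordinates of the points where [phi] is nonzero is easier to carry through
    shifts and derivatives than compactness of the closed support. *)
Lemma test_fieldP phi : test_field phi <->
  smooth phi /\ exists c : R, forall x, phi x != 0 -> forall i, `|x ord0 i| <= c.
Proof.
split=> [[sp cp]|[sp [c hc]]]; split => //.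
  have [M [_ MA]] := compact_bounded cp.
  exists (M + 1) => x px i.
  have := MA (M + 1); rewrite ltrDl => /(_ ltr01 x).
  move=> /(_ _)/wrap[]; first exact: subset_closure.
  apply: le_trans; rewrite [leRHS]mx_normrE.
  exact: (le_bigmax _ _ (ord0, i)).
have cb : compact [set y : rV | forall j, - c <= y ord0 j <= c].
  by apply: compact_cbox.
apply: (subclosed_compact (@closed_closure _ _) cb).
rewrite [X in _ `<=` X](closure_id _).1; last first.
  by apply: compact_closed => //; exact: norm_hausdorff.
by apply: closure_subset => y /= /hc h j; rewrite -ler_norml.
Qed.

Lemma test_field_shift phi v : test_field phi -> test_field (fun x => phi (x + v)).
Proof.
move=> /test_fieldP[sp [c hc]]; apply/test_fieldP; split; last first.
  exists (c + enorm v) => x /hc h i; have := h i; rewrite mxE => {}h.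
  rewrite -[x ord0 i](addrK (v ord0 i)).
  by apply: le_trans (ler_normB _ _) _; rewrite lerD// coord_le_enorm.
have E s : iter_pderiv s (fun x => phi (x + v)) = (fun x => iter_pderiv s phi (x + v)).
  elim: s => [//|i s IH]; rewrite [LHS]/= -/(iter_pderiv s _) IH.
  by apply/funext => x; rewrite derive_shift.
move=> s; rewrite E; have [cs ds] := sp s; split; last first.
  by move=> i x; apply: derivable_shift; exact: ds.
move=> x; apply: (@continuous_comp rV rV rV (fun y => y + v) (iter_pderiv s phi)).
  by apply: (@continuousD R rV rV (fun y => y) (fun=> v) x); [exact: cvg_id|exact: cst_continuous].
exact: cs.
Qed.

Lemma test_field_derive phi i : test_field phi -> test_field ('D_(delta_mx ord0 i) phi).
Proof.
move=> /test_fieldP[sp [c hc]]; apply/test_fieldP; split.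
  move=> s; have := sp (rcons s i).
  rewrite (_ : iter_pderiv (rcons s i) phi = iter_pderiv s ('D_(delta_mx ord0 i) phi))//.
  by rewrite /iter_pderiv foldr_rcons.
exists c => x dx j; rewrite leNgt; apply/negP => cx; move/eqP: dx; apply.
(* Beyond the bound [c] in some coordinate the field vanishes on a whole neighbourhood, so its
   derivatives vanish too. *)
have near0 : \near x, phi x = cst 0 x.
  have h : (fun y : rV => `|y ord0 j|) @ x --> `|x ord0 j|.
    apply: (@continuous_comp rV R R (fun y => y ord0 j) (fun t => `|t|) x).
      exact: coord_continuous.
    exact: norm_continuous.
  near=> y; have cy : c < `|y ord0 j| by near: y; exact: (cvgr_gt _ h _ cx).
  by apply/eqP; apply: contraTT cy => /hc/(_ j); rewrite leNgt.
by rewrite (near_eq_derive _ near0) derive_cst.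
Unshelve. all: by end_near. Qed.

Lemma test_field_continuous phi : test_field phi -> continuous phi.
Proof. by move=> [sp _]; exact: (sp [::]).1. Qed.

Lemma test_field_coord_continuous phi i : test_field phi ->
  continuous (fun x => phi x ord0 i).
Proof.
move=> tp x; apply: (@continuous_comp rV rV R phi (fun y => y ord0 i)).
  exact: test_field_continuous.
exact: coord_continuous.
Qed.

Lemma test_field_measurable phi : test_field phi -> measurable_fun setT phi.
Proof.
move=> tp; apply: measurable_fun_rV => i.
by apply: continuous_measurable_rV; exact: test_field_coord_continuous.
Qed.

Lemma test_field_bounded phi : test_field phi ->
  exists2 M : R, 0 <= M & forall x, enorm (phi x) <= M.
Proof.
move=> tp; have /test_fieldP[sp [c hc]] := tp.
have cb : compact [set y : rV | forall j, - c <= y ord0 j <= c] by apply: compact_cbox.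
have cN : continuous (fun x => \sum_i `|phi x ord0 i|).
  elim: (index_enum _) => [|i s IH].
    by under eq_fun do rewrite big_nil; exact: cst_continuous.
  under eq_fun do rewrite big_cons.
  move=> x; apply: (@continuousD R R rV); last exact: IH.
  apply: (@continuous_comp rV R R (fun y => phi y ord0 i) (fun t => `|t|) x).
    exact: test_field_coord_continuous.
  exact: norm_continuous.
have cN' : {within [set y : rV | forall j, - c <= y ord0 j <= c],
  continuous (fun x => \sum_i `|phi x ord0 i|)} by exact: continuous_subspaceT.
have [M [_ MA]] := compact_bounded (continuous_compact cN' cb).
exists (`|M| + 1); first by rewrite addr_ge0.
move=> x; have [->|px] := eqVneq (phi x) 0; first by rewrite enorm0 addr_ge0.
apply: le_trans (enorm_le_sum _) _.
have S0 : 0 <= \sum_i `|phi x ord0 i| by exact: sumr_ge0.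
rewrite -(ger0_norm S0); apply: MA; first by rewrite ltr_pwDr// ler_norm.
exists x => //= j; rewrite -ler_norml; exact: hc.
Qed.

End test_field_theory.

Lemma Rintegral_dominated d (T : measurableType d) (R : realType)
    (m : {measure set T -> \bar R}) (f_ : nat -> T -> R) (f g : T -> R) :
  (forall k, measurable_fun setT (f_ k)) -> measurable_fun setT f ->
  {ae m, forall x, f_ k x @[k --> \oo] --> f x} ->
  m.-integrable setT (EFin \o g) -> {ae m, forall x, forall k, `|f_ k x| <= g x} ->
  m.-integrable setT (EFin \o f) /\ \int[m]_x f_ k x @[k --> \oo] --> \int[m]_x f x.
Proof.
move=> mf_ mf ff ig fg.
have mEf k : measurable_fun setT (EFin \o f_ k) by exact/measurable_EFinP.
have ffE : {ae m, forall x, setT x -> (f_ k x)%:E @[k --> \oo] --> (f x)%:E}.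
  by apply: filterS ff => x h _; apply: cvg_EFin => //; exact: nearW.
have [i1 _ i3] := @dominated_convergence _ _ _ m setT measurableT
  (fun k => EFin \o f_ k) (EFin \o f) (EFin \o g) mEf (proj2 (measurable_EFinP _ _) mf) ffE ig
  (filterS (fun x h k _ => h k) fg).
split => //.
have fin : (\int[m]_x (EFin \o f) x)%E \is a fin_num by exact: integrable_fin_num.
exact: (fine_cvg (eq_ind _ (fun l => _ --> l) i3 _ (esym (fineK fin)))).
Qed.

(** * Integration by parts through difference quotients *)

Section bounded_support.
Context {R : realType} {n : nat}.
Notation rV := ('rV[R]_n).
Notation lam := (@lebesgue_rV R n).
Implicit Types v : rV -> R.

Definition bsupp v (c : R) := forall x, v x != 0 -> forall i, `|x ord0 i| <= c.

Let cube (c : R) : set rV := [set x | forall i, `|x ord0 i| <= c].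

Let measurable_cube c : measurable (cube c).
Proof.
rewrite (_ : cube c = [set y | forall j, - c <= y ord0 j <= c]).
  by apply: compact_measurable_rV; apply: compact_cbox.
by apply/seteqP; split=> x h i; have := h i; rewrite ler_norml.
Qed.

Lemma integrable_cube c (M : R) : lam.-integrable setT (fun x => (M * \1_(cube c) x)%:E).
Proof.
apply/integrable_EFinP; split.
  by apply: measurable_funM => //; exact: measurable_indic.
under eq_integral => x _ do rewrite normrM [`|\1__ x|]ger0_norm// EFinM.
rewrite ge0_integralZl_EFin//.
- rewrite integral_indic// setIT lte_mul_pinfty//.
  exact: lebesgue_rV_bounded_box.
- by apply/measurable_EFinP; exact: measurable_indic.
Qed.

Lemma bsupp_le v c (M : R) : (forall x, `|v x| <= M) -> bsupp v c ->
  forall x, `|v x| <= M * \1_(cube c) x.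
Proof.
move=> vM vc x; have [v0|v0] := eqVneq (v x) 0; last first.
  by rewrite indicE mem_set ?mulr1//; exact: vc.
by rewrite v0 normr0 mulr_ge0//; apply: le_trans (vM x).
Qed.

Lemma integrable_bsupp v c (M : R) : measurable_fun setT v ->
  (forall x, `|v x| <= M) -> bsupp v c -> lam.-integrable setT (EFin \o v).
Proof.
move=> mv vM vc; apply: le_integrable (integrable_cube c M) => //.
  exact/measurable_EFinP.
move=> x _; rewrite /= lee_fin; apply: le_trans (bsupp_le vM vc x) _.
exact: ler_norm.
Qed.

Lemma Lp_bsupp v c (M p : R) : 0 < p -> measurable_fun setT v ->
  (forall x, `|v x| <= M) -> bsupp v c -> Lp p v.
Proof.
move=> p0 mv vM vc; apply/LpP => //; split => //.
have mav : measurable_fun setT (fun x => `|v x|) by exact: measurableT_comp.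
have h := @integrable_bsupp (fun x => `|v x| `^ p) c (M `^ p) (measurable_powR_comp _ mav).
have /integrable_EFinP[_] : lam.-integrable setT (EFin \o (fun x => `|v x| `^ p)).
  apply: h => //.
  - move=> x; rewrite ger0_norm ?powR_ge0//; apply: ge0_ler_powR => //; first exact: ltW.
    by rewrite nnegrE; apply: le_trans (vM x).
  - move=> x; rewrite powR_eq0 negb_and negbK normr_eq0 => /orP[/vc//|].
    by move=> /eqP p00; rewrite p00 ltxx in p0.
by under eq_integral => x _ do rewrite ger0_norm ?powR_ge0//.
Qed.

Definition diffquot (f : rV -> R) (e : rV) (t : R) (x : rV) := t^-1 * (f (x + t *: e) - f x).

Lemma measurable_diffquot f e t : measurable_fun setT f -> measurable_fun setT (diffquot f e t).
Proof.
move=> mf; apply: measurable_funM => //; apply: measurable_funB => //.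
by apply: measurableT_comp => //; exact: measurable_fun_rVD.
Qed.

(* Translation invariance moves the difference quotient to the other factor. *)
Lemma Rintegral_diffquot (m v : rV -> R) (C M c t : R) (e : rV) :
  measurable_fun setT m -> measurable_fun setT v -> (forall x, `|m x| <= C) ->
  (forall x, `|v x| <= M) -> bsupp v c ->
  \int[lam]_x (m x * diffquot v e t x) = - \int[lam]_x (diffquot m e (- t) x * v x).
Proof.
move=> mm mv mC vM vc.
have C0 : 0 <= C by apply: le_trans (mC 0).
have M0 : 0 <= M by apply: le_trans (vM 0).
have mms (w : rV) (f : rV -> R) : measurable_fun setT f -> measurable_fun setT (fun x : rV => f (x + w)).
  by move=> mf; apply: measurableT_comp => //; exact: measurable_fun_rVD.
have bnd (a b : R) : `|a| <= C -> `|b| <= M -> `|a * b| <= C * M.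
  by move=> h1 h2; rewrite normrM ler_pM.
have i0 : lam.-integrable setT (EFin \o (fun x => m x * v x)).
  apply: (@integrable_bsupp _ c (C * M)) => //; first exact: measurable_funM.
    by move=> x; exact: bnd.
  by move=> x; rewrite mulf_eq0 negb_or => /andP[_ /vc].
have im : lam.-integrable setT (EFin \o (fun x => m (x - t *: e) * v x)).
  apply: (@integrable_bsupp _ c (C * M)) => //; first by apply: measurable_funM => //; exact: mms.
    by move=> x; exact: bnd.
  by move=> x; rewrite mulf_eq0 negb_or => /andP[_ /vc].
have iv : lam.-integrable setT (EFin \o (fun x => m x * v (x + t *: e))).
  apply: (@integrable_bsupp _ (c + `|t| * enorm e) (C * M)) => //.
  - by apply: measurable_funM => //; exact: mms.
  - by move=> x; exact: bnd.
  - move=> x; rewrite mulf_eq0 negb_or => /andP[_ /vc h i].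
    rewrite -[x ord0 i](addrK ((t *: e) ord0 i)).
    apply: le_trans (ler_normB _ _) _; apply: lerD.
      by have := h i; rewrite mxE.
    by rewrite -enormZ coord_le_enorm.
rewrite /diffquot.
transitivity (t^-1 * (\int[lam]_x (m x * v (x + t *: e)) - \int[lam]_x (m x * v x))).
  rewrite -RintegralB// -RintegralZl_measurable; last first.
    by apply: measurable_funB; apply: measurable_funM => //; exact: mms.
  by apply: eq_Rintegral => x _; ring.
have <- : \int[lam]_x (m (x - t *: e) * v x) = \int[lam]_x (m x * v (x + t *: e)).
  rewrite -(@Rintegral_rV_shift R n (t *: e) (fun x => m (x - t *: e) * v x)).
    by apply: eq_Rintegral => x _; rewrite addrK.
  by apply: measurable_funM => //; exact: mms.
rewrite -[RHS]RintegralN_measurable; last first.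
  apply: measurable_funM => //; apply: measurable_funM => //; apply: measurable_funB => //.
  exact: mms.
rewrite -RintegralB// -RintegralZl_measurable; last first.
  by apply: measurable_funB; apply: measurable_funM => //; exact: mms.
by apply: eq_Rintegral => x _; rewrite scaleNr invrN; ring.
Qed.

(** The identity holds exactly for difference quotients, by translation invariance. Lipschitz bounds
    in the direction [e] dominate the quotients on both sides, so the limit can be taken even though
    [m] is differentiable only almost everywhere. *)
Lemma Rintegral_by_parts (m dm v dv : rV -> R) (C K M c : R) (e : rV) :
  measurable_fun setT m -> measurable_fun setT dm ->
  measurable_fun setT v -> measurable_fun setT dv ->
  (forall x, `|m x| <= C) -> (forall x t, `|m (x + t *: e) - m x| <= K * `|t|) ->
  {ae lam, forall x, diffquot m e t x @[t --> 0^'] --> dm x} ->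
  (forall x, `|v x| <= M) -> (forall x t, `|v (x + t *: e) - v x| <= M * `|t|) ->
  (forall x, diffquot v e t x @[t --> 0^'] --> dv x) -> bsupp v c ->
  \int[lam]_x (m x * dv x) = - \int[lam]_x (dm x * v x).
Proof.
move=> mm mdm mv mdv mC mK dmE vM vL dvE vc.
have C0 : 0 <= C by apply: le_trans (mC 0).
have M0 : 0 <= M by apply: le_trans (vM 0).
pose t (k : nat) : R := k.+1%:R^-1.
have t0 k : 0 < t k by rewrite invr_gt0.
have tcvg : t k @[k --> \oo] --> (0 : R)^'.
  have h : t k @[k --> \oo] --> (0 : R) by exact: cvg_harmonic.
  move=> P /= /h; rewrite !near_simpl => hP.
  by apply: filterS hP => k; apply; rewrite gt_eqF.
(* The quotient transferred to [m] has the opposite step. *)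
have tNcvg : - t k @[k --> \oo] --> (0 : R)^'.
  have h : - t k @[k --> \oo] --> (0 : R).
    by rewrite -oppr0; apply: cvgN; exact: cvg_harmonic.
  move=> P /= /h; rewrite !near_simpl => hP.
  by apply: filterS hP => k; apply; rewrite oppr_eq0 gt_eqF.
have dq_le f L s x : s != 0 -> (forall x t, `|f (x + t *: e) - f x| <= L * `|t|) ->
    `|diffquot f e s x| <= L.
  move=> s0 fL; rewrite /diffquot normrM normfV ler_pdivrMl ?normr_gt0// mulrC.
  exact: fL.
have dq_cvg (w dw : rV -> R) (s : nat -> R) x : s k @[k --> \oo] --> (0 : R)^' ->
    diffquot w e u x @[u --> 0^'] --> dw x -> diffquot w e (s k) x @[k --> \oo] --> dw x.
  by move=> h; apply: (cvg_comp _ _ h).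
have te k i : `|(t k *: e) ord0 i| <= enorm e.
  apply: le_trans (coord_le_enorm _ _) _; rewrite enormZ ger0_norm ?(ltW (t0 k))//.
  by rewrite ler_piMl ?enorm_ge0// invf_le1 ?ler1n ?ltr0n.
have mdq k : measurable_fun setT (fun x => m x * diffquot v e (t k) x).
  by apply: measurable_funM => //; exact: measurable_diffquot.
have [_ hA] : lam.-integrable setT (EFin \o (fun x => m x * dv x)) /\
    \int[lam]_x (m x * diffquot v e (t k) x) @[k --> \oo] --> \int[lam]_x (m x * dv x).
  (* The steps are at most [1], so the shifted supports of [v] stay in the cube enlarged by
     [enorm e]. *)
  apply: (Rintegral_dominated mdq _ _ (integrable_cube (c + enorm e) (C * M))).
  - exact: measurable_funM.
  - by apply: aeW => x; apply: cvgM; [exact: cvg_cst|exact: dq_cvg].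
  - apply: aeW => y k; move: y; apply: bsupp_le => x.
      by rewrite normrM ler_pM// dq_le// gt_eqF.
    rewrite mulf_eq0 negb_or /diffquot mulf_eq0 negb_or => /and3P[_ _ h] i.
    have [v0|/vc/(_ i) hi] := eqVneq (v x) 0; last by rewrite (le_trans hi)// lerDl enorm_ge0.
    move: h; rewrite v0 subr0 => /vc/(_ i); rewrite mxE => hi.
    rewrite -[x ord0 i](addrK ((t k *: e) ord0 i)).
    by apply: le_trans (ler_normB _ _) _; rewrite lerD.
have mdq' k : measurable_fun setT (fun x => diffquot m e (- t k) x * v x).
  by apply: measurable_funM => //; exact: measurable_diffquot.
have [_ hB] : lam.-integrable setT (EFin \o (fun x => dm x * v x)) /\
    \int[lam]_x (diffquot m e (- t k) x * v x) @[k --> \oo] --> \int[lam]_x (dm x * v x).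
  apply: (Rintegral_dominated mdq' _ _ (integrable_cube c (K * M))).
  - exact: measurable_funM.
  - by apply: filterS dmE => x dmx; apply: cvgM; [exact: dq_cvg|exact: cvg_cst].
  - apply: aeW => y k; move: y; apply: bsupp_le => x.
      by rewrite normrM ler_pM// dq_le// oppr_eq0 gt_eqF.
    by rewrite mulf_eq0 negb_or => /andP[_ /vc].
apply: (@cvg_unique _ (@norm_hausdorff _ R^o) _ _ _ _ hA); apply: cvg_trans (cvgN hB).
apply: near_eq_cvg; apply: nearW => k /=.
by rewrite (Rintegral_diffquot (t k) e mm mv mC vM vc).
Qed.

End bounded_support.

(** * Lipschitz bounds and divergence of test fields *)

Section test_field_quotients.
Context {R : realType} {n : nat}.
Notation rV := ('rV[R]_n).
Notation lam := (@lebesgue_rV R n).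
Implicit Types phi : rV -> rV.

Lemma test_field_is_derive phi i j x : test_field phi ->
  is_derive x (delta_mx ord0 i : rV) (fun y => phi y ord0 j)
    ('D_(delta_mx ord0 i) phi x ord0 j).
Proof.
move=> [sp _]; have [_ /(_ i x) d] := sp [::].
apply: is_derive_cvg.
have h := cvg_is_derive (DeriveDef d erefl).
have := cvg_comp _ (fun y : rV => y ord0 j) h (coord_continuous (i := ord0) (j := j) (x := 'D_(delta_mx ord0 i) phi x)).
by apply: cvg_trans; apply: near_eq_cvg; apply: nearW => t /=; rewrite !mxE.
Qed.

Lemma test_field_diffquot phi i j x : test_field phi ->
  diffquot (fun y => phi y ord0 j) (delta_mx ord0 i) t x @[t --> 0^'] -->
  'D_(delta_mx ord0 i) phi x ord0 j.
Proof.
move=> tp; have := cvg_is_derive (test_field_is_derive i j x tp).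
apply: cvg_trans; apply: near_eq_cvg; apply: nearW => t /=.
by rewrite /diffquot (addrC x).
Qed.

Lemma test_field_derive_bounded phi : test_field phi ->
  exists2 M : R, 0 <= M & forall i x, enorm ('D_(delta_mx ord0 i) phi x) <= M.
Proof.
move=> tp.
have hM : forall i, exists M : R, 0 <= M /\ forall x, enorm ('D_(delta_mx ord0 i) phi x) <= M.
  by move=> i; have [M M0 h] := test_field_bounded (test_field_derive i tp); exists M.
have [M hM'] := choice hM; exists (\sum_i M i); first by apply: sumr_ge0 => i _; exact: (hM' i).1.
move=> i x; apply: le_trans ((hM' i).2 x) _; rewrite (bigD1 i)//= lerDl.
by apply: sumr_ge0 => j _; exact: (hM' j).1.
Qed.

Lemma line_is_derive (f : rV -> R) (e x : rV) t (d : R) :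
  is_derive (x + t *: e) e f d -> is_derive t (1 : R) (fun s => f (x + s *: e)) d.
Proof.
move=> h; apply: is_derive_cvg; have := cvg_is_derive h.
apply: cvg_trans; apply: near_eq_cvg; apply: nearW => s /=.
by rewrite scalerDl [_%:A]mulr1 addrCA.
Qed.

Lemma diff_le_derive (f df : R -> R) (M a b : R) :
  (forall x, is_derive x (1 : R) f (df x)) -> (forall x, `|df x| <= M) ->
  `|f b - f a| <= M * `|b - a|.
Proof.
move=> dF hM; wlog ab : a b / a <= b.
  move=> H; have [/H//|/ltW/H] := leP a b.
  by rewrite (distrC (f a)) (distrC a).
have cf : {within `[a, b], continuous f}.
  apply: continuous_subspaceT => x; apply: differentiable_continuous.
  by apply/derivable1_diffP; case: (dF x).
have [c _ ->] := MVT_segment ab (fun x _ => dF x) cf.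
by rewrite normrM ler_wpM2r.
Qed.

Lemma test_field_line_lipschitz phi (M : R) i j x t : test_field phi ->
  (forall i x, enorm ('D_(delta_mx ord0 i) phi x) <= M) ->
  `|phi (x + t *: delta_mx ord0 i) ord0 j - phi x ord0 j| <= M * `|t|.
Proof.
move=> tp hM; pose f s := phi (x + s *: delta_mx ord0 i) ord0 j.
have dF s : is_derive s (1 : R) f ('D_(delta_mx ord0 i) phi (x + s *: delta_mx ord0 i) ord0 j).
  exact: (@line_is_derive (fun y => phi y ord0 j)) (test_field_is_derive i j _ tp).
have := @diff_le_derive f _ M 0 t dF.
rewrite /f scale0r addr0 subr0; apply => s.
by apply: le_trans (coord_le_enorm _ _) _.
Qed.

(** The increment [h] is added one coordinate at a time, each addition being controlled by the mean
    value theorem. The resulting constant is crude, but it only serves to dominate integrands. *)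
Lemma test_field_lipschitz phi : test_field phi ->
  exists2 L : R, 0 <= L & forall x h, enorm (phi (x + h) - phi x) <= L * enorm h.
Proof.
move=> tp; have [M M0 hM] := test_field_derive_bounded tp.
have coordL j x h : `|phi (x + h) ord0 j - phi x ord0 j| <= M * (n%:R * enorm h).
  rewrite [in leLHS](row_sum_delta h).
  have : `|phi (x + \sum_i h ord0 i *: delta_mx ord0 i) ord0 j - phi x ord0 j|
      <= M * \sum_(i < n) `|h ord0 i|.
    elim: (index_enum _) => [|i s IH]; first by rewrite !big_nil addr0 subrr normr0 mulr0.
    rewrite !big_cons addrCA addrA [in X in phi X _ _]addrC [X in phi (_ + X)]addrC.
    rewrite -(subrK (phi (x + \sum_(i <- s) h ord0 i *: delta_mx ord0 i) ord0 j) (phi _ _ _)).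
    rewrite -addrA; apply: le_trans (ler_normD _ _) _; rewrite mulrDr; apply: lerD => //.
    by rewrite addrA (addrC _ x); exact: test_field_line_lipschitz.
  move=> /le_trans; apply; rewrite ler_wpM2l//.
  have -> : n%:R * enorm h = \sum_(i < n) enorm h.
    by rewrite sumr_const card_ord mulr_natl.
  by apply: ler_sum => i _; exact: coord_le_enorm.
exists (n%:R * (M * n%:R)); first by rewrite !mulr_ge0.
move=> x h; apply: le_trans (enorm_le_sum _) _.
have -> : n%:R * (M * n%:R) * enorm h = \sum_(i < n) (M * (n%:R * enorm h)).
  by rewrite sumr_const card_ord -mulr_natl; ring.
by apply: ler_sum => j _; rewrite !mxE.
Qed.

Lemma test_field_bsupp phi j : test_field phi ->
  exists c : R, bsupp (fun x => phi x ord0 j) c.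
Proof.
move=> /test_fieldP[_ [c hc]]; exists c => x h; apply: hc.
by apply: contraNneq h => ->; rewrite mxE.
Qed.

Lemma test_field_Lp phi j (p : R) : 0 < p -> test_field phi -> Lp p (fun x => phi x ord0 j).
Proof.
move=> p0 tp; have [M _ hM] := test_field_bounded tp.
have [c hc] := test_field_bsupp j tp.
apply: (@Lp_bsupp _ _ _ c M) => //.
  by apply: continuous_measurable_rV; exact: test_field_coord_continuous.
by move=> x; apply: le_trans (coord_le_enorm _ _) _.
Qed.

Lemma measurable_divergence phi : test_field phi -> measurable_fun setT (divergence phi).
Proof.
move=> tp; apply: measurable_sum => i.
by apply: continuous_measurable_rV; exact/test_field_coord_continuous/test_field_derive.
Qed.

Lemma divergence_bounded phi : test_field phi ->
  exists2 M : R, 0 <= M & forall x, `|divergence phi x| <= M.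
Proof.
move=> tp; have [M M0 hM] := test_field_derive_bounded tp.
exists (n%:R * M); first by rewrite mulr_ge0.
move=> x; rewrite mulr_natl -[in leRHS](card_ord n) -sumr_const.
apply: le_trans (ler_norm_sum _ _ _) _; apply: ler_sum => i _.
by apply: le_trans (coord_le_enorm _ _) _.
Qed.

Lemma divergence_bsupp phi : test_field phi -> exists c : R, bsupp (divergence phi) c.
Proof.
move=> tp.
have : forall i, exists c : R, 0 <= c /\ bsupp (fun x => 'D_(delta_mx ord0 i) phi x ord0 i) c.
  move=> i; have [c hc] := test_field_bsupp i (test_field_derive i tp).
  exists `|c|; split => // x h j; apply: le_trans (hc x h j) _; exact: ler_norm.
move=> /choice[c hc]; exists (\sum_i c i) => x; apply: contraNP => /existsNP[j /negP].
rewrite -ltNge => hj; apply/eqP; apply: big1 => i _; apply/eqP; apply: contraTT hj => h.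
rewrite -leNgt; apply: le_trans ((hc i).2 x h j) _; rewrite (bigD1 i)//= lerDl.
by apply: sumr_ge0 => k _; exact: (hc k).1.
Qed.

Lemma divergence_Lp phi (p : R) : 0 < p -> test_field phi -> Lp p (divergence phi).
Proof.
move=> p0 tp; have [M _ hM] := divergence_bounded tp.
have [c hc] := divergence_bsupp tp.
by apply: (@Lp_bsupp _ _ _ c M) => //; exact: measurable_divergence.
Qed.

Lemma divergence_shift phi v x : divergence (fun y => phi (y + v)) x = divergence phi (x + v).
Proof. by apply: eq_bigr => i _; rewrite derive_shift. Qed.

End test_field_quotients.

(** * The capped kernel max(|h|, s)^-a *)

Section capped_kernel.
Context {R : realType} {n : nat}.
Notation rV := ('rV[R]_n).
Notation lam := (@lebesgue_rV R n).
Variables (a : R) (n0 : (0 < n)%N) (a0 : 0 < a).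
Implicit Types (h : rV) (s r : R).

(** Through the radial integration formula the sphere becomes a subset of the single point [s^n] of
    the half-line. *)
Lemma esphere_negligible s : {ae lam, forall h, enorm h != s}.
Proof.
have mS : measurable [set h : rV | enorm h = s].
  rewrite -[X in measurable X]setTI (_ : [set h : rV | _] = @enorm R n @^-1` [set s]) //.
  by apply: measurable_enorm => //; exact: measurable_set1.
exists [set h : rV | enorm h = s]; split => //; last first.
  by move=> h /=; rewrite -[_ != _]/(~~ _) => /negP; rewrite negbK => /eqP.
apply/eqP; rewrite eq_le measure_ge0 andbT.
rewrite -[X in lam X]setIT -integral_indic//.
pose F (t : R) : \bar R := (\1_[set s ^+ n] t)%:E.
have mF : measurable_fun setT F by apply/measurable_EFinP; exact: measurable_indic.
have := @ge0_integral_radial R n F n0 mF (fun t => ltac:(by rewrite lee_fin)).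
have -> : (\int[lebesgue_measure]_(t in `[0%R, +oo[) F t = 0)%E.
  rewrite integral_indic//= ; apply/eqP; rewrite eq_le measure_ge0 andbT.
  apply: le_trans (le_measure _ _ _ (@subIsetl _ _ _)) _; rewrite ?inE//.
  - by apply: measurableI => //; exact: measurable_set1.
  - by have := @lebesgue_measure_set1 R (s ^+ n) => E; rewrite le_eqVlt; apply/orP; left; apply/eqP; exact: E.
rewrite mule0 => <-; apply: ge0_le_integral => //.
- by apply/measurable_EFinP; exact: measurable_indic.
- apply: measurableT_comp => //; apply: measurable_funX; exact: measurable_enorm.
- move=> h _; rewrite lee_fin !indicE ler_nat; case: (boolP (h \in _)) => //.
  by rewrite inE /= => <-; rewrite mem_set.
Qed.

Definition kcap s h : R := ((Num.max (enorm h) s) `^ a)^-1.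

Lemma kcap_ge0 s h : 0 <= kcap s h.
Proof. by rewrite invr_ge0 powR_ge0. Qed.

Lemma measurable_kcap s : measurable_fun setT (kcap s).
Proof.
rewrite /kcap; under eq_fun do rewrite -powRN.
apply: measurable_powR_comp; apply: measurable_maxr => //; exact: measurable_enorm.
Qed.

Lemma kcap_le s h : 0 < s -> kcap s h <= (s `^ a)^-1.
Proof.
move=> s0; rewrite /kcap lef_pV2 ?posrE ?powR_gt0 ?lt_max ?s0 ?orbT//.
by apply: ge0_ler_powR; rewrite ?nnegrE ?le_max ?lexx ?orbT ?(ltW a0) ?(ltW s0)// enorm_ge0.
Qed.

Lemma kcap_le_kpow s h : 0 < s -> h != 0 -> kcap s h <= kpow a h.
Proof.
move=> s0 h0; rewrite /kcap /kpow lef_pV2 ?posrE ?powR_gt0 ?lt_max ?s0 ?orbT ?enorm_gt0//.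
by apply: ge0_ler_powR; rewrite ?nnegrE ?le_max ?lexx ?(ltW a0) ?enorm_ge0.
Qed.

Lemma kcap_off s h : s <= enorm h -> kcap s h = kpow a h.
Proof. by move=> sh; rewrite /kcap (max_idPl sh). Qed.

Lemma kcap_near s h : enorm h <= s -> kcap s h = (s `^ a)^-1.
Proof. by move=> sh; rewrite /kcap (max_idPr sh). Qed.

Lemma invpowR_lipschitz s u w : 0 < s -> s <= u -> s <= w ->
  `|(u `^ a)^-1 - (w `^ a)^-1| <= a * s `^ (- a - 1) * `|u - w|.
Proof.
move=> s0; wlog wu : u w / w <= u.
  move=> H su sw; have [/H|/ltW/H] := leP w u; first exact.
  by rewrite distrC (distrC w); apply.
move=> su sw; rewrite -!powRN.
have dF (x : R) : 0 < x -> is_derive x (1 : R) (fun t : R => t `^ (- a)) (- a * x `^ (- a - 1)).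
  by move=> x0; exact: is_derive1_powR.
have [||c] := @MVT_segment R (fun t : R => t `^ (- a)) (fun x => - a * x `^ (- a - 1)) w u wu.
- by move=> x; rewrite in_itv/= => /andP[wx _]; apply: dF; rewrite (lt_trans _ wx)// (lt_le_trans s0).
- apply: continuous_in_subspaceT => x; rewrite inE/= in_itv/= => /andP[wx _].
  by apply: continuous_powR_gt0; rewrite (lt_le_trans s0)// (le_trans sw).
rewrite in_itv/= => /andP[wc _] ->.
have sc : s <= c by exact: le_trans wc.
have c0 : 0 < c by exact: lt_le_trans sc.
rewrite normrM ler_wpM2r// normrM normrN (ger0_norm (ltW a0)) ler_wpM2l ?(ltW a0)//.
rewrite ger0_norm ?powR_ge0// -opprD !powRN lef_pV2 ?posrE ?powR_gt0//.
by apply: ge0_ler_powR; rewrite ?nnegrE ?(ltW s0) ?(ltW c0)// addr_ge0 ?(ltW a0).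
Qed.

Lemma kcap_lipschitz s h w : 0 < s -> `|kcap s (h + w) - kcap s h| <= a * s `^ (- a - 1) * enorm w.
Proof.
move=> s0; apply: le_trans (invpowR_lipschitz s0 _ _) _; rewrite ?le_max ?lexx ?orbT//.
rewrite ler_wpM2l ?mulr_ge0 ?powR_ge0 ?(ltW a0)//.
have maxL (u v : R) : `|Num.max u s - Num.max v s| <= `|u - v|.
  wlog uv : u v / v <= u.
    move=> H; have [/H//|/ltW/H] := leP v u.
    by rewrite distrC (distrC v).
  rewrite [leRHS]ger0_norm ?subr_ge0// ler_norml.
  by have [us|su] := leP u s; have [vs|sv] := leP v s; apply/andP; split; lra.
apply: le_trans (maxL _ _) _; apply: le_trans (ler_enormB _ _) _.
by rewrite addrAC subrr add0r.
Qed.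

(** Inside the sphere the kernel is locally constant. Outside, it is the power [-a/2] of the squared
    norm, which is a quadratic polynomial [Q] along a coordinate line, so the norm itself is never
    differentiated. *)
Lemma kcap_diffquot s h i : 0 < s -> enorm h != s ->
  diffquot (kcap s) (delta_mx ord0 i) t h @[t --> 0^'] -->
  - a * (h ord0 i * kpow (a + 2) h * off_ball s h).
Proof.
move=> s0; set e : rV := delta_mx ord0 i.
have ct : enorm (h + t *: e) @[t --> (0 : R)] --> enorm h.
  apply/cvgrPdist_le => eps eps0; near=> t; rewrite distrC.
  apply: le_trans (ler_enormB _ _) _; rewrite addrC addKr enormZ enorm_delta mulr1.
  by near: t; apply: (cvgr0_norm_le _ cvg_id).
have ct' : enorm (h + t *: e) @[t --> 0^'] --> enorm h.
  by apply: cvg_trans ct; exact: cvg_fmap2 (@nbhs_dnbhs _ _).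
rewrite neq_lt off_ballE => /orP[hs|sh].
  rewrite [s <= _]leNgt hs mulr0 mulr0; apply: (@cvg_trans _ (0 @[t --> (0 : R)^'])).
    apply: near_eq_cvg; near=> t.
    have hts : enorm (h + t *: e) < s by near: t; apply: (cvgr_lt _ ct').
    by rewrite /diffquot !kcap_near ?(ltW hs) ?(ltW hts)// subrr mulr0.
  exact: cvg_cst.
rewrite (ltW sh) mulr1.
have h0 : 0 < enorm h by exact: lt_trans sh.
pose Q (t : R) : R := enorm h ^+ 2 + t * (h ord0 i *+ 2) + t ^+ 2.
have QE t : Q t = enorm (h + t *: e) ^+ 2.
  rewrite /Q !sqr_enorm dotrVDl !dotrVDr !dotrVZl !dotrVZr.
  have -> : dotrV e e = 1 by rewrite -sqr_enorm enorm_delta expr1n.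
  have -> : dotrV h e = h ord0 i.
    rewrite /dotrV (bigD1 i)//= mxE !eqxx mulr1 big1 ?addr0// => j ji.
    by rewrite mxE (negbTE ji) andbF mulr0.
  have -> : dotrV e h = h ord0 i.
    rewrite /dotrV (bigD1 i)//= mxE !eqxx mul1r big1 ?addr0// => j ji.
    by rewrite mxE (negbTE ji) andbF mul0r.
  ring.
have dQ : is_derive (0 : R) (1 : R) Q (h ord0 i *+ 2).
  apply: is_derive_eq; rewrite /GRing.scale/=; ring.
have Q0 : 0 < Q 0 by rewrite QE scale0r addr0 exprn_gt0.
have dP : is_derive (Q 0) (1 : R) (fun u : R => u `^ (- (a / 2))) (- (a / 2) * Q 0 `^ (- (a / 2) - 1)).
  exact: is_derive1_powR.
have dPQ : is_derive (0 : R) (1 : R) (fun t => Q t `^ (- (a / 2))) (- a * (h ord0 i * kpow (a + 2) h)).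
  apply: (is_derive_eq (@is_derive1_comp _ (fun u : R => u `^ (- (a / 2))) Q 0 _ _ dP dQ)).
  rewrite QE scale0r addr0 -powR_mulrn ?enorm_ge0// -powRrM /kpow -powRN.
  rewrite (_ : 2 * (- (a / 2) - 1) = - (a + 2)); last by field.
  by rewrite /GRing.scale/=; field.
have := cvg_is_derive dPQ; apply: cvg_trans; apply: near_eq_cvg; near=> t.
have sht : s < enorm (h + t *: e) by near: t; apply: (cvgr_gt _ ct').
rewrite /diffquot /= [_%:A]mulr1 addr0 !kcap_off ?(ltW sh) ?(ltW sht)// /kpow -!powRN.
have E u : enorm (h + u *: e) `^ (- a) = Q u `^ (- (a / 2)).
  by rewrite QE -powR_mulrn ?enorm_ge0// -powRrM; congr (_ `^ _); field.
by rewrite -!E scale0r addr0.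
Unshelve. all: by end_near. Qed.

End capped_kernel.

(** * The fractional divergence *)

Section gradient_kernel.
Context {R : realType} {n : nat}.
Notation rV := ('rV[R]_n).
Notation lam := (@lebesgue_rV R n).
Implicit Types (h : rV) (s r a : R).

(** Up to the factor [- a], the i-th partial derivative of [kcap a s] away from the sphere of radius
    [s]. *)
Definition kgrad a s (i : 'I_n) h : R := h ord0 i * kpow (a + 2) h * off_ball s h.

Lemma measurable_kgrad a s i : measurable_fun setT (kgrad a s i).
Proof.
apply: measurable_funM; last exact: measurable_off_ball.
by apply: measurable_funM; [exact: measurable_coord|exact: measurable_kpow].
Qed.

(** An equality away from the origin; the inequality absorbs the conventional values at [0]. *)
Lemma enorm_kpow c h : enorm h * kpow (c + 1) h <= kpow c h.
Proof.
have [->|h0] := eqVneq h 0; first by rewrite enorm0 mul0r kpow_ge0.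
have h1 : 0 < enorm h by rewrite enorm_gt0.
rewrite /kpow powRD; last by rewrite (gt_eqF h1) implybT.
by rewrite powRr1 ?enorm_ge0// invfM mulrC mulfVK// gt_eqF.
Qed.

Lemma kpow_off c s h : 0 <= c -> 0 < s -> kpow c h * off_ball s h <= (s `^ c)^-1.
Proof.
move=> c0 s0; rewrite off_ballE; have [sh|_] := leP s (enorm h); last first.
  by rewrite mulr0 invr_ge0 powR_ge0.
have h0 : 0 < enorm h by exact: lt_le_trans sh.
rewrite mulr1 lef_pV2 ?posrE ?powR_gt0//.
by apply: ge0_ler_powR; rewrite ?nnegrE ?(ltW s0) ?(ltW h0).
Qed.

Lemma kgrad_le a s i h : `|kgrad a s i h| <= kpow (a + 1) h * off_ball s h.
Proof.
have o0 : 0 <= off_ball s h by rewrite off_ballE.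
rewrite /kgrad !normrM (ger0_norm o0) (ger0_norm (kpow_ge0 _ _)) ler_wpM2r//.
rewrite (_ : a + 2 = a + 1 + 1); last by ring.
apply: le_trans (enorm_kpow _ _); rewrite ler_wpM2r ?kpow_ge0//; exact: coord_le_enorm.
Qed.

Lemma kgrad_bounded a s i h : 0 < a -> 0 < s -> `|kgrad a s i h| <= (s `^ (a + 1))^-1.
Proof.
move=> a0 s0; apply: le_trans (kgrad_le _ _ _ _) _.
by apply: kpow_off => //; rewrite addr_ge0// ltW.
Qed.

Lemma kcap_by_parts a s phi : (0 < n)%N -> 0 < a -> 0 < s -> test_field phi ->
  \int[lam]_h (kcap a s h * divergence phi h) =
  a * \sum_i \int[lam]_h (kgrad a s i h * phi h ord0 i).
Proof.
move=> n0 a0 s0 tp.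
have [M1 M10 hM1] := test_field_bounded tp.
have [M2 M20 hM2] := test_field_derive_bounded tp.
have mphi i : measurable_fun setT (fun h => phi h ord0 i).
  by apply: continuous_measurable_rV; exact: test_field_coord_continuous.
have mdphi i : measurable_fun setT (fun h => 'D_(delta_mx ord0 i) phi h ord0 i).
  by apply: continuous_measurable_rV; exact/test_field_coord_continuous/test_field_derive.
have kcapM h : `|kcap a s h| <= (s `^ a)^-1 by rewrite ger0_norm ?kcap_ge0// kcap_le.
transitivity (\sum_i \int[lam]_h (kcap a s h * 'D_(delta_mx ord0 i) phi h ord0 i)).
  rewrite -Rintegral_sum; first by apply: eq_Rintegral => h _; rewrite mulr_sumr.
  move=> i; have [c hc] := test_field_bsupp i (test_field_derive i tp).
  apply: (@integrable_bsupp _ _ _ c ((s `^ a)^-1 * M2)).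
  - by apply: measurable_funM => //; exact: measurable_kcap.
  - by move=> h; rewrite normrM ler_pM// (le_trans (coord_le_enorm _ _)).
  - by move=> h; rewrite mulf_eq0 negb_or => /andP[_ /hc].
rewrite mulr_sumr; apply: eq_bigr => i _.
have [c hc] := test_field_bsupp i tp.
have mk := measurable_kgrad a s i.
have := @Rintegral_by_parts R n (kcap a s) (fun h => - a * kgrad a s i h)
  (fun h => phi h ord0 i) (fun h => 'D_(delta_mx ord0 i) phi h ord0 i)
  (* [M1 + M2] serves both as a bound and as a Lipschitz constant of the component of [phi]. *)
  (s `^ a)^-1 (a * s `^ (- a - 1)) (M1 + M2) c (delta_mx ord0 i).
move=> ->//.
- rewrite -RintegralN_measurable; last by apply: measurable_funM => //; exact: measurable_funM.
  rewrite -RintegralZl_measurable; last exact: measurable_funM.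
  by apply: eq_Rintegral => h _; ring.
- exact: measurable_kcap.
- exact: measurable_funM.
- move=> h t; apply: le_trans (kcap_lipschitz _ _ _ _) _ => //.
  by rewrite enormZ enorm_delta mulr1.
- apply: filterS (esphere_negligible n0 s) => h hs.
  exact: kcap_diffquot.
- by move=> h; apply: le_trans (coord_le_enorm _ _) _; apply: le_trans (hM1 _) _; rewrite lerDl.
- move=> h t; apply: le_trans (test_field_line_lipschitz _ _ _ _ tp hM2) _.
  by rewrite ler_wpM2r// lerDr.
- by move=> h; exact: test_field_diffquot.
Qed.

(** The kernel is odd. This is what allows the value of a test field at the centre to be
    subtracted. *)
Lemma Rintegral_kgrad a s i : \int[lam]_h kgrad a s i h = 0.
Proof.
have mk := measurable_kgrad a s i.
have : \int[lam]_h kgrad a s i (0 - h) = \int[lam]_h kgrad a s i h.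
  exact: Rintegral_rV_reflect.
under eq_Rintegral => h _.
  rewrite (_ : kgrad a s i (0 - h) = - kgrad a s i h); last first.
    by rewrite /kgrad sub0r mxE /kpow !off_ballE enormN !mulNr.
  over.
by rewrite RintegralN_measurable//; lra.
Qed.

Lemma kgrad_integrable alpha s i : (0 < n)%N -> 0 < alpha -> 0 < s ->
  lam.-integrable setT (EFin \o kgrad (n%:R + alpha - 1) s i).
Proof.
move=> n0 a0 s0; apply/integrable_EFinP; split; first exact: measurable_kgrad.
apply: le_lt_trans (ltry (n%:R * omega n * (s `^ (- alpha) / alpha))).
apply: le_trans (integral_kpow_off n0 a0 s0); apply: ge0_le_integral => //.
- by apply/measurable_EFinP; apply: measurableT_comp => //; exact: measurable_kgrad.
- apply/measurable_EFinP; apply: measurable_funM; first exact: measurable_kpow.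
  exact: measurable_off_ball.
- move=> h _; rewrite lee_fin; apply: le_trans (kgrad_le _ _ _ _) _.
  by rewrite (_ : n%:R + alpha - 1 + 1 = n%:R + alpha) //; ring.
Qed.

End gradient_kernel.

(** * Kernel formulas for the fractional divergence *)

Section fractional_divergence.
Context {R : realType} {n : nat}.
Notation rV := ('rV[R]_n).
Notation lam := (@lebesgue_rV R n).
Variables (alpha : R) (n0 : (0 < n)%N) (alpha0 : 0 < alpha) (alpha1 : alpha < 1).
Let a : R := n%:R + alpha - 1.
Implicit Types (h x : rV) (s r : R) (phi : rV -> rV).

Lemma order_gt0 : 0 < a.
Proof. by rewrite /a addrAC ltr_wpDl// subr_ge0 ler1n. Qed.

Lemma kpow_near_integrable r : 0 < r -> lam.-integrable setT (EFin \o (fun h => kpow a h * near_ball r h)).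
Proof.
move=> r0; apply/integrable_EFinP; split.
  by apply: measurable_funM; [exact: measurable_kpow|exact: measurable_near_ball].
have b0 : 0 < 1 - alpha by rewrite subr_gt0.
have bn : 1 - alpha < n%:R by rewrite ltrBlDr ltr_pwDr// ler1n.
apply: le_lt_trans (ltry (n%:R * omega n * (r `^ (1 - alpha) / (1 - alpha)))).
apply: le_trans (integral_kpow_near b0 bn r0).
rewrite le_eqVlt; apply/orP; left; apply/eqP; apply: eq_integral => h _.
rewrite ger0_norm; last by rewrite mulr_ge0 ?kpow_ge0// near_ballE.
by rewrite (_ : n%:R - (1 - alpha) = a)// /a; ring.
Qed.

Lemma kpow_off_integrable r : 0 < r -> lam.-integrable setT (EFin \o (fun h => kpow (a + 1) h * off_ball r h)).
Proof.
move=> r0; apply/integrable_EFinP; split.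
  by apply: measurable_funM; [exact: measurable_kpow|exact: measurable_off_ball].
apply: le_lt_trans (ltry (n%:R * omega n * (r `^ (- alpha) / alpha))).
apply: le_trans (integral_kpow_off n0 alpha0 r0).
rewrite le_eqVlt; apply/orP; left; apply/eqP; apply: eq_integral => h _.
rewrite ger0_norm; last by rewrite mulr_ge0 ?kpow_ge0// off_ballE.
by rewrite (_ : n%:R + alpha = a + 1)// /a; ring.
Qed.

Let t k : R := k.+1%:R^-1.
Let t0 k : 0 < t k. Proof. by rewrite invr_gt0. Qed.

Let near_t h : h != 0 -> \forall k \near \oo, t k <= enorm h.
Proof.
rewrite -enorm_gt0 => h0; have h1 : t k @[k --> \oo] --> (0 : R) by exact: cvg_harmonic.
by near=> k; apply: ltW; near: k; exact: (cvgr_lt _ h1).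
Unshelve. all: by end_near. Qed.

Let ae_neq0 : {ae lam, forall h, h != 0}.
Proof. by apply: filterS (esphere_negligible n0 0) => h; rewrite enorm_eq0. Qed.

(** Outside the unit ball the kernel is at most [1]. With [c] the indicator of a cube this gives an
    integrable majorant independent of the cap. *)
Let near_split c h : c <= 1 -> 0 <= c -> kpow a h * c <= kpow a h * near_ball 1 h + c.
Proof.
move=> c1 c0; rewrite near_ballE; have [h1|h1] := ltP (enorm h) 1.
  by rewrite mulr1 -lerBlDl; apply: le_trans c0; rewrite subr_le0 ler_piMr// kpow_ge0.
rewrite mulr0 add0r ler_piMl//.
have := @kpow_off _ _ a 1 h (ltW order_gt0) ltr01.
by rewrite off_ballE h1 mulr1 powR1 invr1.
Qed.

(** The radius of the cap tends to [0] in [kcap_by_parts]. The left side is dominated because |h|^-a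
    is locally integrable. On the right |h|^-(a+1) is not, so [phi 0] is first subtracted, which is
    free by oddness, and the Lipschitz bound recovers one power of |h|. *)
Lemma kpow_divergence0 phi : test_field phi ->
  lam.-integrable setT (EFin \o (fun h => kpow a h * divergence phi h)) /\
  \int[lam]_h (kpow a h * divergence phi h) =
  a * \int[lam]_h (dotrV h (phi h - phi 0) * kpow (a + 2) h).
Proof.
move=> tp; have a0 := order_gt0.
have [M M0 hM] := divergence_bounded tp; have [c hc] := divergence_bsupp tp.
have mdiv := measurable_divergence tp.
have [B B0 hB] := test_field_bounded tp; have [L L0 hL] := test_field_lipschitz tp.
have mphi := test_field_measurable tp.
pose cub : set rV := [set x | forall i, `|x ord0 i| <= c].
pose g h := M * (kpow a h * near_ball 1 h) + M * \1_cub h.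
have ig : lam.-integrable setT (EFin \o g).
  have := integrableD measurableT (integrableZl measurableT M (kpow_near_integrable ltr01)) (@integrable_cube R n c M).
  by apply: eq_integrable => // h _ /=; rewrite EFinD EFinM.
have [i1 lim1] : lam.-integrable setT (EFin \o (fun h => kpow a h * divergence phi h)) /\
    \int[lam]_h (kcap a (t k) h * divergence phi h) @[k --> \oo] -->
    \int[lam]_h (kpow a h * divergence phi h).
  apply: (Rintegral_dominated _ _ _ ig).
  - by move=> k; apply: measurable_funM => //; exact: measurable_kcap.
  - by apply: measurable_funM => //; exact: measurable_kpow.
  - apply: filterS ae_neq0 => h h0; apply: cvg_near_cst.
    by near=> k; rewrite kcap_off//; near: k; exact: near_t.
  - apply: filterS ae_neq0 => h h0 k; rewrite normrM (ger0_norm (kcap_ge0 _ _ _)).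
    apply: le_trans (ler_pM (kcap_ge0 _ _ _) (normr_ge0 _) (kcap_le_kpow a0 (t0 k) h0) (bsupp_le hM hc h)) _.
    rewrite mulrCA /g -mulrDr ler_wpM2l//; apply: near_split; rewrite ?indicE//.
    by case: (_ \in _).
split => //.
(* Near the origin the increment of [phi] is at most [L |h|]; far from it, at most twice the bound
   [B]. *)
pose g2 h := L * (kpow a h * near_ball 1 h) + 2 * B * (kpow (a + 1) h * off_ball 1 h).
have ig2 : lam.-integrable setT (EFin \o g2).
  have := integrableD measurableT (integrableZl measurableT L (kpow_near_integrable ltr01))
    (integrableZl measurableT (2 * B) (kpow_off_integrable ltr01)).
  by apply: eq_integrable => // h _ /=; rewrite EFinD !EFinM.
have mF : measurable_fun setT (fun h => dotrV h (phi h - phi 0) * kpow (a + 2) h).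
  apply: measurable_funM; last exact: measurable_kpow.
  by apply: measurable_dotrV => //; exact: measurable_fun_rVB.
have [_ lim2] : lam.-integrable setT (EFin \o (fun h => dotrV h (phi h - phi 0) * kpow (a + 2) h)) /\
    \int[lam]_h (dotrV h (phi h - phi 0) * kpow (a + 2) h * off_ball (t k) h) @[k --> \oo] -->
    \int[lam]_h (dotrV h (phi h - phi 0) * kpow (a + 2) h).
  apply: (Rintegral_dominated _ _ _ ig2) => //.
  - by move=> k; apply: measurable_funM => //; exact: measurable_off_ball.
  - apply: filterS ae_neq0 => h h0; apply: cvg_near_cst.
    by near=> k; rewrite off_ballE (_ : t k <= enorm h) ?mulr1//; near: k; exact: near_t.
  - apply: aeW => h k.
    have : `|dotrV h (phi h - phi 0) * kpow (a + 2) h * off_ball (t k) h| <=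
        enorm (phi h - phi 0) * (enorm h * kpow (a + 2) h).
      rewrite normrM; apply: (@le_trans _ _ (`|dotrV h (phi h - phi 0) * kpow (a + 2) h| * 1)).
        by rewrite ler_wpM2l// off_ballE; case: (t k <= enorm h); rewrite /= ?normr1 ?normr0 ?ler01.
      rewrite mulr1 normrM (ger0_norm (kpow_ge0 _ _)) mulrA ler_wpM2r ?kpow_ge0// mulrC.
      by rewrite [leRHS]mulrC mulrC normr_dotrV.
    move=> /le_trans; apply.
    have k1 : enorm h * kpow (a + 2) h <= kpow (a + 1) h.
      by rewrite (_ : a + 2 = a + 1 + 1) ?enorm_kpow//; ring.
    have hh : 0 <= enorm h * kpow (a + 2) h by rewrite mulr_ge0 ?enorm_ge0 ?kpow_ge0.
    rewrite /g2 near_ballE off_ballE; have [h1|h1] := ltP (enorm h) 1.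
      rewrite mulr1 mulr0 mulr0 addr0.
      apply: le_trans (ler_wpM2l L0 (enorm_kpow a h)); rewrite (mulrA L).
      apply: ler_pM => //; first exact: enorm_ge0.
      by have := hL 0 h; rewrite add0r.
    rewrite mulr0 mulr0 add0r mulr1; apply: ler_pM => //; first exact: enorm_ge0.
    by apply: le_trans (ler_enormD _ _) _; rewrite enormN mulr_natl mulr2n lerD.
have mphii i : measurable_fun setT (fun h => phi h ord0 i).
  by apply: continuous_measurable_rV; exact: test_field_coord_continuous.
apply: (@cvg_unique _ (@norm_hausdorff _ R^o) _ _ _ _ lim1).
apply: cvg_trans (cvgM (cvg_cst a) lim2); apply: near_eq_cvg; apply: nearW => k /=.
rewrite (kcap_by_parts n0 a0 (t0 k) tp); congr (_ * _).
have ikp i : lam.-integrable setT (EFin \o (fun h => kgrad a (t k) i h * phi h ord0 i)).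
  have [c' hc'] := test_field_bsupp i tp.
  apply: (@integrable_bsupp _ _ _ c' ((t k `^ (a + 1))^-1 * B)).
  - by apply: measurable_funM => //; exact: measurable_kgrad.
  - by move=> h; rewrite normrM ler_pM ?kgrad_bounded// (le_trans (coord_le_enorm _ _)).
  - by move=> h; rewrite mulf_eq0 negb_or => /andP[_ /hc'].
have ik i : lam.-integrable setT (EFin \o (fun h => kgrad a (t k) i h * phi 0 ord0 i)).
  have := integrableZr measurableT (phi 0 ord0 i) (@kgrad_integrable _ _ alpha (t k) i n0 alpha0 (t0 k)).
  by apply: eq_integrable.
(* The terms in [phi 0] integrate to [0] one coordinate at a time; they are integrable because the
   kernel is supported off a ball. *)
transitivity (\sum_i \int[lam]_h (kgrad a (t k) i h * phi h ord0 i - kgrad a (t k) i h * phi 0 ord0 i)).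
  rewrite -Rintegral_sum; last first.
    move=> i; have := integrableB measurableT (ikp i) (ik i).
    by apply: eq_integrable.
  apply: eq_Rintegral => h _; rewrite /dotrV !mulr_suml; apply: eq_bigr => i _.
  by rewrite !mxE /kgrad; ring.
apply: eq_bigr => i _; rewrite RintegralB// RintegralZr_measurable; last exact: measurable_kgrad.
by rewrite Rintegral_kgrad mul0r subr0.
Unshelve. all: by end_near. Qed.

(* The maximum only matters at [h = 0], where [kpow a 0 = 0] (inverse of 0). *)
Definition knear r h : R := Num.max 0 (kpow a h - kcap a r h).

Lemma knear_ge0 r h : 0 <= knear r h.
Proof. by rewrite le_max lexx. Qed.

Lemma knear_le r h : knear r h <= kpow a h * near_ball r h.
Proof.
rewrite near_ballE /knear ge_max mulr_ge0 ?kpow_ge0//=.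
have [hr|hr] := ltP (enorm h) r; first by rewrite mulr1 lerBlDr lerDl kcap_ge0.
by rewrite mulr0 kcap_off// subrr.
Qed.

Lemma measurable_knear r : measurable_fun setT (knear r).
Proof.
apply: measurable_maxr => //; apply: measurable_funB; first exact: measurable_kpow.
exact: measurable_kcap.
Qed.

Lemma knear_integrable r : 0 < r -> lam.-integrable setT (EFin \o knear r).
Proof.
move=> r0; apply: le_integrable (kpow_near_integrable r0) => //.
  by apply/measurable_EFinP; exact: measurable_knear.
move=> h _ /=; rewrite lee_fin ger0_norm ?knear_ge0//.
exact: le_trans (knear_le r h) (ler_norm _).
Qed.

(** Off the origin the kernel is the sum of [knear] and of the kernel capped at [r]. Only the capped
    part is integrated by parts, and the factor [a] this produces cancels the one in [mu / a]. *)
Lemma fdivergenceE r phi x : 0 < r -> test_field phi ->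
  fdivergence alpha phi x =
  mu_const n alpha / a * \int[lam]_h (knear r h * divergence phi (x + h)) +
  mu_const n alpha * \sum_i \int[lam]_h (kgrad a r i h * phi (x + h) ord0 i).
Proof.
move=> r0 tp; have a0 := order_gt0; have cancel_a (u w : R) : u / a * (a * w) = u * w by rewrite mulrA divfK// gt_eqF.
pose psi h := phi (h + x).
have tps : test_field psi by exact: test_field_shift.
have [ikd kd] := kpow_divergence0 tps.
have mdiv := measurable_divergence tps.
have [M M0 hM] := divergence_bounded tps; have [c hc] := divergence_bsupp tps.
have -> : fdivergence alpha phi x = mu_const n alpha / a * \int[lam]_h (kpow a h * divergence psi h).
  rewrite kd cancel_a; apply: (congr1 ( *%R (mu_const n alpha))).
  (* The variable [y] is replaced by [h + x], which centres the singularity at the origin. *)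
  rewrite -(@Rintegral_rV_shift _ _ x); last first.
    have mphi := test_field_measurable tp.
    apply: measurable_funM.
      by apply: measurable_dotrV; exact: measurable_fun_rVB.
    rewrite (_ : (fun y => _) = (fun y => kpow (n%:R + alpha + 1) (y - x)))//.
    by apply: measurableT_comp; [exact: measurable_kpow|exact: measurable_fun_rVB].
  apply: eq_Rintegral => h _; rewrite addrK /psi add0r /kpow.
  by rewrite (_ : a + 2 = n%:R + alpha + 1)// /a; ring.
have -> : \int[lam]_h (knear r h * divergence phi (x + h)) = \int[lam]_h (knear r h * divergence psi h).
  by apply: eq_Rintegral => h _; rewrite divergence_shift addrC.
have -> : \sum_i \int[lam]_h (kgrad a r i h * phi (x + h) ord0 i) =
    \sum_i \int[lam]_h (kgrad a r i h * psi h ord0 i).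
  by apply: eq_bigr => i _; apply: eq_Rintegral => h _; rewrite /psi addrC.
have -> : mu_const n alpha * \sum_i \int[lam]_h (kgrad a r i h * psi h ord0 i) =
   mu_const n alpha / a * \int[lam]_h (kcap a r h * divergence psi h).
  by rewrite (kcap_by_parts n0 a0 r0 tps) cancel_a.
rewrite -mulrDr; congr (_ * _).
have mkn := measurable_knear r; have mkc := @measurable_kcap R n a r.
have mkp := @measurable_kpow R n a.
rewrite -RintegralD//.
- apply: ae_eq_Rintegral; [exact: measurable_funM| |].
    by apply: measurable_funD; exact: measurable_funM.
  apply: filterS ae_neq0 => h h0; rewrite -mulrDl /knear (max_idPr _) ?subrK//.
  by rewrite subr_ge0 kcap_le_kpow.
- apply: (@le_integrable _ _ _ lam _ measurableT _ (EFin \o (fun h => M * knear r h))).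
  + by apply/measurable_EFinP; exact: measurable_funM.
  + move=> h _ /=; rewrite lee_fin normrM mulrC [leRHS]normrM ler_wpM2r// (le_trans (hM h))//.
    exact: ler_norm.
  + have := integrableZl measurableT M (knear_integrable r0).
    by apply: eq_integrable.
- apply: (@integrable_bsupp _ _ _ c ((r `^ a)^-1 * M)).
  + exact: measurable_funM.
  + by move=> h; rewrite normrM ler_pM// ger0_norm ?kcap_ge0// kcap_le.
  + by move=> h; rewrite mulf_eq0 negb_or => /andP[_ /hc].
Qed.

End fractional_divergence.

(** * Convolution and duality pairings in L^p *)

Section lebesgue_space_convolution.
Context {R : realType} {n : nat}.
Notation rV := ('rV[R]_n).
Notation lam := (@lebesgue_rV R n).
Implicit Types (k u v : rV -> R) (p q : R) (x h : rV).

Lemma Lp_measurable p u : 0 < p -> Lp p u -> measurable_fun setT u.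
Proof. by move=> p0 /(LpP _ p0)[]. Qed.

Lemma Lp_integrableM p q u v : 0 < p -> 0 < q -> p^-1 + q^-1 = 1 ->
  Lp p u -> Lp q v -> lam.-integrable setT (EFin \o (fun x => u x * v x)).
Proof.
move=> p0 q0 pq /(LpP _ p0)[mu uoo] /(LpP _ q0)[mv voo].
apply/integrable_EFinP; split; first exact: measurable_funM.
apply: le_lt_trans (holder_ge0 lam mu mv p0 q0 pq) _.
by rewrite lte_mul_pinfty ?poweR_ge0// ?poweR_lty// ge0_fin_numE ?poweR_ge0// poweR_lty.
Qed.

Lemma compact_coord_bounded (K : set rV) : compact K ->
  exists c : R, forall x, K x -> forall i, `|x ord0 i| <= c.
Proof.
move=> cK; have [M [_ MK]] := compact_bounded cK; exists (M + 1) => x Kx i.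
have := MK (M + 1); rewrite ltrDl => /(_ ltr01 x Kx).
by apply: le_trans; rewrite [leRHS]mx_normrE; exact: (le_bigmax _ _ (ord0, i)).
Qed.

Lemma conj_exponent p : 1 < p -> exists q : R, [/\ 1 < q, p^-1 + q^-1 = 1 & 0 < q].
Proof.
move=> p1; have p0 : 0 < p by exact: lt_trans p1.
have d0 : 0 < p - 1 by rewrite subr_gt0.
exists (p / (p - 1)); split; last by rewrite divr_gt0.
  by rewrite ltr_pdivlMr// mul1r ltrBlDr ltrDl.
by rewrite invf_div -[X in X + _]mul1r -mulrDl addrC subrK divff// gt_eqF.
Qed.

(** Hölder against the indicator of the compact set. *)
Lemma Lp_compact_integrable p u (K : set rV) : 1 < p -> Lp p u -> compact K ->
  lam.-integrable K (EFin \o u).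
Proof.
move=> p1 Lu cK; have mK := compact_measurable_rV cK.
have p0 : 0 < p by exact: lt_trans p1.
have [q [q1 pq q0]] := conj_exponent p1; have [c hc] := compact_coord_bounded cK.
have L1 : Lp q (\1_K : rV -> R).
  apply: (@Lp_bsupp _ _ _ c 1) => //.
    by move=> x; rewrite indicE; case: (_ \in _); rewrite ?normr1 ?normr0.
  move=> x; rewrite indicE; case: (boolP (x \in K)); last by rewrite eqxx.
  by rewrite inE => /hc.
apply: (integrable_mkcond _ mK).2.
have := Lp_integrableM p0 q0 pq Lu L1; apply: eq_integrable => // x _ /=.
by rewrite patchE indicE; case: (_ \in _); rewrite ?mulr1 ?mulr0.
Qed.

Lemma Lp_field_L1loc p (g : rV -> rV) : 1 < p -> Lp_field p g -> L1loc_field g.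
Proof. by move=> p1 [mg Lg]; split => // K cK; exact: Lp_compact_integrable p1 Lg cK. Qed.

Lemma Lp_field_coord p (g : rV -> rV) i : 0 < p -> Lp_field p g -> Lp p (fun x => g x ord0 i).
Proof.
move=> p0 [mg /(LpP _ p0)[meg goo]].
have mi : measurable_fun setT (fun x => g x ord0 i).
  exact: measurableT_comp (measurable_coord i) mg.
apply/(LpP _ p0); split => //; apply: le_lt_trans goo.
apply: ge0_le_integral => //.
- by apply/measurable_EFinP; apply: measurable_powR_comp; exact: measurableT_comp.
- by apply/measurable_EFinP; apply: measurable_powR_comp; exact: measurableT_comp.
- move=> x _; rewrite lee_fin; apply: ge0_ler_powR; rewrite ?nnegrE ?(ltW p0)//.
  by rewrite /= [leRHS]ger0_norm ?enorm_ge0// coord_le_enorm.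
Qed.

Lemma integrable_reflect k : lam.-integrable setT (EFin \o k) ->
  lam.-integrable setT (EFin \o (fun h => k (- h))).
Proof.
move=> /integrable_EFinP[mk koo].
have mN : measurable_fun setT (fun h => k (- h)).
  by apply: measurableT_comp => //; exact: measurable_fun_rVN.
apply/integrable_EFinP; split => //.
rewrite (_ : (\int[lam]_x `|k (- x)|%:E)%E = (\int[lam]_x `|k x|%:E)%E)//.
have mE : measurable_fun setT (fun x => `|k x|%:E).
  by apply/measurable_EFinP; exact: measurableT_comp.
rewrite -[RHS](@integral_rV_reflect R n 0 (fun x => `|k x|%:E) mE).
by apply: eq_integral => x _; rewrite sub0r.
Qed.

Lemma conv_reflect k v x : measurable_fun setT k -> measurable_fun setT v ->
  \int[lam]_h (k h * v (x + h)) = conv (fun h => k (- h)) v x.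
Proof.
move=> mk mv; rewrite -(@Rintegral_rV_reflect _ _ 0); last first.
  by apply: measurable_funM => //; apply: measurableT_comp => //; exact: measurable_fun_rVD.
by apply: eq_Rintegral => h _; rewrite sub0r.
Qed.

Lemma econv_Lp p k u : 1 < p -> lam.-integrable setT (EFin \o k) -> Lp p u ->
  (\int[lam]_x (econv (fun h => `|k h|)%R (fun h => `|u h|)%R x `^ p) < +oo)%E.
Proof.
move=> p1 /integrable_EFinP[mk koo] Lu; have p0 : 0 < p by exact: lt_trans p1.
have [mu uoo] := (LpP _ p0).1 Lu.
have I0 : (0 <= \int[lam]_x `|k x|%:E)%E by apply: integral_ge0 => x _; rewrite lee_fin.
have Ifin : (\int[lam]_x `|k x|%:E)%E \is a fin_num by rewrite ge0_fin_numE.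
apply: (@le_lt_trans _ _ _ _ _ (@young _ _ _ _ p (fine (\int[lam]_x `|k x|%:E)%E) p1 _ _ _ _ _ _)) => //.
- by apply: fine_ge0.
- exact: measurableT_comp.
- exact: measurableT_comp.
- by rewrite fineK.
- by rewrite lte_mul_pinfty// lee_fin powR_ge0.
Qed.

Lemma Lp_conv p k u : 1 < p -> lam.-integrable setT (EFin \o k) -> Lp p u -> Lp p (conv k u).
Proof.
move=> p1 ik Lu; have p0 : 0 < p by exact: lt_trans p1.
have [mk koo] := (integrable_EFinP _ _).1 ik; have mu := Lp_measurable p0 Lu.
apply/(LpP _ p0); split; first exact: measurable_conv.
apply: le_lt_trans (econv_Lp p1 ik Lu); apply: ge0_le_integral => //.
- apply/measurable_EFinP; apply: measurable_powR_comp; apply: measurableT_comp => //.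
  exact: measurable_conv.
- apply: (@measurableT_comp _ _ _ _ _ _ (fun y : \bar R => (y `^ p)%E)).
    exact: measurable_poweR.
  by apply: measurable_econv => //; exact: measurableT_comp.
- move=> x _; rewrite -poweR_EFin; apply: ge0_le_poweR; rewrite ?(ltW p0) ?lee_fin//.
  exact: le_abs_conv.
Qed.

(** The iterated integrals in the duality argument are split into sums later, which requires each
    term to be integrable. The first is bounded by [|k|] times a Hölder constant uniform in [h]; the
    other two pair a convolution in one Lebesgue space with a function in the dual one. *)
Lemma pairing_integrable p q k u v : 1 < p -> 1 < q -> p^-1 + q^-1 = 1 ->
  lam.-integrable setT (EFin \o k) -> Lp p u -> Lp q v ->
  lam.-integrable setT (EFin \o (fun h => k h * \int[lam]_x (u x * v (x + h)))) /\
  lam.-integrable setT (EFin \o (fun x => u x * \int[lam]_h (k h * v (x + h)))) /\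
  lam.-integrable setT (EFin \o (fun x => conv k u x * v x)).
Proof.
move=> p1 q1 pq ik Lu Lv.
have p0 : 0 < p by exact: lt_trans p1.
have q0 : 0 < q by exact: lt_trans q1.
have [mk koo] := (integrable_EFinP _ _).1 ik.
have [mu uoo] := (LpP _ p0).1 Lu; have [mv voo] := (LpP _ q0).1 Lv.
have mvs h : measurable_fun setT (fun x : rV => v (x + h)).
  by apply: measurableT_comp => //; exact: measurable_fun_rVD.
split; last split; last first.
- exact: Lp_integrableM p0 q0 pq (Lp_conv p1 ik Lu) Lv.
- apply: Lp_integrableM p0 q0 pq Lu _; under eq_fun do rewrite conv_reflect//.
  by apply: Lp_conv => //; exact: integrable_reflect.
pose N := ((\int[lam]_x (`|u x| `^ p)%:E) `^ p^-1 * (\int[lam]_x (`|v x| `^ q)%:E) `^ q^-1)%E.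
have N0 : (0 <= N)%E by rewrite mule_ge0 ?poweR_ge0.
have Noo : N \is a fin_num.
  rewrite ge0_fin_numE// lte_mul_pinfty ?poweR_ge0// ?poweR_lty//.
  by rewrite ge0_fin_numE ?poweR_ge0// poweR_lty.
apply: (@le_integrable _ _ _ lam _ measurableT _ (EFin \o (fun h => fine N * k h))) => //.
- apply/measurable_EFinP; apply: measurable_funM => //.
  (* Measurability in [h] comes from reading the inner integral as a convolution of [v] with the
     reflected [u]. *)
  under eq_fun do under eq_Rintegral do rewrite addrC.
  under eq_fun do rewrite conv_reflect//.
  apply: measurable_conv => //; apply: measurableT_comp => //; exact: measurable_fun_rVN.
- move=> h _ /=; rewrite lee_fin normrM mulrC [leRHS]normrM ler_wpM2r//.
  apply: le_trans (ler_norm _); rewrite -lee_fin fineK//.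
  apply: le_trans (le_abs_Rintegral _ _) _; first exact: measurable_funM.
  apply: le_trans (holder_ge0 lam mu (mvs h) p0 q0 pq) _.
  rewrite (@integral_rV_shift R n h (fun x => (`|v x| `^ q)%:E))//.
  by apply/measurable_EFinP; apply: measurable_powR_comp; exact: measurableT_comp.
- have := integrableZl measurableT (fine N) ik.
  by apply: eq_integrable.
Qed.

End lebesgue_space_convolution.

(** * The fractional gradient *)

Section split_gradient.
Context {R : realType} {n : nat}.
Notation rV := ('rV[R]_n).
Notation lam := (@lebesgue_rV R n).
Variables (alpha p : R) (n0 : (0 < n)%N) (alpha0 : 0 < alpha) (alpha1 : alpha < 1) (p1 : 1 < p).
Variables (f : rV -> R) (Df : rV -> rV).
Hypotheses (Lf : Lp p f) (LDf : Lp_field p Df).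
Let a : R := n%:R + alpha - 1.
Let mu := mu_const n alpha : R.

Definition fgrad_split r (x : rV) : rV :=
  \row_i (mu / a * conv (knear alpha r) (fun y => Df y ord0 i) x
          - mu * conv (kgrad a r i) f x).

Let p0 : 0 < p. Proof. exact: lt_trans p1. Qed.
Let mf : measurable_fun setT f. Proof. exact: Lp_measurable p0 Lf. Qed.
Let mDf : measurable_fun setT Df. Proof. by case: LDf. Qed.
Let LDi i : Lp p (fun y => Df y ord0 i). Proof. exact: Lp_field_coord. Qed.
Let mDi i : measurable_fun setT (fun y => Df y ord0 i).
Proof. exact: Lp_measurable p0 (LDi i). Qed.

Lemma measurable_fgrad_split r : measurable_fun setT (fgrad_split r).
Proof.
apply: measurable_fun_rV => i; under eq_fun do rewrite mxE.
apply: measurable_funB; apply: measurable_funM => //; apply: measurable_conv => //.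
  exact: measurable_knear.
exact: measurable_kgrad.
Qed.

Lemma fgrad_split_Lp_coord r i : 0 < r -> Lp p (fun x => fgrad_split r x ord0 i).
Proof.
move=> r0.
have := rpredB (rpredZ (mu / a) (Lp_conv p1 (knear_integrable n0 alpha0 alpha1 r0) (LDi i)))
  (rpredZ mu (Lp_conv p1 (kgrad_integrable i n0 alpha0 r0) Lf)).
have pE : (1 <= p%:E)%E by rewrite lee_fin ltW.
move=> /(_ pE pE pE) h; rewrite (_ : (fun x => _) =
  (mu / a) *: conv (knear alpha r) (fun y => Df y ord0 i) - mu *: conv (kgrad a r i) f)//.
by apply/funext => x; rewrite mxE.
Qed.

(** The formula [fdivergenceE] is paired with [f]. In its near part the divergence is moved onto [f]
    for each fixed [h], which brings in [Df]; the far part contains no derivative and only needs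
    Fubini and duality. *)
Lemma fgrad_split_identity r phi : 0 < r -> is_weak_grad f Df -> test_field phi ->
  \int[lam]_x (f x * fdivergence alpha phi x) =
  - \int[lam]_x dotrV (fgrad_split r x) (phi x).
Proof.
move=> r0 [_ wDf] tp; have [q [q1 pq q0]] := conj_exponent p1.
have ikn := knear_integrable n0 alpha0 alpha1 r0.
have ikg i := @kgrad_integrable R n alpha r i n0 alpha0 r0.
have mkn := @measurable_knear R n alpha r; have mkg i := @measurable_kgrad R n a r i.
have Lphi i : Lp q (fun x => phi x ord0 i) by exact: test_field_Lp.
have mphi i := Lp_measurable q0 (Lphi i).
have Ldiv : Lp q (divergence phi) by exact: divergence_Lp.
have mdiv := Lp_measurable q0 Ldiv.
have [_ [i1 _]] := pairing_integrable p1 q1 pq ikn Lf Ldiv.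
have i2 i : lam.-integrable setT (EFin \o (fun x => f x * \int[lam]_h (kgrad a r i h * phi (x + h) ord0 i))).
  by have [_ [? _]] := pairing_integrable p1 q1 pq (ikg i) Lf (Lphi i).
have i3 i : lam.-integrable setT (EFin \o (fun h => knear alpha r h * \int[lam]_x (Df x ord0 i * phi (x + h) ord0 i))).
  by have [? _] := pairing_integrable p1 q1 pq ikn (LDi i) (Lphi i).
have i4 i : lam.-integrable setT (EFin \o (fun x => conv (knear alpha r) (fun y => Df y ord0 i) x * phi x ord0 i)).
  by have [_ [_ ?]] := pairing_integrable p1 q1 pq ikn (LDi i) (Lphi i).
have i5 i : lam.-integrable setT (EFin \o (fun x => conv (kgrad a r i) f x * phi x ord0 i)).
  by have [_ [_ ?]] := pairing_integrable p1 q1 pq (ikg i) Lf (Lphi i).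
have near_part : \int[lam]_x (f x * \int[lam]_h (knear alpha r h * divergence phi (x + h))) =
    - \sum_i \int[lam]_x (conv (knear alpha r) (fun y => Df y ord0 i) x * phi x ord0 i).
  rewrite (conv_Fubini p0 q0 pq ikn Lf Ldiv).
  transitivity (\int[lam]_h (- \sum_i (knear alpha r h * \int[lam]_x (Df x ord0 i * phi (x + h) ord0 i)))).
    (* For fixed [h], the translate of [phi] is itself a test field, so the definition of the weak
       gradient applies to it. *)
    apply: eq_Rintegral => h _; have th := test_field_shift h tp.
    have := wDf _ th; under eq_Rintegral do rewrite divergence_shift.
    move=> ->; rewrite mulrN; congr (- _); rewrite -mulr_sumr; congr (_ * _).
    rewrite -Rintegral_sum// => i.
    by apply: (Lp_integrableM p0 q0 pq (LDi i)); exact: (test_field_Lp i q0 th).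
  have mS : measurable_fun setT (fun h => \sum_i (knear alpha r h * \int[lam]_x (Df x ord0 i * phi (x + h) ord0 i))).
    by apply: measurable_sum => i; have /integrable_EFinP[] := i3 i.
  rewrite RintegralN_measurable// Rintegral_sum//; congr (- _); apply: eq_bigr => i _.
  exact: conv_adjoint p0 q0 pq ikn (LDi i) (Lphi i).
have far_part i : \int[lam]_x (f x * \int[lam]_h (kgrad a r i h * phi (x + h) ord0 i)) =
    \int[lam]_x (conv (kgrad a r i) f x * phi x ord0 i).
  by rewrite (conv_Fubini p0 q0 pq (ikg i) Lf (Lphi i)) (conv_adjoint p0 q0 pq (ikg i) Lf (Lphi i)).
transitivity (mu / a * - (\sum_i \int[lam]_x (conv (knear alpha r) (fun y => Df y ord0 i) x * phi x ord0 i)) +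
   mu * \sum_i \int[lam]_x (conv (kgrad a r i) f x * phi x ord0 i)).
  have m1 := ((integrable_EFinP _ _).1 i1).1.
  have mS : measurable_fun setT (fun x => \sum_i (f x * \int[lam]_h (kgrad a r i h * phi (x + h) ord0 i))).
    by apply: measurable_sum => i; have /integrable_EFinP[] := i2 i.
  rewrite -near_part -RintegralZl_measurable//.
  under eq_bigr do rewrite -far_part.
  rewrite -Rintegral_sum// -RintegralZl_measurable// -RintegralD//.
  - apply: eq_Rintegral => x _; rewrite (fdivergenceE n0 alpha0 alpha1 x r0 tp) mulrDr.
    by congr (_ + _); [rewrite mulrCA|rewrite mulrCA -mulr_sumr].
  - by have := integrableZl measurableT (mu / a) i1; apply: eq_integrable.
  - have := integrableZl measurableT mu (integrable_sum_EFin (index_enum _) i2).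
    by apply: eq_integrable.
transitivity (- \sum_i \int[lam]_x (fgrad_split r x ord0 i * phi x ord0 i)); last first.
  congr (- _); rewrite -Rintegral_sum// => i.
  exact: Lp_integrableM p0 q0 pq (fgrad_split_Lp_coord i r0) (Lphi i).
rewrite mulrN !mulr_sumr -!sumrN -big_split/=; apply: eq_bigr => i _.
have m4 := ((integrable_EFinP _ _).1 (i4 i)).1.
have m5 := ((integrable_EFinP _ _).1 (i5 i)).1.
rewrite -!RintegralZl_measurable// addrC -opprB; congr (- _).
rewrite -RintegralB//; last 2 first.
- by have := integrableZl measurableT (mu / a) (i4 i); apply: eq_integrable.
- by have := integrableZl measurableT mu (i5 i); apply: eq_integrable.
by apply: eq_Rintegral => x _; rewrite mxE; ring.
Qed.

(** Majorant of the Euclidean norm of the vector kernel whose components are [kgrad]. *)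
Definition koff (r : R) (h : rV) : R := kpow (a + 1) h * off_ball r h.

Lemma koff_ge0 r h : 0 <= koff r h.
Proof. by rewrite mulr_ge0 ?kpow_ge0// off_ballE. Qed.

Lemma measurable_koff r : measurable_fun setT (koff r).
Proof. by apply: measurable_funM; [exact: measurable_kpow|exact: measurable_off_ball]. Qed.

Let a0 : 0 < a. Proof. exact: order_gt0. Qed.

(** The two convolutions are bounded as vector integrals, by the integral of the Euclidean norm, and
    not componentwise; no dimensional factor is lost. *)
Lemma enorm_fgrad_split r x : 0 <= mu ->
  ((enorm (fgrad_split r x))%:E <=
   (mu / a)%:E * econv (knear alpha r) (fun y => enorm (Df y)) x +
   mu%:E * econv (koff r) (fun y => `|f y|%R) x)%E.
Proof.
move=> mu0; pose A : rV := \row_i conv (knear alpha r) (fun y => Df y ord0 i) x.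
pose B : rV := \row_i conv (kgrad a r i) f x.
have -> : fgrad_split r x = (mu / a) *: A - mu *: B.
  by apply/rowP => i; rewrite !mxE.
have mua0 : 0 <= mu / a by rewrite divr_ge0// ltW.
apply: (@le_trans _ _ ((mu / a) * enorm A + mu * enorm B)%:E).
  rewrite lee_fin; apply: le_trans (ler_enormD _ _) _.
  by rewrite enormN !enormZ !ger0_norm.
rewrite EFinD !EFinM; apply: leeD; apply: lee_wpmul2l; rewrite ?lee_fin//.
- have mV : measurable_fun setT (fun h => knear alpha r h *: Df (x - h)).
    apply: measurable_fun_rV => i; under eq_fun do rewrite mxE.
    exact: (@measurable_conv_slice R n _ (fun y => Df y ord0 i) x (measurable_knear _ _) (mDi i)).
  have -> : A = \row_i \int[lam]_h ((knear alpha r h *: Df (x - h)) ord0 i).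
    by apply/rowP => i; rewrite !mxE; apply: eq_Rintegral => h _; rewrite mxE.
  apply: le_trans (enorm_Rintegral lam mV) _.
  rewrite le_eqVlt; apply/orP; left; apply/eqP; apply: eq_integral => h _.
  by rewrite enormZ ger0_norm// knear_ge0.
- have mV : measurable_fun setT (fun h : rV => (f (x - h) * (kpow (a + 2) h * off_ball r h)) *: h).
    apply: measurable_fun_rV => i; under eq_fun do rewrite mxE.
    apply: measurable_funM; last exact: measurable_coord.
    apply: measurable_funM; last by apply: measurable_funM; [exact: measurable_kpow|exact: measurable_off_ball].
    by apply: measurableT_comp => //; exact: measurable_fun_rVB.
  have -> : B = \row_i \int[lam]_h (((f (x - h) * (kpow (a + 2) h * off_ball r h)) *: h) ord0 i).
    by apply/rowP => i; rewrite !mxE; apply: eq_Rintegral => h _; rewrite mxE /kgrad; ring.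
  apply: le_trans (enorm_Rintegral lam mV) _; apply: ge0_le_integral => //.
  + by move=> h _; rewrite lee_fin enorm_ge0.
  + by apply/measurable_EFinP; apply: measurableT_comp => //; exact: measurable_enorm.
  + apply/measurable_EFinP.
    apply: (@measurable_conv_slice R n _ (fun y => `|f y|) x (measurable_koff r)).
    exact: measurableT_comp.
  + move=> h _; rewrite lee_fin enormZ normrM mulrC mulrCA [leRHS]mulrC ler_wpM2l//.
    have o0 : 0 <= off_ball r h by rewrite off_ballE.
    rewrite ger0_norm ?mulr_ge0 ?kpow_ge0// mulrA ler_wpM2r//.
    by rewrite (_ : a + 2 = a + 1 + 1) ?enorm_kpow//; ring.
Qed.

End split_gradient.

(** * Uniqueness of weak gradients *)

Section weak_uniqueness.
Context {R : realType} {n : nat}.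
Notation rV := ('rV[R]_n).
Notation lam := (@lebesgue_rV R n).

Lemma compact_integrable_coord (g : rV -> rV) i (K : set rV) : L1loc_field g -> compact K ->
  lam.-integrable K (EFin \o (fun x => g x ord0 i)).
Proof.
move=> [mg gK] cK; apply: le_integrable (gK K cK).
- exact: compact_measurable_rV.
- apply/measurable_EFinP; apply: measurable_funS (measurableT_comp (measurable_coord i) mg) => //.
- by move=> x _ /=; rewrite lee_fin [leRHS]ger0_norm ?enorm_ge0// coord_le_enorm.
Qed.

(** A product of bumps times a basis vector isolates one component of the difference, to which the
    fundamental lemma applies. The operator [dv] is arbitrary, so the classical and the fractional
    gradient are treated together. *)
Lemma weak_adjoint_unique (dv : (rV -> rV) -> rV -> R) (f : rV -> R) (g1 g2 : rV -> rV) :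
  weak_adjoint dv f g1 -> weak_adjoint dv f g2 -> {ae lam, forall x, g1 x = g2 x}.
Proof.
move=> [l1 w1] [l2 w2].
have mgi (g : rV -> rV) i : L1loc_field g -> measurable_fun setT (fun x => g x ord0 i).
  by move=> [mg _]; exact: measurableT_comp (measurable_coord i) mg.
suff H i : {ae lam, forall x, g1 x ord0 i - g2 x ord0 i = 0}.
  have : {ae lam, forall x, forall i, g1 x ord0 i - g2 x ord0 i = 0}.
    (* The finitely many indices are embedded in the natural numbers; beyond [n] the condition is
       vacuous. *)
    have := @ae_foralln _ _ _ lam (fun k x => forall i : 'I_n, i = k :> nat -> g1 x ord0 i - g2 x ord0 i = 0).
    move=> h; apply: filterS (h _) => [x hx i|k]; first exact: hx.
    case: (ltnP k n) => kn; last first.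
      by apply: aeW => x i ik; move: (ltn_ord i); rewrite ik ltnNge kn.
    apply: filterS (H (Ordinal kn)) => x hx i ik.
    by rewrite (_ : i = Ordinal kn)//; exact: val_inj.
  by apply: filterS => x hx; apply/rowP => i; apply/eqP; rewrite -subr_eq0 hx.
have loc (g : rV -> rV) := @compact_integrable_coord g i.
apply: fundamental_lemma.
- by apply: measurable_funB; exact: mgi.
- move=> K cK; have := integrableB (compact_measurable_rV cK) (loc _ _ l1 cK) (loc _ _ l2 cK).
  by apply: eq_integrable => //; exact: compact_measurable_rV.
move=> a b k; set T := tensor _; have tT := test_field_tensor_bump a b (delta_mx ord0 i) k.
have mT : measurable_fun setT T.
  by apply: continuous_measurable_rV; apply: continuous_tensor => j; exact: (smooth1_bump _ _ _ 0%N).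
have iT (g : rV -> rV) : L1loc_field g -> lam.-integrable setT (EFin \o (fun x => g x ord0 i * T x)).
  move=> lg; have /test_fieldP[_ [c hc]] := tT.
  have [M M0 hM] := test_field_bounded tT.
  pose K : set rV := [set y : rV | forall j, - c <= y ord0 j <= c].
  have cK : compact K by apply: compact_cbox.
  have mK := compact_measurable_rV cK.
  have h := (integrable_mkcond _ mK).1 (loc g K lg cK).
  have := integrableZl measurableT M h.
  apply: le_integrable => //; first by apply/measurable_EFinP; apply: measurable_funM => //; exact: mgi.
  move=> x _; rewrite /= patchE; case: ifPn => xK.
    rewrite abseM /= -EFinM lee_fin normrM mulrC ler_wpM2r// [leRHS]ger0_norm//.
    have := hM x; rewrite enormZ enorm_delta mulr1; exact.
  have [T0|T0] := eqVneq (T x) 0; first by rewrite T0 mulr0 normr0 abse_ge0.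
  move: xK; rewrite notin_setE; apply: contra_notP => _ j; rewrite -ler_norml; apply: hc.
  rewrite scaler_eq0 negb_or T0/=; apply/eqP => /rowP/(_ i).
  by rewrite !mxE !eqxx => /eqP; rewrite oner_eq0.
have E (g : rV -> rV) : \int[lam]_x dotrV (g x) (T x *: delta_mx ord0 i) = \int[lam]_x (g x ord0 i * T x).
  apply: eq_Rintegral => x _; rewrite /dotrV (bigD1 i)//= !mxE !eqxx mulr1 big1 ?addr0// => j ji.
  by rewrite !mxE (negbTE ji) andbF !mulr0.
under eq_Rintegral do rewrite mulrBl.
rewrite RintegralB//; [|exact: iT..].
apply/eqP; rewrite subr_eq0 -!E; apply/eqP/oppr_inj.
by rewrite -(w1 _ tT) -(w2 _ tT).
Qed.

End weak_uniqueness.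

(** * Local L^p bounds for convolutions *)

Section local_estimate.
Context {R : realType} {n : nat}.
Notation rV := ('rV[R]_n).
Notation lam := (@lebesgue_rV R n).
Implicit Types (k w u v g e : rV -> R) (A E : set rV) (p r c K : R).

Lemma Lp_norm_le p A g e : 0 < p -> measurable A ->
  measurable_fun setT g -> measurable_fun setT e ->
  {ae lam, forall x, A x -> `|g x| <= `|e x|} -> (Lp_norm A p g <= Lp_norm setT p e)%E.
Proof.
move=> p0 mA mg me ge; rewrite !Lp_normE//.
apply: ge0_le_poweR; first by rewrite invr_ge0 ltW.
  by apply: integral_ge0 => x _; rewrite lee_fin powR_ge0.
have mp u : measurable_fun setT u -> measurable_fun setT (fun x => (`|u x| `^ p)%:E).
  by move=> mu; apply/measurable_EFinP; apply: measurable_powR_comp; exact: measurableT_comp.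
apply: (@le_trans _ _ (\int[lam]_(x in A) (`|e x| `^ p)%:E)%E).
  apply: ae_ge0_le_integral => //.
  - by apply: measurable_funS (mp _ mg).
  - by apply: measurable_funS (mp _ me).
  - apply: filterS ge => x h Ax; rewrite lee_fin; apply: ge0_ler_powR; rewrite ?nnegrE ?(ltW p0)//.
    exact: h.
by apply: ge0_subset_integral => //; exact: mp.
Qed.

Lemma Lp_norm_field_mono p A E (g : rV -> rV) : 0 < p -> measurable A -> measurable E ->
  measurable_fun setT g -> A `<=` E -> (Lp_norm_field A p g <= Lp_norm_field E p g)%E.
Proof.
move=> p0 mA mE mg AE; rewrite /Lp_norm_field !Lp_normE//.
apply: ge0_le_poweR; first by rewrite invr_ge0 ltW.
  by apply: integral_ge0 => x _; rewrite lee_fin powR_ge0.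
apply: ge0_subset_integral => //.
apply/measurable_EFinP; apply: measurable_funS measurableT _ _ => //.
apply: measurable_powR_comp; apply: measurableT_comp => //.
exact: measurableT_comp (@measurable_enorm R n) mg.
Qed.

Lemma ae_econv_fin p k w : 0 < p -> measurable_fun setT k -> measurable_fun setT w ->
  (forall x, 0 <= k x) -> (forall x, 0 <= w x) ->
  (\int[lam]_x (econv k w x `^ p) < +oo)%E -> {ae lam, forall x, econv k w x \is a fin_num}.
Proof.
move=> p0 mk mw k0 w0 oo.
have me := measurable_econv mk mw k0 w0.
have : lam.-integrable setT (fun x => econv k w x `^ p)%E.
  apply/integrableP; split.
    by apply: (@measurableT_comp _ _ _ _ _ _ (fun y : \bar R => (y `^ p)%E)) => //; exact: measurable_poweR.
  by under eq_integral do rewrite gee0_abs ?poweR_ge0//.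
move=> /(integrable_ae measurableT); apply: filterS => x /(_ I) h.
rewrite ge0_fin_numE ?econv_ge0//; apply: (@lty_poweRy _ _ p); first by rewrite gt_eqF.
by rewrite -ge0_fin_numE ?poweR_ge0.
Qed.

(** The norm is taken of a real function. Replacing infinite values by [0] can only decrease the
    integral, so Young's inequality still bounds it. *)
Lemma Lp_norm_econv p c k w K : 1 < p -> 0 <= c -> 0 <= K ->
  measurable_fun setT k -> measurable_fun setT w ->
  (forall x, 0 <= k x) -> (forall x, 0 <= w x) -> (\int[lam]_h (k h)%:E <= K%:E)%E ->
  (Lp_norm setT p (fun x => c * fine (econv k w x))%R <= (c * K)%:E * Lp_norm setT p w)%E.
Proof.
move=> p1 c0 K0 mk mw k0 w0 kK; have p0 : 0 < p by exact: lt_trans p1.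
have me := measurable_econv mk mw k0 w0.
have mf : measurable_fun setT (fun x => fine (econv k w x)).
  by apply: measurableT_comp => //; exact: fine_measurable.
have mep : measurable_fun setT (fun x => econv k w x `^ p)%E.
  by apply: (@measurableT_comp _ _ _ _ _ _ (fun y : \bar R => (y `^ p)%E)) => //; exact: measurable_poweR.
have -> : ((c * K)%:E * Lp_norm setT p w = (((c * K) `^ p)%R%:E * \int[lam]_x (w x `^ p)%:E) `^ p^-1)%E.
  rewrite Lp_normE// poweRM; last 2 first.
  - by rewrite lee_fin powR_ge0.
  - by apply: integral_ge0 => x _; rewrite lee_fin powR_ge0.
  have cK0 : 0 <= c * K by rewrite mulr_ge0.
  have -> : (((c * K) `^ p)%R%:E `^ p^-1 = (c * K)%:E)%E.
    by rewrite poweR_EFin -powRrM divff ?gt_eqF// powRr1.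
  by congr (_ * _ `^ _)%E; apply: eq_integral => x _; rewrite ger0_norm.
rewrite Lp_normE//; apply: ge0_le_poweR; first by rewrite invr_ge0 ltW.
  by apply: integral_ge0 => x _; rewrite lee_fin powR_ge0.
rewrite powRM// EFinM -muleA.
apply: (@le_trans _ _ ((c `^ p)%R%:E * \int[lam]_x (econv k w x `^ p))%E); last first.
  by apply: lee_wpmul2l; [rewrite lee_fin powR_ge0|exact: young].
rewrite -ge0_integralZl_EFin//; [|by move=> x _; exact: poweR_ge0|exact: powR_ge0].
apply: ge0_le_integral => //.
- by apply/measurable_EFinP; apply: measurable_powR_comp; apply: measurableT_comp => //; exact: measurable_funM.
- by apply: measurable_funeM.
- move=> x _; have f0 : 0 <= fine (econv k w x) by rewrite fine_ge0// econv_ge0.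
  rewrite ger0_norm ?mulr_ge0// powRM// EFinM; apply: lee_wpmul2l; first by rewrite lee_fin powR_ge0.
  rewrite -poweR_EFin; apply: ge0_le_poweR; rewrite ?(ltW p0) ?lee_fin//.
  by have := econv_ge0 x k0 w0; case: (econv k w x) => //= _; rewrite leey.
Qed.

Lemma enlarge_subB A r x h : A x -> enorm h < r -> enlarge A r (x - h).
Proof.
move=> Ax hr; rewrite /enlarge /= /edist_rV; apply: (@le_lt_trans _ _ (enorm h)%:E); last by rewrite lte_fin.
by apply: ereal_inf_lbound; exists x => //; rewrite addrAC subrr add0r enormN.
Qed.

(** A kernel supported in the ball of radius [r] only sees points of the [r]-enlargement of [A]; its
    closure is a closed set, hence Borel. *)
Lemma econv_local k w A r x : (forall h, k h != 0 -> enorm h < r) -> A x ->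
  econv k w x = econv k (fun y => w y * \1_(closure (enlarge A r)) y) x.
Proof.
move=> ksupp Ax; apply: eq_integral => h _; have [->|/ksupp hr] := eqVneq (k h) 0.
  by rewrite !mul0r.
by rewrite indicE mem_set ?mulr1//; apply: subset_closure; exact: enlarge_subB.
Qed.

End local_estimate.

(** * Estimates for the split gradient *)

Section fgrad_estimates.
Context {R : realType} {n : nat}.
Notation rV := ('rV[R]_n).
Notation lam := (@lebesgue_rV R n).

Lemma Lp_norm_lty p A (g : rV -> R) : 0 < p -> measurable A -> Lp p g -> (Lp_norm A p g < +oo)%E.
Proof.
move=> p0 mA /(LpP _ p0)[mg goo]; rewrite Lp_normE//; apply: poweR_lty; apply: le_lt_trans goo.
apply: ge0_subset_integral => //.
by apply/measurable_EFinP; apply: measurable_powR_comp; exact: measurableT_comp.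
Qed.

Lemma Lp_norm_ge0 p A (g : rV -> R) : (0 <= Lp_norm A p g)%E.
Proof. exact: Lnorm_ge0. Qed.

Lemma mu_const_ge0 (alpha : R) : 0 <= mu_const n alpha.
Proof.
have G0 (s : R) : 0 <= Gamma s.
  by apply: Rintegral_ge0 => t _; rewrite mulr_ge0 ?powR_ge0 ?expR_ge0.
by rewrite /mu_const !mulr_ge0 ?powR_ge0 ?invr_ge0.
Qed.

Variables (alpha p : R) (n0 : (0 < n)%N) (alpha0 : 0 < alpha) (alpha1 : alpha < 1) (p1 : 1 < p).
Variables (f : rV -> R) (Df : rV -> rV).
Hypotheses (Lf : Lp p f) (LDf : Lp_field p Df).
Let a : R := n%:R + alpha - 1.
Let mu := mu_const n alpha : R.
Let p0 : 0 < p. Proof. exact: lt_trans p1. Qed.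
Let a0 : 0 < a. Proof. exact: order_gt0. Qed.
Let mf : measurable_fun setT f. Proof. exact: Lp_measurable p0 Lf. Qed.
Let mDf : measurable_fun setT Df. Proof. by case: LDf. Qed.
Let mw : measurable_fun setT (fun y => enorm (Df y)).
Proof. exact: measurableT_comp (@measurable_enorm R n) mDf. Qed.
Let mabs : measurable_fun setT (fun y => `|f y|). Proof. exact: measurableT_comp. Qed.

Lemma integral_knear r : 0 < r ->
  (\int[lam]_h (knear alpha r h)%:E <= (n%:R * omega n * (r `^ (1 - alpha) / (1 - alpha)))%:E)%E.
Proof.
move=> r0; have b0 : 0 < 1 - alpha by rewrite subr_gt0.
have bn : 1 - alpha < n%:R by rewrite ltrBlDr ltr_pwDr// ler1n.
apply: le_trans (integral_kpow_near b0 bn r0); apply: ge0_le_integral => //.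
- by move=> h _; rewrite lee_fin knear_ge0.
- by apply/measurable_EFinP; exact: measurable_knear.
- by apply/measurable_EFinP; apply: measurable_funM; [exact: measurable_kpow|exact: measurable_near_ball].
- move=> h _; rewrite lee_fin (_ : n%:R - (1 - alpha) = n%:R + alpha - 1) ?knear_le//; ring.
Qed.

Lemma integral_koff r : 0 < r ->
  (\int[lam]_h (koff alpha r h)%:E <= (n%:R * omega n * (r `^ (- alpha) / alpha))%:E)%E.
Proof.
move=> r0; apply: le_trans (integral_kpow_off n0 alpha0 r0).
rewrite le_eqVlt; apply/orP; left; apply/eqP; apply: eq_integral => h _.
by rewrite /koff (_ : n%:R + alpha - 1 + 1 = n%:R + alpha)//; ring.
Qed.

Let nw0 : 0 <= n%:R * omega n :> R. Proof. by rewrite mulr_ge0 ?omega_ge0. Qed.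
Let mua0 : 0 <= mu / a. Proof. by rewrite divr_ge0 ?mu_const_ge0 ?(ltW a0). Qed.

(** On [A], the near convolution is unchanged when [|Df|] is cut off outside the closed enlargement.
    Young's inequality then bounds each term over the whole space, and Minkowski's inequality adds
    them. *)
Lemma fgrad_split_local r (A : set rV) : 0 < r -> measurable A ->
  (Lp_norm_field A p (fgrad_split alpha f Df r) <=
   (mu / a * (n%:R * omega n * (r `^ (1 - alpha) / (1 - alpha))))%:E *
     Lp_norm_field (closure (enlarge A r)) p Df +
   (mu * (n%:R * omega n * (r `^ (- alpha) / alpha)))%:E * Lp_norm setT p f)%E.
Proof.
move=> r0 mA; pose E := closure (enlarge A r).
have mE : measurable E by apply: closed_measurable_rV; exact: closed_closure.
pose w1 (y : rV) : R := enorm (Df y) * \1_E y.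
have mw1 : measurable_fun setT w1 by apply: measurable_funM => //; exact: measurable_indic.
have w10 y : 0 <= w1 y by rewrite mulr_ge0 ?enorm_ge0.
have Lw1 : Lp_norm setT p w1 = Lp_norm_field E p Df.
  rewrite /Lp_norm_field !Lp_normE//; apply: (congr1 (fun z => z `^ p^-1)%E).
  rewrite [RHS]integral_mkcond; apply: eq_integral => y _; rewrite patchE /w1 indicE.
  by case: (y \in E); rewrite ?mulr1// mulr0 normr0 powR0 ?gt_eqF.
have w1oo : (\int[lam]_y (w1 y `^ p)%:E < +oo)%E.
  have [_ Doo] := (LpP _ p0).1 LDf.2; apply: le_lt_trans Doo; apply: ge0_le_integral => //.
  - by move=> y _; rewrite lee_fin powR_ge0.
  - by apply/measurable_EFinP; apply: measurable_powR_comp.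
  - by apply/measurable_EFinP; apply: measurable_powR_comp; exact: measurableT_comp.
  - move=> y _; rewrite lee_fin; apply: ge0_ler_powR; rewrite ?nnegrE ?(ltW p0)//=.
    by rewrite [leRHS]ger0_norm ?enorm_ge0// /w1 ler_piMr ?enorm_ge0// indicE; case: (y \in E).
have k10 := @knear_ge0 R n alpha r; have k20 := @koff_ge0 R n alpha r.
have mk1 := @measurable_knear R n alpha r; have mk2 := @measurable_koff R n alpha r.
pose K1 : R := n%:R * omega n * (r `^ (1 - alpha) / (1 - alpha)).
pose K2 : R := n%:R * omega n * (r `^ (- alpha) / alpha).
have K10 : 0 <= K1 by rewrite mulr_ge0// divr_ge0 ?powR_ge0// subr_ge0 ltW.
have K20 : 0 <= K2 by rewrite mulr_ge0// divr_ge0 ?powR_ge0// ltW.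
(* Both convolutions are finite almost everywhere, and there the real functions [e1] and [e2] carry
   the full extended bound. *)
have fin1 : {ae lam, forall x, econv (knear alpha r) w1 x \is a fin_num}.
  apply: (ae_econv_fin p0) => //; apply: le_lt_trans (young p1 K10 mk1 mw1 k10 w10 (integral_knear r0)) _.
  by rewrite lte_mul_pinfty// lee_fin powR_ge0.
have fin2 : {ae lam, forall x, econv (koff alpha r) (fun y => `|f y|)%R x \is a fin_num}.
  apply: (ae_econv_fin p0) => //.
  apply: le_lt_trans (young p1 K20 mk2 mabs k20 (fun y => normr_ge0 _) (integral_koff r0)) _.
  by rewrite lte_mul_pinfty ?lee_fin ?powR_ge0//; exact: ((LpP _ p0).1 Lf).2.
pose e1 x : R := mu / a * fine (econv (knear alpha r) w1 x).
pose e2 x : R := mu * fine (econv (koff alpha r) (fun y => `|f y|)%R x).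
have me1 : measurable_fun setT e1.
  apply: measurable_funM => //; apply: measurableT_comp; first exact: fine_measurable.
  exact: measurable_econv.
have me2 : measurable_fun setT e2.
  apply: measurable_funM => //; apply: measurableT_comp; first exact: fine_measurable.
  exact: measurable_econv.
apply: (@le_trans _ _ (Lp_norm setT p (e1 \+ e2))).
  apply: Lp_norm_le => //.
  - apply: measurableT_comp; first exact: measurable_enorm.
    exact: (measurable_fgrad_split alpha p1 Lf LDf r).
  - exact: measurable_funD.
  - apply: filterS2 fin1 fin2 => x f1 f2 Ax.
    rewrite /= ger0_norm ?enorm_ge0//; apply: le_trans (ler_norm _).
    rewrite -lee_fin (EFinD (e1 x)) (EFinM (mu / a) (fine _)) (EFinM mu (fine _)) !fineK//.
    have := enorm_fgrad_split n0 alpha0 p1 Lf LDf r x (mu_const_ge0 alpha).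
    rewrite (@econv_local _ _ _ (fun y => enorm (Df y)) A r)// => h kh.
    have [//|hr] := ltP (enorm h) r; move/eqP: kh; case; apply/eqP.
    rewrite eq_le knear_ge0 andbT; apply: le_trans (knear_le _ _ _) _.
    by rewrite near_ballE ltNge hr mulr0.
apply: (@le_trans _ _ (Lp_norm setT p e1 + Lp_norm setT p e2)%E).
  by rewrite /Lp_norm !patch_setT; apply: minkowski_EFin => //; exact: ltW.
apply: leeD.
  rewrite -Lw1; exact: (Lp_norm_econv p1 mua0 K10 mk1 mw1 k10 w10 (integral_knear r0)).
rewrite (_ : Lp_norm setT p f = Lp_norm setT p (fun y => `|f y|)%R).
  exact: (Lp_norm_econv p1 (mu_const_ge0 _) K20 mk2 mabs k20 (fun y => normr_ge0 _) (integral_koff r0)).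
by rewrite !Lp_normE//; apply: (congr1 (fun z => z `^ p^-1)%E); apply: eq_integral => y _; rewrite normr_id.
Qed.

Lemma fgrad_split_Lp r : 0 < r -> Lp_field p (fgrad_split alpha f Df r).
Proof.
move=> r0; have mG := measurable_fgrad_split alpha p1 Lf LDf r; split => //.
have meG : measurable_fun setT (@enorm R n \o fgrad_split alpha f Df r).
  by apply: measurableT_comp => //; exact: measurable_enorm.
apply/(LpP _ p0); split => //.
have : (Lp_norm_field setT p (fgrad_split alpha f Df r) < +oo)%E.
  apply: le_lt_trans (fgrad_split_local r0 measurableT) _.
  have b0 : 0 <= 1 - alpha by rewrite subr_ge0 ltW.
  apply: lte_add_pinfty; apply: lte_mul_pinfty => //.
  - by rewrite lee_fin mulr_ge0// mulr_ge0// divr_ge0 ?powR_ge0.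
  - by apply: Lp_norm_lty LDf.2 => //; apply: closed_measurable_rV; exact: closed_closure.
  - by rewrite lee_fin mulr_ge0 ?mu_const_ge0// mulr_ge0// divr_ge0 ?powR_ge0 ?ltW.
  - exact: Lp_norm_lty.
rewrite /Lp_norm_field Lp_normE// => /lty_poweRy; apply.
by rewrite invr_eq0 gt_eqF.
Qed.

Lemma fgrad_split_is_weak_fgrad r : 0 < r -> is_weak_grad f Df ->
  is_weak_fgrad alpha f (fgrad_split alpha f Df r).
Proof.
move=> r0 wD; split; first exact: (Lp_field_L1loc p1 (fgrad_split_Lp r0)).
by move=> phi tp; exact: (fgrad_split_identity n0 alpha0 alpha1 p1 Lf LDf r0 wD tp).
Qed.

End fgrad_estimates.

(** * Optimization in the radius *)

Section interpolation.
Context {R : realType}.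
Implicit Types (x K s r D F N C alpha : R).

(** Settles the degenerate cases of the optimization, in which one of the two norms vanishes and no
    optimal radius exists. *)
Lemma le_decay_le0 x K s : 0 < s -> (forall r, 0 < r -> x <= K * r `^ (- s)) -> x <= 0.
Proof.
move=> s0 H; rewrite leNgt; apply/negP => x0.
have h : K * r `^ (- s) @[r --> +oo%R] --> K * 0.
  by apply: cvgM; [exact: cvg_cst|exact: powR_cvg_pinfty].
rewrite mulr0 in h.
have [r [r0 rx]] : exists r : R, 0 < r /\ K * r `^ (- s) < x.
  have : \forall r \near +oo%R, 0 < r /\ K * r `^ (- s) < x.
    near=> r; split; first by near: r; exact: nbhs_pinfty_gt.
    by near: r; exact: (cvgr_lt _ h).
  by move=> /filter_ex.
by have := H r r0; rewrite leNgt rx.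
Unshelve. all: by end_near. Qed.

(* [N = n + 2 alpha - 1]; the optimal radius is [r = N F / D]. *)
Lemma interpolate x C N D F alpha : 0 < alpha -> alpha < 1 -> 0 < N -> 0 <= C -> 0 <= D -> 0 <= F ->
  (forall r, 0 < r -> x <= C * (D * (r `^ (1 - alpha) / (1 - alpha)) + N / alpha * F * r `^ (- alpha))) ->
  x <= N `^ (1 - alpha) * (C / (alpha * (1 - alpha))) * D `^ alpha * F `^ (1 - alpha).
Proof.
move=> al0 al1 N0 C0 D0 F0 H; have be0 : 0 < 1 - alpha by rewrite subr_gt0.
(* Without the gradient term the bound decays as the radius tends to infinity. *)
have [DE|Dn] := eqVneq D 0.
  rewrite DE powR0 ?gt_eqF// mulr0 mul0r; apply: (@le_decay_le0 x (C * (N / alpha * F)) _ al0).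
  by move=> r r0; have := H r r0; rewrite DE mul0r add0r !mulrA.
have [FE|Fn] := eqVneq F 0.
  rewrite FE powR0 ?gt_eqF// mulr0; apply: (@le_decay_le0 x (C * D / (1 - alpha)) _ be0).
  (* Here the radius has to tend to [0], so the hypothesis is used at [r^-1]. *)
  move=> r r0; have := H (r `^ (- 1)) (powR_gt0 _ r0).
  by rewrite FE mulr0 mul0r addr0 -powRrM mulN1r !mulrA mulrAC.
have Dp : 0 < D by rewrite lt_def Dn.
have Fp : 0 < F by rewrite lt_def Fn.
have u0 : 0 < N * F by rewrite mulr_gt0.
pose r := N * F / D; have r0 : 0 < r by rewrite divr_gt0.
apply: le_trans (H r r0) _; rewrite le_eqVlt; apply/orP; left; apply/eqP.
have rE s : r `^ s = (N * F) `^ s / D `^ s.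
  by rewrite /r powRM ?invr_ge0 ?(ltW u0)// -powR_inv1 ?(ltW Dp)// -!powRrM mulN1r powRN.
have split1 y : 0 < y -> y = y `^ alpha * y `^ (1 - alpha).
  by move=> y0; rewrite -powRD ?(gt_eqF y0) ?implybT// addrCA subrr addr0 powRr1// ltW.
rewrite powRN !rE.
have VE : (N * F) `^ (1 - alpha) = N `^ (1 - alpha) * F `^ (1 - alpha) by rewrite powRM// ltW.
have DE := split1 D Dp; have FE : N / alpha * F = (N * F) `^ alpha * (N * F) `^ (1 - alpha) / alpha.
  by rewrite -split1//; ring.
rewrite FE VE; set A := D `^ alpha in DE *; set B := D `^ (1 - alpha) in DE *.
set U := (N * F) `^ alpha.
have A0 : A != 0 by rewrite gt_eqF ?powR_gt0.
have B0 : B != 0 by rewrite gt_eqF ?powR_gt0.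
have U0 : U != 0 by rewrite gt_eqF ?powR_gt0.
rewrite {1}DE; field.
by rewrite A0 B0 U0 !gt_eqF.
Qed.

End interpolation.

(** * Representation by the Riesz potential *)

Section riesz_representation.
Context {R : realType} {n : nat}.
Notation rV := ('rV[R]_n).
Notation lam := (@lebesgue_rV R n).
Variables (alpha p : R) (n0 : (0 < n)%N) (alpha0 : 0 < alpha) (alpha1 : alpha < 1) (p1 : 1 < p).
Variables (f : rV -> R) (Df : rV -> rV).
Hypotheses (Lf : Lp p f) (LDf : Lp_field p Df) (pn : p < n%:R / (1 - alpha)).
Let a : R := n%:R + alpha - 1.
Let mu := mu_const n alpha : R.
Let q : R := n%:R * p / (n%:R - (1 - alpha) * p).
Let p0 : 0 < p. Proof. exact: lt_trans p1. Qed.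
Let a0 : 0 < a. Proof. exact: order_gt0. Qed.
Let mf : measurable_fun setT f. Proof. exact: Lp_measurable p0 Lf. Qed.
Let mDf : measurable_fun setT Df. Proof. by case: LDf. Qed.
Let mw : measurable_fun setT (fun y => enorm (Df y)).
Proof. exact: measurableT_comp (@measurable_enorm R n) mDf. Qed.
Let w0 y : 0 <= enorm (Df y). Proof. exact: enorm_ge0. Qed.
Let mDi i : measurable_fun setT (fun y => Df y ord0 i).
Proof. exact: Lp_measurable p0 (Lp_field_coord i p0 LDf). Qed.
Let b0 : 0 < 1 - alpha. Proof. by rewrite subr_gt0. Qed.
Let aE : n%:R - (1 - alpha) = a. Proof. by rewrite /a; ring. Qed.
Let bpn : (1 - alpha) * p < n%:R. Proof. by move: pn; rewrite ltr_pdivlMr// mulrC. Qed.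
Let q0 : 0 < q. Proof. by rewrite divr_gt0 ?mulr_gt0 ?ltr0n// subr_gt0. Qed.

Lemma rieszE (u : rV -> rV) x : (forall i, measurable_fun setT (fun y => u y ord0 i)) ->
  riesz alpha u x = \row_i (mu / a * conv (kpow a) (fun y => u y ord0 i) x).
Proof.
move=> mu_; apply/rowP => i; rewrite !mxE; congr (_ * _).
rewrite /conv -[RHS](@Rintegral_rV_reflect _ _ x); last first.
  exact: (@measurable_conv_slice R n _ (fun y => u y ord0 i) x (measurable_kpow _) (mu_ i)).
by apply: eq_Rintegral => y _; rewrite subKr mulrC.
Qed.

Let econv_w x := econv (kpow a) (fun y => enorm (Df y)) x.

Lemma econv_order_Lq : (\int[lam]_x (econv_w x `^ q) < +oo)%E.
Proof.
have [_ Doo] := (LpP _ p0).1 LDf.2.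
rewrite /econv_w -aE; apply: hardy_littlewood_sobolev => //.
apply: le_lt_trans Doo; rewrite le_eqVlt; apply/orP; left; apply/eqP.
by apply: eq_integral => y _; rewrite /= ger0_norm.
Qed.

Lemma ae_econv_order_fin : {ae lam, forall x, econv_w x \is a fin_num}.
Proof.
apply: (ae_econv_fin q0) => //; [exact: measurable_kpow|by move=> h; exact: kpow_ge0|].
exact: econv_order_Lq.
Qed.

Lemma enorm_riesz x : ((enorm (riesz alpha Df x))%:E <= (mu / a)%:E * econv_w x)%E.
Proof.
rewrite rieszE//.
have -> : \row_i (mu / a * conv (kpow a) (fun y => Df y ord0 i) x) =
    (mu / a) *: \row_i \int[lam]_h ((kpow a h *: Df (x - h)) ord0 i).
  by apply/rowP => i; rewrite !mxE; congr (_ * _); apply: eq_Rintegral => h _; rewrite mxE.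
have m0 : 0 <= mu / a by rewrite divr_ge0 ?mu_const_ge0 ?(ltW a0).
rewrite enormZ (ger0_norm m0) EFinM; apply: lee_wpmul2l; first by rewrite lee_fin.
have mV : measurable_fun setT (fun h => kpow a h *: Df (x - h)).
  apply: measurable_fun_rV => i; under eq_fun do rewrite mxE.
  exact: (@measurable_conv_slice R n _ (fun y => Df y ord0 i) x (measurable_kpow _) (mDi i)).
apply: le_trans (enorm_Rintegral lam mV) _.
rewrite le_eqVlt; apply/orP; left; apply/eqP; apply: eq_integral => h _.
by rewrite enormZ ger0_norm// kpow_ge0.
Qed.

Let rad (k : nat) : R := k.+1%:R.
Let rad1 k : 1 <= rad k. Proof. by rewrite ler1n. Qed.
Let rad0 k : 0 < rad k. Proof. exact: lt_le_trans (rad1 k). Qed.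

Let rad_decay s : 0 < s -> rad k `^ (- s) @[k --> \oo] --> (0 : R).
Proof.
move=> s0; apply: (@cvg_comp _ _ _ rad (fun r : R => r `^ (- s)) \oo (+oo%R)).
  by rewrite (@cvg_shiftS _ (fun k => k%:R : R)); exact: cvgr_idn.
exact: powR_cvg_pinfty.
Qed.

(** Once |h| is below the radius, [knear] equals |h|^-a minus a power of the radius that tends to
    [0]. The majorant [kpow a h * |Df (x - h)|] is integrable exactly because the extended
    convolution is finite at [x]. *)
Let near_part x i : econv_w x \is a fin_num ->
  conv (knear alpha (rad k)) (fun y => Df y ord0 i) x @[k --> \oo] -->
  conv (kpow a) (fun y => Df y ord0 i) x.
Proof.
move=> ex.
have mslice (k : rV -> R) : measurable_fun setT k -> measurable_fun setT (fun h => k h * Df (x - h) ord0 i).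
  by move=> mk; exact: (@measurable_conv_slice R n k (fun y => Df y ord0 i) x mk (mDi i)).
have mg : measurable_fun setT (fun h => kpow a h * enorm (Df (x - h))).
  exact: (@measurable_conv_slice R n (kpow a) (fun y => enorm (Df y)) x (measurable_kpow _) mw).
have ig : lam.-integrable setT (EFin \o (fun h => kpow a h * enorm (Df (x - h)))).
  apply/integrable_EFinP; split => //.
  move: ex; rewrite /econv_w fin_numElt => /andP[_].
  by under eq_integral do rewrite ger0_norm ?mulr_ge0 ?kpow_ge0//.
have kn_le k (h : rV) : knear alpha (rad k) h <= kpow a h.
  apply: (le_trans (knear_le alpha (rad k) h)); rewrite ler_piMr ?kpow_ge0// near_ballE.
  by case: (enorm h < rad k).
have [] // := Rintegral_dominated (fun k => mslice _ (measurable_knear alpha (rad k)))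
  (mslice _ (measurable_kpow a)) _ ig _.
- apply: filterS (esphere_negligible n0 0) => h; rewrite enorm_eq0 => h0.
  apply: cvgM; last exact: cvg_cst.
  have : kpow a h - rad k `^ (- a) @[k --> \oo] --> kpow a h - 0.
    by apply: cvgB; [exact: cvg_cst|exact: rad_decay].
  rewrite subr0; apply: cvg_trans; apply: near_eq_cvg; near=> k.
  have hk : enorm h <= rad k.
    near: k; have [N _ NP] := nbhs_infty_ger (enorm h); exists N => // m /= Nm.
    by apply: (le_trans (NP m Nm)); rewrite ler_nat.
  rewrite /knear (max_idPr _) ?subr_ge0 ?kcap_le_kpow//.
  by rewrite kcap_near// powRN.
- apply: aeW => h k; rewrite normrM; apply: ler_pM => //; last exact: coord_le_enorm.
  by rewrite ger0_norm ?knear_ge0.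
Unshelve. all: by end_near. Qed.

(** [hls_far] applied to [|f|] gives decay in the radius at every point [x]. *)
Let far_part x i : conv (kgrad a (rad k) i) f x @[k --> \oo] --> (0 : R).
Proof.
have [_ foo] := (LpP _ p0).1 Lf.
have mabs : measurable_fun setT (fun y => `|f y|) by exact: measurableT_comp.
have [C C0 hC] := @hls_far R n (1 - alpha) p (fun y => `|f y|) b0 p1 bpn mabs (fun y => normr_ge0 _) foo.
have e0 : 0 < n%:R / p - (1 - alpha) by rewrite subr_gt0 ltr_pdivlMr.
have bound k : `|conv (kgrad a (rad k) i) f x| <= C * rad k `^ (- (n%:R / p - (1 - alpha))).
  rewrite -lee_fin; apply: le_trans (hC (rad k) x (rad0 k)).
  apply: le_trans (le_abs_conv _ (measurable_kgrad _ _ _) mf) _; apply: ge0_le_integral => //.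
  - apply/measurable_EFinP; apply: (@measurable_conv_slice R n (fun h => `|kgrad a (rad k) i h|) (fun h => `|f h|)).
      by apply: measurableT_comp => //; exact: measurable_kgrad.
    exact: mabs.
  - apply/measurable_EFinP; apply: (@measurable_conv_slice R n _ (fun h => `|f h|)) => //.
    by apply: measurable_funM; [exact: measurable_kpow|exact: measurable_off_ball].
  - move=> h _; rewrite lee_fin ler_wpM2r// aE; apply: le_trans (kgrad_le _ _ _ _) _.
    rewrite !off_ballE; have [hk|_] := leP (rad k) (enorm h); last by rewrite !mulr0.
    rewrite !mulr1; have h1 : 1 <= enorm h by exact: le_trans hk.
    (* The radii are at least [1], so |h|^-(a+1) is at most |h|^-a off the ball, and the bound
       stated for the latter applies. *)
    by apply: le_trans (enorm_kpow a h); rewrite ler_peMl ?kpow_ge0.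
apply/norm_cvg0P; apply: (@squeeze_cvgr _ _ _ _ (fun=> 0) (fun k => C * rad k `^ (- (n%:R / p - (1 - alpha))))).
- by apply: nearW => k; rewrite normr_ge0 bound.
- exact: cvg_cst.
- by rewrite -(mulr0 C); apply: cvgM; [exact: cvg_cst|exact: rad_decay].
Qed.

(** Outside a single null set [Daf] equals the split gradient for every radius of a countable
    sequence. As a constant sequence it equals its limit, in which the far part disappears and the
    near kernel fills up to |h|^-a. *)
Lemma fgrad_riesz (Daf : rV -> rV) : is_weak_grad f Df -> is_weak_fgrad alpha f Daf ->
  {ae lam, forall x, Daf x = riesz alpha Df x}.
Proof.
move=> wD wa.
have : {ae lam, forall x, forall k, Daf x = fgrad_split alpha f Df (rad k) x}.
  apply/ae_foralln => k; apply: weak_adjoint_unique wa _.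
  exact: (fgrad_split_is_weak_fgrad n0 alpha0 alpha1 p1 Lf LDf (rad0 k) wD).
apply: filterS2 ae_econv_order_fin => x ex Dx; rewrite rieszE//; apply/rowP => i; rewrite mxE.
have h : mu / a * conv (knear alpha (rad k)) (fun y => Df y ord0 i) x
      - mu * conv (kgrad a (rad k) i) f x @[k --> \oo] -->
    mu / a * conv (kpow a) (fun y => Df y ord0 i) x - mu * 0.
  apply: cvgB; apply: cvgM; [exact: cvg_cst|exact: near_part|exact: cvg_cst|exact: far_part].
rewrite mulr0 subr0 in h.
apply: (@cvg_unique _ (@norm_hausdorff _ R^o) _ _ _ _ _ h).
by apply: cvg_near_cst; apply: nearW => k; rewrite (Dx k) mxE.
Qed.

(** The Riesz potential is dominated in norm by the convolution of the kernel with [|Df|], which the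
    Hardy-Littlewood-Sobolev inequality places in L^q. *)
Lemma fgrad_Lq (Daf : rV -> rV) : measurable_fun setT Daf ->
  {ae lam, forall x, Daf x = riesz alpha Df x} -> Lp_field q Daf.
Proof.
move=> mD DE; split => //.
have me : measurable_fun setT (@enorm R n \o Daf).
  by apply: measurableT_comp => //; exact: measurable_enorm.
have m0 : 0 <= mu / a by rewrite divr_ge0 ?mu_const_ge0 ?(ltW a0).
have mec : measurable_fun setT econv_w.
  by apply: measurable_econv => //; [exact: measurable_kpow|move=> h; exact: kpow_ge0].
have mep : measurable_fun setT (fun x => econv_w x `^ q)%E.
  by apply: (@measurableT_comp _ _ _ _ _ _ (fun y : \bar R => (y `^ q)%E)) => //; exact: measurable_poweR.
have ec0 x : (0 <= econv_w x)%E by apply: econv_ge0 => // h; exact: kpow_ge0.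
apply/(LpP _ q0); split => //.
apply: (@le_lt_trans _ _ (\int[lam]_x (((mu / a) `^ q)%R%:E * econv_w x `^ q))%E).
  apply: ae_ge0_le_integral => //.
  - by apply/measurable_EFinP; apply: measurable_powR_comp; exact: measurableT_comp.
  - by move=> x _; rewrite mule_ge0 ?poweR_ge0// lee_fin powR_ge0.
  - exact: measurable_funeM.
  - apply: filterS DE => x Dx _.
    have h : (((mu / a) `^ q)%R%:E * econv_w x `^ q = ((mu / a)%R%:E * econv_w x) `^ q)%E.
      by rewrite poweRM// lee_fin.
    rewrite h -poweR_EFin; apply: ge0_le_poweR; rewrite ?(ltW q0) ?lee_fin//.
    by rewrite /= ger0_norm ?enorm_ge0// Dx; exact: enorm_riesz.
rewrite ge0_integralZl_EFin ?powR_ge0//; last by move=> x _; exact: poweR_ge0.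
by rewrite lte_mul_pinfty ?lee_fin ?powR_ge0//; exact: econv_order_Lq.
Qed.

End riesz_representation.

(** * The estimates for arbitrary versions of the weak gradients *)

Theorem proposition3p3 (R : realType) (n : nat) (alpha p : R)
    (f : 'rV[R]_n -> R) :
  (1 <= n)%N -> 0 < alpha -> alpha < 1 -> 1 < p -> W1p p f ->
  Sap alpha p f /\
  forall Df Daf : 'rV[R]_n -> 'rV[R]_n,
    is_weak_grad f Df -> is_weak_fgrad alpha f Daf ->
    [/\ forall (r : R) (A : set 'rV[R]_n), 0 < r -> open A ->
          (Lp_norm_field A p Daf <=
           (n%:R * omega n * mu_const n alpha / (n%:R + alpha - 1))%:E *
           (Lp_norm_field (closure (enlarge A r)) p Df *
              (r `^ (1 - alpha) / (1 - alpha))%:E +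
            ((n%:R + 2 * alpha - 1) / alpha)%:E * Lp_norm setT p f *
              (r `^ (- alpha))%:E))%E,
        (Lp_norm_field setT p Daf <=
         ((n%:R + 2 * alpha - 1) `^ (1 - alpha) / (n%:R + alpha - 1) *
          (n%:R * omega n * mu_const n alpha / (alpha * (1 - alpha))))%:E *
         Lp_norm_field setT p Df `^ alpha * Lp_norm setT p f `^ (1 - alpha))%E
      & p < n%:R / (1 - alpha) ->
        {ae lebesgue_rV n, forall x, Daf x = riesz alpha Df x} /\
        Lp_field (n%:R * p / (n%:R - (1 - alpha) * p)) Daf].
Proof.
move=> n0 alpha0 alpha1 p1 [Lf [g [wg Lg]]].
have p0 : 0 < p by exact: lt_trans p1.
split.
  split => //; exists (fgrad_split alpha f g 1); split; last exact: fgrad_split_Lp.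
  exact: (fgrad_split_is_weak_fgrad n0 alpha0 alpha1 p1 Lf Lg (@ltr01 R) wg).
move=> Df Daf wD wa.
have mDf := wD.1.1; have mDaf := wa.1.1.
have men (h : 'rV[R]_n -> 'rV[R]_n) : measurable_fun setT h -> measurable_fun setT (@enorm R n \o h).
  by move=> mh; apply: measurableT_comp => //; exact: measurable_enorm.
(* [Df] is an arbitrary weak gradient; it lies in L^p because it equals almost everywhere the one
   provided by [W1p]. *)
have LDf : Lp_field p Df.
  split => //; apply/(LpP _ p0); split; first exact: men.
  have [_ goo] := (LpP _ p0).1 Lg.2; apply: le_lt_trans goo.
  rewrite le_eqVlt; apply/orP; left; apply/eqP; apply: ae_eq_integral => //.
  - by apply/measurable_EFinP; apply: measurable_powR_comp; apply: measurableT_comp => //; exact: men.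
  - by apply/measurable_EFinP; apply: measurable_powR_comp; apply: measurableT_comp => //; exact: men Lg.1.
  - by apply: filterS (weak_adjoint_unique wD wg) => x /= ->.
have a0 : 0 < n%:R + alpha - 1 :> R by exact: order_gt0.
set a := n%:R + alpha - 1 in a0 *; set mu := mu_const n alpha; set nw := n%:R * omega n.
set N := n%:R + 2 * alpha - 1.
have mu0 : 0 <= mu by exact: mu_const_ge0.
have nw0 : 0 <= nw by rewrite mulr_ge0 ?omega_ge0.
have b0 : 0 < 1 - alpha by rewrite subr_gt0.
(* Young's inequality gives the coefficient [a / alpha] for the term in [f]; it is enlarged to the
   stated [N / alpha]. *)
have aN : a <= N by rewrite /N /a; lra.
have N0 : 0 < N by exact: lt_le_trans aN.
have Ffin : Lp_norm setT p f \is a fin_num by rewrite ge0_fin_numE ?Lp_norm_ge0 ?Lp_norm_lty.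
have Dfin E : measurable E -> Lp_norm_field E p Df \is a fin_num.
  by move=> mE; rewrite ge0_fin_numE ?Lp_norm_ge0// Lp_norm_lty//; exact: LDf.2.
have local (r : R) (A : set 'rV[R]_n) : 0 < r -> open A ->
  (Lp_norm_field A p Daf <= (nw * mu / a)%:E *
    (Lp_norm_field (closure (enlarge A r)) p Df * (r `^ (1 - alpha) / (1 - alpha))%:E +
     (N / alpha)%:E * Lp_norm setT p f * (r `^ (- alpha))%:E))%E.
  move=> r0 oA; have mA : measurable A by exact: open_measurable_rV.
  have mE : measurable (closure (enlarge A r)) by apply: closed_measurable_rV; exact: closed_closure.
  have mG := measurable_fgrad_split alpha p1 Lf LDf r.
  apply: (@le_trans _ _ (Lp_norm_field A p (fgrad_split alpha f Df r))).
    suff -> : Lp_norm_field A p Daf = Lp_norm_field A p (fgrad_split alpha f Df r) by exact: lexx.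
    rewrite /Lp_norm_field (Lp_normE A _ p0) (Lp_normE A _ p0).
    apply: (congr1 (fun z => z `^ p^-1)%E); apply: ae_eq_integral => //.
    - apply/measurable_EFinP; apply: measurable_funS measurableT _ _ => //.
      by apply: measurable_powR_comp; apply: measurableT_comp => //; exact: men.
    - apply/measurable_EFinP; apply: measurable_funS measurableT _ _ => //.
      by apply: measurable_powR_comp; apply: measurableT_comp => //; exact: men.
    - have wG := fgrad_split_is_weak_fgrad n0 alpha0 alpha1 p1 Lf LDf r0 wD.
      by apply: filterS (weak_adjoint_unique wa wG) => x /= ->.
  apply: le_trans (fgrad_split_local n0 alpha0 alpha1 p1 Lf LDf r0 mA) _.
  have D0 := Lp_norm_ge0 p (closure (enlarge A r)) (@enorm R n \o Df).
  rewrite -/(Lp_norm_field _ _ _) in D0.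
  have F0 := Lp_norm_ge0 p setT f.
  rewrite -(fineK (Dfin _ mE)) -(fineK Ffin) -!EFinM -!EFinD lee_fin -/a -/mu -/nw.
  set d := fine _; set F := fine (Lp_norm _ _ f).
  have F00 : 0 <= F by rewrite fine_ge0.
  rewrite mulrDr; apply: lerD.
    by rewrite le_eqVlt; apply/orP; left; apply/eqP; ring.
  have -> : mu * (nw * (r `^ (- alpha) / alpha)) * F = nw * mu / alpha * (F * r `^ (- alpha)).
    by ring.
  have -> : nw * mu / a * (N / alpha * F * r `^ (- alpha)) = nw * mu / alpha * (F * r `^ (- alpha)) * (N / a).
    by ring.
  rewrite ler_peMr ?ler_pdivlMr ?mul1r//.
  by apply: mulr_ge0; [exact: divr_ge0 (mulr_ge0 nw0 mu0) (ltW alpha0)|exact: mulr_ge0 F00 (powR_ge0 _ _)].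
split => //; last first.
  move=> pn; have DE := fgrad_riesz n0 alpha0 alpha1 p1 Lf LDf pn wD wa.
  by split => //; exact: fgrad_Lq DE.
have Dtfin := Dfin _ measurableT.
have D0 : 0 <= fine (Lp_norm_field setT p Df) by rewrite fine_ge0// Lp_norm_ge0.
have F0 : 0 <= fine (Lp_norm setT p f) by rewrite fine_ge0// Lp_norm_ge0.
have global r : 0 < r -> (Lp_norm_field setT p Daf <= (nw * mu / a *
   (fine (Lp_norm_field setT p Df) * (r `^ (1 - alpha) / (1 - alpha)) +
    N / alpha * fine (Lp_norm setT p f) * r `^ (- alpha)))%:E)%E.
  move=> r0; apply: le_trans (local r setT r0 openT) _.
  have E (c x y z t s : R) : ((c * (x * y + z * t * s))%:E = c%:E * (x%:E * y%:E + z%:E * t%:E * s%:E))%E by [].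
  rewrite E (fineK Dtfin) (fineK Ffin).
  apply: lee_wpmul2l; first by rewrite lee_fin; exact: divr_ge0 (mulr_ge0 nw0 mu0) (ltW a0).
  apply: leeD => //; apply: lee_wpmul2r; first by rewrite lee_fin divr_ge0 ?powR_ge0 ?(ltW b0).
  (* On the whole space the norm over the enlargement is bounded by the norm over [setT], which
     frees it from [r] before optimizing. *)
  apply: Lp_norm_field_mono => //; apply: closed_measurable_rV; exact: closed_closure.
have Gfin : Lp_norm_field setT p Daf \is a fin_num.
  by rewrite ge0_fin_numE ?Lp_norm_ge0//; apply: le_lt_trans (global 1 ltr01) (ltry _).
have C0 : 0 <= nw * mu / a by exact: divr_ge0 (mulr_ge0 nw0 mu0) (ltW a0).
have := @interpolate R (fine (Lp_norm_field setT p Daf)) _ N _ _ alpha alpha0 alpha1 N0 C0 D0 F0.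
have globalR r : 0 < r -> fine (Lp_norm_field setT p Daf) <= nw * mu / a *
   (fine (Lp_norm_field setT p Df) * (r `^ (1 - alpha) / (1 - alpha)) +
    N / alpha * fine (Lp_norm setT p f) * r `^ (- alpha)).
  by move=> r0; rewrite -lee_fin fineK//; exact: global.
move=> /(_ globalR); rewrite -lee_fin (fineK Gfin) => /le_trans; apply.
rewrite -[in leRHS](fineK Dtfin) -[in leRHS](fineK Ffin) !poweR_EFin -!EFinM lee_fin.
rewrite le_eqVlt; apply/orP; left; apply/eqP; congr (_ * _ * _).
by field; rewrite !gt_eqF.
Qed.
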